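(* Let $G$ be a compact Lie group whose Lie algebra satisfies $[\mathfrak g,\mathfrak g]=\mathfrak g$ (e.g. $G$ semisimple), acting on a smooth map $F\colon M\to N$ and preserving a relative pre-$2$-plectic structure $\varpi\in\Omega^3(F)$, with $N$ connected and $M\neq\emptyset$. Then the action admits a one-step extension $\varpi-\mathrm M$ of $\varpi$ in the relative Cartan model, hence a relative homotopy moment map given by $f_1(x)=\mathrm M(x)$, $f_2(x,y)=\iota_{v_x}\mathrm M(y)$. (No fixed-point hypothesis is needed.)
   Context: All manifolds, maps, forms and actions are smooth. For smooth $F\colon M\to N$: $\Omega^k(F)=\Omega^k(N)\oplus\Omega^{k-1}(M)$ (forms of negative degree are $0$), $d_F(\alpha,\beta)=(d\alpha,\,F^*\alpha-d\beta)$. An $F$-pair is a pair $v=(v_N,v_M)$ of vector fields on $N$ and $M$ with $TF\circ v_M=v_N\circ F$; $\iota_v(\alpha,\beta)=(\iota_{v_N}\alpha,-\iota_{v_M}\beta)$; $\iota(v_1\wedge\dots\wedge v_k)=\iota_{v_k}\cdots\iota_{v_1}$. A relative pre-$2$-plectic structure is $\varpi\in\Omega^{3}(F)$ with $d_F\varpi=0$. An action of $G$ on $F$ is a pair of left actions on $M$ and $N$ making $F$ equivariant; $v_x|_p=\frac{d}{dt}|_{t=0}\exp(-tx)\cdot p$, $v_x=(v_x^N,v_x^M)$. The action preserves $\varpi$: both components of $\varpi$ are $G$-invariant. Relative Cartan model: for a $G$-manifold $P$, $C_G^k(P)=\bigoplus_{2p+q=k}(S^p\mathfrak g^\vee\otimes\Omega^q(P))^G$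 ($G$-equivariant polynomial maps $\mathfrak g\to\Omega(P)$), $(d_G\alpha)(x)=d(\alpha(x))-\iota_{v_x}(\alpha(x))$; $C_G(F)^k=C_G^k(N)\oplus C_G^{k-1}(M)$, $d_G^F(\alpha,\beta)=(d_G\alpha,F^*\alpha-d_G\beta)$. A one-step extension of $\varpi$ is a cocycle $\varpi-\mathrm M\in C_G(F)^3$, $d_G^F(\varpi-\mathrm M)=0$, with $\mathrm M\in(\mathfrak g^\vee\otimes\Omega^1(F))^G$. A relative homotopy moment map (for $n=2$) is an $L_\infty$-morphism from $\mathfrak g$ to the Lie $2$-algebra of relative observables of $(F,\varpi)$ lifting the action; concretely (and equivalently), linear maps $f_1\colon\mathfrak g\to\Omega^1(F)$, $f_2\colon\Lambda^2\mathfrak g\to\Omega^0(F)$ such that for all $x,y,z\in\mathfrak g$: $d_Ff_1(x)=-\iota_{v_x}\varpi$; $f_1([x,y])=d_Ff_2(x,y)+\iota(v_x\wedge v_y)\varpi$; $f_2([x,y],z)-f_2([x,z],y)+f_2([y,z],x)=-\iota(v_x\wedge v_y\wedge v_z)\varpi$. *)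

(* Defs.v *)
(* Smooth manifolds, differential forms, Lie group actions, the relative de Rham
   and relative Cartan complexes of a smooth map, over MathComp-Analysis.

   - The tangent space at p is identified with R^n by means of a preferred chart
     [chart_at p] around p, so a tangent vector at p is its coordinate vector in
     that chart.
   - A differential form takes the list of its arguments: its component of
     degree k is its restriction to lists of length k.  [diff_form P] thus contains
     the direct sum of all Omega^k(P), and d, contraction and pullback are total
     functions on it.  Smoothness, multilinearity and purity of degree are in
     the predicates [is_form] and [Omega]. *)
From HB Require Import structures.
From mathcomp Require Import all_boot all_order all_algebra.
From mathcomp Require Import all_classical all_reals all_analysis.
Set Implicit Arguments.
Unset Strict Implicit.
Unset Printing Implicit Defensive.
Import Order.TTheory GRing.Theory Num.Theory.
Import numFieldNormedType.Exports.
Local Open Scope classical_set_scope.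
Local Open Scope ring_scope.

Section Smooth.
Variables (R : realType) (V W : normedModType R).

Definition iter_derive (vs : seq V) (f : V -> W) : V -> W :=
  foldr (fun v (g : V -> W) (x : V) => 'D_v g x) f vs.

(* Meant for an open set U. *)
Definition smooth_on (U : set V) (f : V -> W) : Prop :=
  forall (vs : seq V) (x : V), U x ->
    {for x, continuous (iter_derive vs f)} /\ forall v, derivable (iter_derive vs f) x v.

End Smooth.

(* [phi] matters only on [dom], and [psi], its inverse, only on [phi @` dom]. *)
Record chart (R : realType) (n : nat) (T : topologicalType) := Chart {
  dom : set T;
  phi : T -> 'rV[R]_n;
  psi : 'rV[R]_n -> T }.

Definition img (R : realType) n (T : topologicalType) (c : chart R n T) :=
  phi c @` dom c.

Definition is_chart (R : realType) n (T : topologicalType) (c : chart R n T) :=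
  [/\ open (dom c), open (img c),
      forall p, dom c p -> psi c (phi c p) = p,
      forall p, dom c p -> {for p, continuous (phi c)}
    & forall x, img c x -> {for x, continuous (psi c)}].

Definition compatible (R : realType) n (T : topologicalType)
    (c c' : chart R n T) :=
  smooth_on (phi c @` (dom c `&` dom c')) (phi c' \o psi c).

Record manifold (R : realType) := Manifold {
  msort :> topologicalType;
  mdim : nat;
  atlas : set (chart R mdim msort);
  chart_at : msort -> chart R mdim msort;
  manifold_hausdorff : hausdorff_space msort;
  manifold_second_countable : @second_countable msort;
  atlas_chart : forall c, atlas c -> is_chart c;
  atlas_compatible : forall c c', atlas c -> atlas c' -> compatible c c';
  atlas_chart_at : forall p, atlas (chart_at p);
  dom_chart_at : forall p, dom (chart_at p) p }.

Arguments atlas {R} m.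
Arguments chart_at {R} m p.

Definition tvec (R : realType) (P : manifold R) := 'rV[R]_(mdim P).

Definition vfield (R : realType) (P : manifold R) := P -> tvec P.

Section Maps.
Variable R : realType.

Definition smooth_map (P Q : manifold R) (F : P -> Q) : Prop :=
  continuous F /\
  forall c d, atlas P c -> atlas Q d ->
    smooth_on (phi c @` (dom c `&` F @^-1` dom d)) (phi d \o F \o psi c).

(* Smoothness of P1 x P2 -> Q, in the product charts of P1 x P2. *)
Definition smooth_map2 (P1 P2 Q : manifold R) (F : P1 -> P2 -> Q) : Prop :=
  continuous (fun z : P1 * P2 => F z.1 z.2) /\
  forall c1 c2 d, atlas P1 c1 -> atlas P2 c2 -> atlas Q d ->
    smooth_on
      [set z : 'rV[R]_(mdim P1) * 'rV[R]_(mdim P2) |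
        [/\ img c1 z.1, img c2 z.2 & dom d (F (psi c1 z.1) (psi c2 z.2))]]
      (fun z => phi d (F (psi c1 z.1) (psi c2 z.2))).

Definition smooth_curve (P : manifold R) (gam : R^o -> P) : Prop :=
  continuous gam /\
  forall c, atlas P c -> smooth_on (gam @^-1` dom c) (phi c \o gam).

Definition velocity (P : manifold R) (gam : R^o -> P) (t : R^o) : tvec P :=
  'D_(1 : R^o) (phi (chart_at P (gam t)) \o gam) t.

Definition tmap (P Q : manifold R) (F : P -> Q) (p : P) (u : tvec P) : tvec Q :=
  'D_u (phi (chart_at Q (F p)) \o F \o psi (chart_at P p))
       (phi (chart_at P p) p).

(* The coordinates in the chart c of the tangent vector u at p, and back. *)
Definition to_chart (P : manifold R) (c : chart R (mdim P) P) (p : P)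
    (u : tvec P) : 'rV[R]_(mdim P) :=
  'D_u (phi c \o psi (chart_at P p)) (phi (chart_at P p) p).

Definition of_chart (P : manifold R) (c : chart R (mdim P) P)
    (x u : 'rV[R]_(mdim P)) : tvec P :=
  'D_u (phi (chart_at P (psi c x)) \o psi c) x.

Definition vfield_loc (P : manifold R) (c : chart R (mdim P) P) (X : vfield P)
    (x : 'rV[R]_(mdim P)) : 'rV[R]_(mdim P) :=
  to_chart c (psi c x) (X (psi c x)).

Definition vbracket (P : manifold R) (X Y : vfield P) : vfield P := fun p =>
  let c := chart_at P p in
  'D_(X p) (vfield_loc c Y) (phi c p) - 'D_(Y p) (vfield_loc c X) (phi c p).

End Maps.

Section Forms.
Variable R : realType.

Definition multilinear (V W : lmodType R) (A : seq V -> W) : Prop :=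
  forall (s1 s2 : seq V) (a : R) (u v : V),
    A (s1 ++ (a *: u + v) :: s2) = a *: A (s1 ++ u :: s2) + A (s1 ++ v :: s2).

Definition alternating (V W : lmodType R) (A : seq V -> W) : Prop :=
  forall (s1 s2 s3 : seq V) (u : V), A (s1 ++ u :: s2 ++ u :: s3) = 0.

Definition diff_form (P : manifold R) := P -> seq 'rV[R]_(mdim P) -> R^o.

Definition form_loc (P : manifold R) (c : chart R (mdim P) P) (al : diff_form P)
    (x : 'rV[R]_(mdim P)) (s : seq 'rV[R]_(mdim P)) : R^o :=
  al (psi c x) [seq of_chart c x u | u <- s].

Definition is_form (P : manifold R) (al : diff_form P) : Prop :=
  [/\ forall p, multilinear (al p), forall p, alternating (al p)
    & forall c s, atlas P c -> smooth_on (img c) (fun x => form_loc c al x s)].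

Definition Omega (P : manifold R) (k : nat) : set (diff_form P) :=
  [set al | is_form al /\ forall p s, size s != k -> al p s = 0].

(* (d al)(v_0, ..., v_k) = sum_i (-1)^i D_(v_i) al(v_0, ..^.., v_k) in the
   preferred chart at p, the vectors v_i being extended by constant
   coordinates. *)
Definition dform (P : manifold R) (al : diff_form P) : diff_form P := fun p s =>
  let c := chart_at P p in
  \sum_(i < size s) (-1) ^+ i *:
    'D_(nth 0 s i) (fun x => form_loc c al x (take i s ++ drop i.+1 s))
                   (phi c p).

Definition contract (P : manifold R) (X : vfield P) (al : diff_form P) : diff_form P :=
  fun p s => al p (X p :: s).

Definition pullback (P Q : manifold R) (F : P -> Q) (al : diff_form Q) : diff_form P :=
  fun p s => al (F p) [seq tmap F p u | u <- s].

End Forms.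

Arguments Omega {R} P k.

(* The part of degree k - 1 of a graded object, which is 0 for k = 0. *)
Definition prev_degree (V : nmodType) (S : nat -> set V) (k : nat) : set V :=
  if k is j.+1 then S j else [set 0].

Section RelativeForms.
Variables (R : realType) (N M : manifold R).

Definition rform := (diff_form N * diff_form M)%type.

Definition OmegaF (k : nat) : set rform :=
  [set w | Omega N k w.1 /\ prev_degree (Omega M) k w.2].

Definition dF (F : M -> N) (w : rform) : rform :=
  (dform w.1, pullback F w.1 - dform w.2).

Definition iotaF (v : vfield N * vfield M) (w : rform) : rform :=
  (contract v.1 w.1, - contract v.2 w.2).

(* iota(v_1 /\ ... /\ v_k) = iota_(v_k) ... iota_(v_1) *)
Definition iota_wedge (vs : seq (vfield N * vfield M)) (w : rform) : rform :=
  foldl (fun w' v => iotaF v w') w vs.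

Definition pre_2_plectic (F : M -> N) (w : rform) : Prop :=
  OmegaF 3 w /\ dF F w = 0.

End RelativeForms.

Arguments OmegaF {R} N M k.

Record lieGroup (R : realType) := LieGroup {
  lman :> manifold R;
  lmul : lman -> lman -> lman;
  lone : lman;
  linv : lman -> lman;
  lmulA : forall a b c, lmul a (lmul b c) = lmul (lmul a b) c;
  lmul1g : forall a, lmul lone a = a;
  lmulVg : forall a, lmul (linv a) a = lone;
  lmul_smooth : smooth_map2 lmul;
  linv_smooth : smooth_map linv }.

Arguments lone {R} l.

Section LieGroups.
Variables (R : realType) (G : lieGroup R).

(* The underlying space of the Lie algebra is the tangent space at the unit. *)
Definition lieAlg := 'rV[R]_(mdim G).

Definition left_field (x : lieAlg) : vfield G :=
  fun g => tmap (lmul g) (lone G) x.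

Definition lbracket (x y : lieAlg) : lieAlg :=
  vbracket (left_field x) (left_field y) (lone G).

Definition derived_algebra : set lieAlg :=
  [set z | exists s : seq (R * (lieAlg * lieAlg)),
     z = \sum_(t <- s) t.1 *: lbracket t.2.1 t.2.2].

Definition one_parameter_subgroup (x : lieAlg) (gam : R^o -> G) : Prop :=
  [/\ smooth_curve gam, forall s t, gam (s + t) = lmul (gam s) (gam t)
    & velocity gam 0 = x].

Definition lexp (x : lieAlg) : G :=
  xget (lone G)
    [set g | exists2 gam, one_parameter_subgroup x gam & g = gam 1].

Definition Ad (g : G) (x : lieAlg) : lieAlg :=
  tmap (fun h => lmul (lmul g h) (linv g)) (lone G) x.

Definition is_action (P : manifold R) (act : G -> P -> P) : Prop :=
  [/\ smooth_map2 act, forall p, act (lone G) p = p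
    & forall g h p, act (lmul g h) p = act g (act h p)].

Definition fund_field (P : manifold R) (act : G -> P -> P) (x : lieAlg) :
    vfield P :=
  fun p => velocity (fun t : R^o => act (lexp (- t *: x)) p) 0.

Definition invariant_form (P : manifold R) (act : G -> P -> P) (al : diff_form P) :=
  forall g, pullback (act g) al = al.

End LieGroups.

Arguments derived_algebra {R} G.

Section Cartan.
Variables (R : realType) (G : lieGroup R).
Local Notation g := (lieAlg G).

Section OneManifold.
Variables (P : manifold R) (act : G -> P -> P).

Definition cochain := g -> diff_form P.

(* S^p g^v (x) Omega^q(P): homogeneous polynomial maps g -> Omega^q(P) of degree
   p, i.e. restrictions to the diagonal of p-linear maps. *)
Definition hompoly (p q : nat) : set cochain :=
  [set al | exists A : seq g -> diff_form P,
    [/\ multilinear A, forall s, Omega P q (A s)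
      & forall x, al x = A (nseq p x)]].

Definition equivariant (al : cochain) : Prop :=
  forall a x, al (Ad a x) = pullback (act (linv a)) (al x).

(* (S^p g^v (x) Omega^q(P))^G *)
Definition cartan_part (p q : nat) : set cochain :=
  [set al | hompoly p q al /\ equivariant al].

(* For p <= k./2, q = k - 2p satisfies 2p + q = k. *)
Definition cartan (k : nat) : set cochain :=
  [set al | exists2 b : nat -> cochain,
    forall p, (p <= k./2)%N -> cartan_part p (k - 2 * p) (b p)
    & al = \sum_(p < (k./2).+1) b p].

Definition dG (al : cochain) : cochain :=
  fun x => dform (al x) - contract (fund_field act x) (al x).

End OneManifold.

Section Relative.
Variables (N M : manifold R) (F : M -> N).
Variables (aN : G -> N -> N) (aM : G -> M -> M).

Definition map_action : Prop :=
  [/\ is_action aN, is_action aM & forall a p, F (aM a p) = aN a (F p)].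

Definition preserves (w : rform N M) : Prop :=
  invariant_form aN w.1 /\ invariant_form aM w.2.

Definition rfund_field (x : g) : vfield N * vfield M :=
  (fund_field aN x, fund_field aM x).

Definition rcochain := (cochain N * cochain M)%type.

Definition rcochain_at (al : rcochain) (x : g) : rform N M := (al.1 x, al.2 x).

Definition rcst (w : rform N M) : rcochain := (fun=> w.1, fun=> w.2).

Definition cartanF (k : nat) : set rcochain :=
  [set al | cartan aN k al.1 /\ prev_degree (cartan aM) k al.2].

Definition dGF (al : rcochain) : rcochain :=
  (dG aN al.1, (fun x => pullback F (al.1 x)) - dG aM al.2).

(* (g^v (x) Omega^1(F))^G, where Omega^1(F) = Omega^1(N) (+) Omega^0(M). *)
Definition linear_part : set rcochain :=
  [set mu | cartan_part aN 1 1 mu.1 /\ cartan_part aM 1 0 mu.2].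

(* rcst w - mu is a one-step extension of w. *)
Definition one_step_extension (w : rform N M) (mu : rcochain) : Prop :=
  [/\ linear_part mu, cartanF 3 (rcst w - mu) & dGF (rcst w - mu) = 0].

Definition homotopy_moment_map (w : rform N M)
    (f1 : g -> rform N M) (f2 : g -> g -> rform N M) : Prop :=
  let v := rfund_field in
  [/\ linear f1 /\ (forall x, OmegaF N M 1 (f1 x)),
      [/\ forall x, linear (f2 x), forall y, linear (f2^~ y),
          forall x, f2 x x = 0 & forall x y, OmegaF N M 0 (f2 x y)],
      forall x, dF F (f1 x) = - iotaF (v x) w,
      forall x y, f1 (lbracket x y) = dF F (f2 x y) + iota_wedge [:: v x; v y] w
    & forall x y z,
        f2 (lbracket x y) z - f2 (lbracket x z) y + f2 (lbracket y z) x
        = - iota_wedge [:: v x; v y; v z] w].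

End Relative.
End Cartan.

(* Main.v *)
(* A perfect Lie algebra is the image of the bracket T : g (x) g -> g, and as G is
   compact, T has a linear G-equivariant section sigma.  For one component al of
   varpi, put m(x) = sum_i iota_(v_(b_i)) iota_(v_(a_i)) al, where sigma(x) is
   sum_i a_i (x) b_i.  By Cartan's formulas for invariant forms these m(x) form
   M = (mu, h), which satisfies d_F M(x) = - iota_(v_x) varpi and is equivariant.
   The remaining equation of a one-step extension is iota_(v_x) mu(x) = 0:
   the function on the left has zero differential, as mu([x, x]) = 0, so it is
   constant on the connected N, and on the image of F it is h([x, x]) = 0.  This
   also gives the antisymmetry of f_2; the equations of a homotopy moment map
   follow by differentiating the equivariance of mu and h. *)
From HB Require Import structures.
Require Import Defs.
From mathcomp Require Import all_boot all_order all_algebra.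
From mathcomp Require Import all_classical all_reals all_analysis.
From mathcomp Require Import ring lra.
Set Implicit Arguments.
Unset Strict Implicit.
Unset Printing Implicit Defensive.
Import Order.TTheory GRing.Theory Num.Theory.
Import numFieldNormedType.Exports.
Local Open Scope classical_set_scope.
Local Open Scope ring_scope.

(** * Differential calculus *)

(** [fund_field] is defined through [lexp], itself a choice among one-parameter subgroups, so it can
    be computed only after these are known to exist and to be unique; this is why differential
    equations come in. Once v_x is identified with minus the derivative of the orbit map at the unit
    ([fund_fieldE]), no curve in G is used again: every Lie derivative is a derivative of the action
    at the unit. The sign in exp(-tx) makes x |-> v_x a morphism of Lie algebras. For an invariant
    form al, Cartan's formulas give d iota_b iota_a al = - iota_[a,b] al + iota_b iota_a d al, so
    that summing over sigma(x) turns the bracket term into - iota_(v_x) al. The section sigma is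
    made equivariant without integrating over G: the linear sections of the bracket form an
    invariant affine subspace of Hom(g, g (x) g), on which the bounded action of G has a fixed point
    by a convexity argument. *)

Section Differentiability.
Variable R : realType.
Implicit Types V W X : normedModType R.

(** An explicit basis with continuous coordinates lets statements on maps between row spaces,
    scalars and their products be proved coordinatewise; products are needed for the domain of a
    group law or of an action. *)
Class finDim V := FinDim {
  fdim : nat;
  fbasis : 'I_fdim -> V;
  fcoord : 'I_fdim -> V -> R^o;
  fcoord_linear : forall i, linear (fcoord i);
  fcoord_continuous : forall i, continuous (fcoord i);
  fcoordK : forall v, v = \sum_i fcoord i v *: fbasis i }.

Arguments fcoord_continuous {V finDim} i.
Arguments fcoord_linear {V finDim} i.

Definition pack_linear V W (f : V -> W) (lf : linear f) : {linear V -> W} :=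
  HB.pack f (GRing.isLinear.Build R V W *:%R f lf).

Lemma linear_fun0 V W (f : V -> W) : linear f -> f 0 = 0.
Proof. by move=> lf; exact: (linear0 (pack_linear lf)). Qed.

Lemma linear_funN V W (f : V -> W) : linear f -> forall u, f (- u) = - f u.
Proof. by move=> lf; exact: (linearN (pack_linear lf)). Qed.

Lemma linear_funB V W (f : V -> W) : linear f -> forall u v, f (u - v) = f u - f v.
Proof. by move=> lf; exact: (linearB (pack_linear lf)). Qed.

Lemma linear_funZ V W (f : V -> W) : linear f -> forall a u, f (a *: u) = a *: f u.
Proof. by move=> lf a u; have := lf a u 0; rewrite (linear_fun0 lf) !addr0. Qed.

Lemma linear_fun_sum V W (f : V -> W) : linear f ->
  forall (I : Type) (r : seq I) (F : I -> V), f (\sum_(i <- r) F i) = \sum_(i <- r) f (F i).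
Proof. by move=> lf I r F; exact: (linear_sum (pack_linear lf)). Qed.

Lemma differentiable_eps V W (f : V -> W) (x : V) (L : {linear V -> W}) :
  continuous L ->
  (forall e, 0 < e -> \forall h \near (0 : V),
     `|f (h + x) - f x - L h| <= e * `|h|) ->
  differentiable f x.
Proof.
move=> cL H.
have E : f \o shift x = cst (f x) + L +o_ (0 : V) id.
  apply/eqaddoP => e e0 /=.
  by apply: filterS (H e e0) => h; rewrite !fctE /= opprD addrA.
have dE := diff_unique cL E.
by apply/diff_locallyP; rewrite dE.
Qed.

Lemma is_derive_cvg V W (f : V -> W) (x v : V) (l : W) :
  (fun h : R => h^-1 *: (f (h *: v + x) - f x)) @ 0^' --> l -> is_derive x v f l.
Proof.
move=> C; apply: DeriveDef; last exact: cvg_lim C.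
by apply: (cvg_ex _).2; exists l.
Qed.

Lemma is_derive_is_cvg V W (f : V -> W) (x v : V) (l : W) :
  is_derive x v f l -> (fun h : R => h^-1 *: (f (h *: v + x) - f x)) @ 0^' --> l.
Proof. by move=> [df <-]; exact: df. Qed.

Lemma linear_is_derive V W (L : V -> W) (x v : V) :
  linear L -> is_derive x v L (L v).
Proof.
move=> lL; apply: is_derive_cvg.
have C : cst (L v) @ (0 : R)^' --> L v by exact: cvg_cst.
apply: cvg_trans C; apply: near_eq_cvg.
near=> h.
have h0 : h != 0 by near: h; exact: nbhs_dnbhs_neq.
by rewrite /= lL addrK scalerA mulVf// scale1r.
Unshelve. all: by end_near. Qed.

Lemma linear_comp_derive V W X (L : W -> X) (f : V -> W) (x v : V) df :
  linear L -> continuous L -> is_derive x v f df ->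
  is_derive x v (L \o f) (L df).
Proof.
move=> lL cL /is_derive_is_cvg fl; apply: is_derive_cvg.
pose L' := pack_linear lL.
have <- : L \o (fun h : R => h^-1 *: (f (h *: v + x) - f x)) =
    (fun h : R => h^-1 *: ((L \o f) (h *: v + x) - (L \o f) x)).
  by apply/funext => h /=; rewrite -[L]/(L' : _ -> _) linearZ (raddfB L').
exact: (cvg_comp _ _ fl (cL df)).
Qed.

Lemma derive_line V W (f : V -> W) (x h : V) (s : R) :
  derivable f (x + s *: h) h ->
  is_derive (s : R^o) (1 : R^o) (fun t : R^o => f (x + t *: h)) ('D_h f (x + s *: h)).
Proof.
move=> df.
have E : (fun k : R => k^-1 *: (f (k *: h + (x + s *: h)) - f (x + s *: h))) =
         (fun k : R => k^-1 *: (f (x + (k *: (1 : R^o) + s : R^o) *: h) - f (x + s *: h))).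
  by apply/funext => k; rewrite [k *: (1 : R^o)]mulr1 scalerDl addrCA.
by split; rewrite /derivable /derive /= -E.
Qed.

(** The length [a] may have either sign, since it will be a coordinate of an increment. *)
Lemma MVT_dir V (f : V -> R^o) (x h : V) (a : R) :
  (forall s : R, `|s| <= `|a| -> derivable f (x + s *: h) h) ->
  exists2 s : R, `|s| <= `|a| & f (x + a *: h) - f x = a * 'D_h f (x + s *: h).
Proof.
move=> df; pose g := fun t : R^o => f (x + t *: h).
have dg (s : R) : `|s| <= `|a| -> is_derive (s : R^o) (1 : R^o) g ('D_h f (x + s *: h)).
  by move=> s01; apply/derive_line/df.
have fx : f x = g 0 by rewrite /g scale0r addr0.
have [a0|a0] := lerP 0 a.
- have na s : s \in `[0, a] -> `|s| <= `|a|.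
    by rewrite in_itv/= => /andP[s0 sa]; rewrite !ger0_norm.
  have [|s|s s01 E] := @MVT_segment R g (fun s => 'D_h f (x + s *: h)) 0 a a0.
  + by move=> s sa; apply/dg/na; exact: subset_itv_oo_cc.
  + apply: derivable_within_continuous => u ua.
    exact: (@ex_derive _ _ _ _ _ _ _ (dg u (na _ ua))).
  + by exists s; [exact: na|rewrite fx [LHS]E subr0 mulrC].
- have na s : s \in `[a, 0] -> `|s| <= `|a|.
    by rewrite in_itv/= => /andP[sa s0]; rewrite !ler0_norm ?lerN2// ltW.
  have [|s|s s01 E] := @MVT_segment R g (fun s => 'D_h f (x + s *: h)) a 0 (ltW a0).
  + by move=> s sa; apply/dg/na; exact: subset_itv_oo_cc.
  + apply: derivable_within_continuous => u ua.
    exact: (@ex_derive _ _ _ _ _ _ _ (dg u (na _ ua))).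
  + exists s; first exact: na.
    by rewrite fx -[LHS]opprB [g 0 - _]E sub0r mulrN opprK mulrC.
Qed.

Lemma fcoord_bound V (fV : finDim V) :
  exists2 C, 0 < C & forall i v, `|fcoord (finDim := fV) i v| <= C * `|v|.
Proof.
have H i : exists2 k, k > 0 & forall v, `|fcoord (finDim := fV) i v| <= k * `|v|.
  have [|k k0 kP] := @linear_lipschitz R V R^o (pack_linear (fcoord_linear (finDim := fV) i)).
    exact: fcoord_continuous.
  by exists k.
pose k i := sval (cid2 (H i)).
have k0 i : 0 < k i by rewrite /k; case: cid2.
have kP i v : `|fcoord i v| <= k i * `|v| by rewrite /k; case: cid2.
exists (1 + \sum_i k i); first by rewrite ltr_pwDl// sumr_ge0// => i _; exact: ltW.
move=> i v; apply: le_trans (kP i v) _; rewrite ler_wpM2r//.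
rewrite (bigD1 i)//= addrCA lerDl addr_ge0// sumr_ge0// => j _; exact: ltW.
Qed.

Lemma continuous_sumr (T : topologicalType) W (I : Type) (r : seq I) (F : I -> T -> W) (x : T) :
  (forall i, {for x, continuous (F i)}) ->
  {for x, continuous (fun y => \sum_(i <- r) F i y)}.
Proof.
move=> cF; elim: r => [|i r IH].
  rewrite (_ : (fun y => _) = cst 0); first exact: cst_continuous.
  by apply/funext => y; rewrite big_nil.
rewrite (_ : (fun y => _) = F i \+ (fun y => \sum_(j <- r) F j y)).
  by apply: (@continuousD _ _ T _ _ x); [exact: cF|exact: IH].
by apply/funext => y; rewrite big_cons.
Qed.

(** The increment from x to x + h is cut into one step per basis vector. The mean value theorem on
    each step replaces the partial derivative at x by one at a nearby point, and continuity makes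
    the error small compared with h. *)
Lemma C1_differentiable_scalar V (fV : finDim V) (f : V -> R^o) (x : V) :
  (\forall y \near x, forall v, derivable f y v) ->
  (forall v, {for x, continuous ('D_v f)}) ->
  differentiable f x.
Proof.
move=> df cf; have [C C0 CP] := fcoord_bound fV.
move: fV C C0 CP => [N b co lco cco coK] /= C C0 CP.
pose L (h : V) : R^o := \sum_i co i h * 'D_(b i) f x.
have lL : linear L.
  move=> a u v; rewrite /L scaler_sumr -big_split /=; apply: eq_bigr => i _.
  by rewrite lco mulrDl scalerAl.
have cL : continuous L.
  move=> h; apply: continuous_sumr => i; apply: cvgMr_tmp; exact: cco.
apply: (@differentiable_eps _ _ f x (pack_linear lL)); first exact: cL.
move=> e e0.
pose E : R := \sum_i `|b i|.
have E0 : 0 <= E by rewrite sumr_ge0.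
pose n : R := 1 + N%:R.
have n0 : 0 < n by rewrite ltr_pwDl// ler0n.
(* Each of the N steps contributes an error of at most C |h| e', and N / n <= 1, so that the total
   is at most e |h|. *)
pose e' := e / (C * n).
have e'0 : 0 < e' by rewrite divr_gt0// mulr_gt0.
have : \forall y \near x, (forall v, derivable f y v) /\
    forall i : 'I_N, `|'D_(b i) f y - 'D_(b i) f x| <= e'.
  apply: filterI => //; apply: filter_forall => i.
  have /cvgrPdist_le /(_ _ e'0) := cf (b i).
  by apply: filterS => y /=; rewrite distrC.
move=> /nbhs_ballP[d /= d0 Hd].
have B0 : 0 < 1 + (E + E) by rewrite ltr_pwDl// addr_ge0.
(* A point of the broken path is x + S k + s b_i; both S k and s b_i have norm at most C |h| E. The
   extra 1 keeps the denominator positive when E = 0. *)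
apply/nbhs_ballP; exists (d / (C * (1 + (E + E)))) => /=; first by rewrite divr_gt0// mulr_gt0.
move=> h; rewrite -ball_normE /= sub0r normrN ltr_pdivlMr ?mulr_gt0// => hd.
pose S (k : nat) : V := \sum_(i < N | (i < k)%N) co i h *: b i.
have SB k i (s : R) : `|s| <= `|co i h| -> ball x d (x + S k + s *: b i).
  move=> si; rewrite -ball_normE /= opprD opprD !addrA subrr sub0r -opprD normrN.
  apply: le_lt_trans hd; apply: le_trans (ler_normD _ _) _.
  have -> : `|h| * (C * (1 + (E + E))) = C * `|h| + (C * (`|h| * E) + C * (`|h| * E)) by ring.
  rewrite -[leLHS]add0r; apply: lerD; first by rewrite mulr_ge0// ltW.
  have hE j (t : R) : `|t| <= `|co j h| -> `|t *: b j| <= C * (`|h| * `|b j|).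
    by move=> tj; rewrite normrZ mulrA ler_wpM2r// (le_trans tj).
  apply: lerD.
    apply: le_trans (ler_norm_sum _ _ _) _; rewrite /E !mulr_sumr big_mkcond /=.
    by apply: ler_sum => j _; case: ifP => _; [exact: hE|rewrite !mulr_ge0// ltW].
  apply: le_trans (hE _ _ si) _; rewrite ler_pM2l// ler_wpM2l// /E (bigD1 i)//= lerDl.
  exact: sumr_ge0.
have Sn : h = S N by rewrite [LHS]coK; apply: eq_bigl => i; rewrite ltn_ord.
have SS (i : 'I_N) : S i.+1 = S i + co i h *: b i.
  rewrite /S (bigD1 i) ?ltnSn//= addrC; congr (_ + _); apply: eq_bigl => j.
  by rewrite ltnS andbC ltn_neqAle -val_eqE.
have S0 : S 0 = 0 by rewrite /S big_pred0.
have -> : f (h + x) - f x - L h =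
   \sum_(i < N) (f (x + S i.+1) - f (x + S i) - co i h * 'D_(b i) f x).
  rewrite sumrB; congr (_ - _).
  rewrite -(big_mkord xpredT (fun i => f (x + S i.+1) - f (x + S i))).
  by rewrite telescope_sumr// -Sn S0 addr0 [x + h]addrC.
apply: le_trans (ler_norm_sum _ _ _) _.
apply: (@le_trans _ _ (\sum_(i < N) (C * `|h| * e'))).
  apply: ler_sum => i _.
  have [s si Es] := @MVT_dir V f (x + S i) (b i) (co i h) (fun s si => (Hd _ (SB i i s si)).1 _).
  rewrite SS addrA Es -mulrBr normrM ler_pM//.
  exact: (Hd _ (SB i i s si)).2.
rewrite sumr_const card_ord -[_ *+ _]mulr_natr /e'.
have -> : C * `|h| * (e / (C * n)) * N%:R = (e * `|h|) * (N%:R / n).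
  by field; rewrite !gt_eqF.
rewrite ler_piMr ?mulr_ge0 ?(ltW e0)// ler_pdivrMr// mul1r /n lerDr. exact: ler01.
Qed.

Lemma C1_differentiable V W (fV : finDim V) (fW : finDim W) (f : V -> W) (x : V) :
  (\forall y \near x, forall v, derivable f y v) ->
  (forall v, {for x, continuous ('D_v f)}) ->
  differentiable f x.
Proof.
move=> df cf.
have -> : f = \sum_(i < fdim) ((fun y => fcoord i (f y) *: fbasis i) : V -> W).
  by apply/funext => y; rewrite fct_sumE -fcoordK.
apply: differentiable_sum => i; apply: differentiableZl.
have D v : \near x, 'D_v (fcoord i \o f) x = fcoord i ('D_v f x).
  apply: filterS df => y dfy.
  by have [_ ->] := linear_comp_derive (fcoord_linear i) (fcoord_continuous i) (derivableP (dfy v)).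
apply: (C1_differentiable_scalar fV).
  apply: filterS df => y dfy v.
  by have [] := linear_comp_derive (fcoord_linear i) (fcoord_continuous i) (derivableP (dfy v)).
move=> v; change ('D_v (fcoord i \o f) @ x --> 'D_v (fcoord i \o f) x); rewrite (nbhs_singleton (D v)).
have C : fcoord i \o ('D_v f) @ x --> fcoord i ('D_v f x).
  by have cfv : 'D_v f @ x --> 'D_v f x := cf v; exact: (cvg_comp _ _ cfv (fcoord_continuous i _)).
apply: cvg_trans C; apply: near_eq_cvg.
by apply: filterS (D v) => y /= ->.
Qed.
End Differentiability.
Arguments fcoord_continuous {R V finDim} i.
Arguments fcoord_linear {R V finDim} i.

Section FinDimInstances.
Variable R : realType.

Section Scalars.
Let co (i : 'I_1) (x : R^o) : R^o := x.
Let co_linear i : linear (co i). Proof. by []. Qed.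
Let co_continuous i : continuous (co i). Proof. by move=> x. Qed.
Let coK (x : R^o) : x = \sum_(i < 1) co i x *: (1 : R^o).
Proof. by rewrite big_ord1 [RHS]mulr1. Qed.
#[global] Instance finDim_scalar : finDim R^o := FinDim co_linear co_continuous coK.
End Scalars.

Section Rows.
Variable n : nat.
Let co (i : 'I_n) (x : 'rV[R]_n) : R^o := x ord0 i.
Let co_linear i : linear (co i). Proof. by move=> a u v; rewrite /co !mxE. Qed.
Let co_continuous i : continuous (co i).
Proof. by move=> x; exact: (@coord_continuous R 1 n ord0 i x). Qed.
Let coK (x : 'rV[R]_n) : x = \sum_(i < n) co i x *: delta_mx ord0 i.
Proof. exact: row_sum_delta. Qed.
#[global] Instance finDim_rV : finDim 'rV[R]_n := FinDim co_linear co_continuous coK.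
End Rows.

Section Products.
Variables (V W : normedModType R) (fV : finDim V) (fW : finDim W).
Let n := fdim (finDim := fV).
Let m := fdim (finDim := fW).
Let b (i : 'I_(n + m)) : V * W :=
  match fintype.split i with inl j => (fbasis j, 0) | inr j => (0, fbasis j) end.
Let co (i : 'I_(n + m)) (x : V * W) : R^o :=
  match fintype.split i with inl j => fcoord j x.1 | inr j => fcoord j x.2 end.
Let co_linear i : linear (co i).
Proof. by move=> a u v; rewrite /co; case: fintype.split => j; rewrite fcoord_linear. Qed.
Let co_continuous i : continuous (co i).
Proof.
rewrite /co; case: fintype.split => j x.
  apply: (@continuous_comp _ _ _ fst (fcoord j) x); first exact: cvg_fst.
  exact: fcoord_continuous.
apply: (@continuous_comp _ _ _ snd (fcoord j) x); first exact: cvg_snd.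
exact: fcoord_continuous.
Qed.
Let coK (x : V * W) : x = \sum_(i < n + m) co i x *: b i.
Proof.
rewrite big_split_ord /=.
under eq_bigr => i _ do rewrite /co /b (unsplitK (inl _ i)).
under [X in _ + X]eq_bigr => i _ do rewrite /co /b (unsplitK (inr _ i)).
have E1 : \sum_(i < n) fcoord i x.1 *: ((fbasis i, 0) : V * W) = (x.1, 0).
  rewrite [x.1 in RHS]fcoordK; elim/big_rec2: _ => // i y1 y2 _ ->.
  by rewrite -[_ *: (_, _)]/(_ *: _, _ *: _) scaler0 -[(_, _) + (_, _)]/(_ + _, _ + _) addr0.
have E2 : \sum_(i < m) fcoord i x.2 *: ((0, fbasis i) : V * W) = (0, x.2).
  rewrite [x.2 in RHS]fcoordK; elim/big_rec2: _ => // i y1 y2 _ ->.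
  by rewrite -[_ *: (_, _)]/(_ *: _, _ *: _) scaler0 -[(_, _) + (_, _)]/(_ + _, _ + _) addr0.
by rewrite E1 E2 -[(_, _) + (_, _)]/(_ + _, _ + _) addr0 add0r; case: x {E1 E2}.
Qed.
#[global] Instance finDim_prod : finDim (V * W)%type := FinDim co_linear co_continuous coK.
End Products.
End FinDimInstances.

(** * Maps of class C^k and their stability under sums, products and composition *)

Section SmoothCalculus.
Variable R : realType.
Implicit Types V W X : normedModType R.

(** Smoothness cut off at order k, so that products and compositions can be treated by induction on
    k; [smooth_on] is the conjunction over all k by [smooth_on_Ck]. *)
Fixpoint Ck V W (k : nat) (U : set V) (f : V -> W) : Prop :=
  if k is j.+1 then
    [/\ forall x, U x -> {for x, continuous f},
        forall x v, U x -> derivable f x v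
      & forall v, Ck j U ('D_v f)]
  else forall x, U x -> {for x, continuous f}.

Lemma Ck_continuous V W k (U : set V) (f : V -> W) x :
  Ck k U f -> U x -> {for x, continuous f}.
Proof. by case: k => [|k] /=; [exact|case=> + _ _; exact]. Qed.

Lemma Ck_succ V W k (U : set V) (f : V -> W) : Ck k.+1 U f -> Ck k U f.
Proof.
elim: k f => [|k IH] f /=; first by case.
by case=> cf df Df; split => // v; apply: IH; exact: Df.
Qed.

Lemma iter_derive_rcons V W vs v (f : V -> W) :
  iter_derive (rcons vs v) f = iter_derive vs ('D_v f).
Proof. by elim: vs => [|u vs IH] //=; rewrite IH. Qed.

Lemma smooth_on_Ck V W (U : set V) (f : V -> W) :
  smooth_on U f <-> forall k, Ck k U f.
Proof.
split=> [sf k|Cf].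
  elim: k f sf => [|k IH] f sf /=.
    by move=> x Ux; exact: (sf [::] x Ux).1.
  split=> [x Ux|x v Ux|v]; [exact: (sf [::] x Ux).1|exact: (sf [::] x Ux).2|].
  by apply: IH => vs x Ux; rewrite -iter_derive_rcons; exact: sf.
move=> vs; elim/last_ind: vs f Cf => [|vs v IH] f Cf x Ux.
  by have [cf df _] := Cf 1%N; split => [|v] /=; [exact: (cf x Ux)|exact: (df x v Ux)].
rewrite iter_derive_rcons; apply: IH Ux => k; have [_ _] := Cf k.+1; exact.
Qed.

Lemma Ck_eq V W k (U : set V) (f g : V -> W) :
  open U -> (forall x, U x -> f x = g x) -> Ck k U f -> Ck k U g.
Proof.
move=> oU; have nU x : U x -> nbhs x U by move=> Ux; exact: open_nbhs_nbhs.
have cE (f1 g1 : V -> W) x : (forall x, U x -> f1 x = g1 x) -> U x ->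
    {for x, continuous f1} -> {for x, continuous g1}.
  move=> fg Ux cf; change (g1 @ x --> g1 x); rewrite -(fg x Ux); apply: cvg_trans cf.
  by apply: near_eq_cvg; apply: filterS (nU x Ux) => y Uy; rewrite fg.
elim: k f g => [|k IH] f g fg /=; first by move=> Cf x Ux; apply: cE (Cf x Ux).
have nfg x : U x -> \forall y \near x, f y = g y.
  by move=> Ux; apply: filterS (nU x Ux).
case=> cf df Df; split=> [x Ux|x v Ux|v]; first exact: cE (cf x Ux).
  exact: near_eq_derivable (nfg x Ux) (df x v Ux).
by apply: IH (Df v) => x Ux; apply: near_eq_derive; exact: nfg.
Qed.

Lemma Ck_cst V W k (U : set V) (a : W) : Ck k U (fun _ : V => a).
Proof.
elim: k a => [|k IH] a /=; first by move=> x _; exact: cst_continuous.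
split=> [x _|x v _|v]; [exact: cst_continuous|exact: derivable_cst|].
rewrite (_ : 'D_v _ = fun=> 0); first exact: IH.
by apply/funext => x; exact: derive_cst.
Qed.

Lemma Ck_linear V W k (U : set V) (L : V -> W) : linear L -> continuous L -> Ck k U L.
Proof.
move=> lL cL; case: k => [|k] /=; first by move=> x _; exact: cL.
split=> [x _|x v _|v]; [exact: cL|by have [] := linear_is_derive x v lL|].
rewrite (_ : 'D_v _ = fun=> L v); first exact: Ck_cst.
by apply/funext => x; have [_ ->] := linear_is_derive x v lL.
Qed.

Lemma Ck_comp_linear V W X k (U : set V) (L : W -> X) (f : V -> W) :
  open U -> linear L -> continuous L -> Ck k U f -> Ck k U (L \o f).
Proof.
move=> oU lL cL; elim: k f => [|k IH] f /=.
  by move=> cf x Ux; apply: (cvg_comp _ _ (cf x Ux) (cL _)).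
case=> cf df Df.
have D x v : U x -> is_derive x v (L \o f) (L ('D_v f x)).
  by move=> Ux; apply: linear_comp_derive => //; apply/derivableP/df.
split=> [x Ux|x v Ux|v]; first by apply: (cvg_comp _ _ (cf x Ux) (cL _)).
  by have [] := D x v Ux.
by apply: Ck_eq (IH _ (Df v)) => // x Ux /=; have [_ ->] := D x v Ux.
Qed.

Lemma Ck_add V W k (U : set V) (f g : V -> W) :
  open U -> Ck k U f -> Ck k U g -> Ck k U (fun x => f x + g x).
Proof.
move=> oU; elim: k f g => [|k IH] f g /=.
  by move=> cf cg x Ux; apply: (@continuousD _ _ _ f g x); [exact: cf|exact: cg].
case=> cf df Df [cg dg Dg]; split=> [x Ux|x v Ux|v].
- by apply: (@continuousD _ _ _ f g x); [exact: cf|exact: cg].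
- by apply: (@derivableD _ _ _ f g); [exact: df|exact: dg].
apply: Ck_eq (IH _ _ (Df v) (Dg v)) => // x Ux.
by rewrite -(deriveD (df x v Ux) (dg x v Ux)).
Qed.

Lemma is_derive_scale V W (s : V -> R^o) (f : V -> W) (x v : V) (ds : R^o) (df : W) :
  {for x, continuous f} -> is_derive x v s ds -> is_derive x v f df ->
  is_derive x v (fun y => s y *: f y) (ds *: f x + s x *: df).
Proof.
move=> cf /is_derive_is_cvg Ds /is_derive_is_cvg Df; apply: is_derive_cvg.
have E : (fun h : R => (h^-1 *: (s (h *: v + x) - s x)) *: f (h *: v + x) +
            s x *: (h^-1 *: (f (h *: v + x) - f x))) =
         (fun h : R => h^-1 *: (s (h *: v + x) *: f (h *: v + x) - s x *: f x)).
  apply/funext => h; rewrite [_ *: (s _ - _)]mulrC -scalerA [s x *: (_ *: _)]scalerA.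
  rewrite [s x * _]mulrC -scalerA scalerA [_ * h^-1]mulrC -scalerA -scalerDr; congr (_ *: _).
  by rewrite scalerBl scalerBr addrA subrK.
rewrite -E; apply: cvgD; apply: cvgZ => //; last exact: cvg_cst.
have C : (fun h : R => h *: v + x) @ 0^' --> x.
  rewrite -[X in _ --> X]add0r -(scale0r v); apply: cvg_within_filter.
  apply: cvgD; last exact: cvg_cst.
  by apply: cvgZr_tmp.
exact: (cvg_comp _ _ C cf).
Qed.

Lemma Ck_scale V W k (U : set V) (s : V -> R^o) (f : V -> W) :
  open U -> Ck k U s -> Ck k U f -> Ck k U (fun x => s x *: f x).
Proof.
move=> oU; elim: k s f => [|k IH] s f /=.
  by move=> cf cg x Ux; apply: cvgZ; [exact: cf|exact: cg].
move=> Cs Cf; have [cs ds Ds] := Cs; have [cf df Df] := Cf.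
have D x v : U x -> is_derive x v (fun y => s y *: f y) ('D_v s x *: f x + s x *: 'D_v f x).
  by move=> Ux; apply: is_derive_scale; [exact: cf|exact/derivableP/ds|exact/derivableP/df].
split=> [x Ux|x v Ux|v]; first by apply: cvgZ; [exact: cs|exact: cf].
  by have [] := D x v Ux.
apply: (@Ck_eq _ _ _ _ (fun x => 'D_v s x *: f x + s x *: 'D_v f x)) => //.
  by move=> x Ux; have [_ ->] := D x v Ux.
by apply: Ck_add => //; apply: IH => //; exact: (@Ck_succ _ _ k).
Qed.

Lemma Ck_sum V W k (U : set V) n (f : 'I_n -> V -> W) :
  open U -> (forall i, Ck k U (f i)) -> Ck k U (fun x => \sum_i f i x).
Proof.
move=> oU Cf; elim: n f Cf => [|n IH] f Cf.
  apply: Ck_eq (@Ck_cst V W k U 0) => // x _; by rewrite big_ord0.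
apply: Ck_eq (Ck_add oU (IH _ (fun i => Cf (widen_ord (leqnSn n) i))) (Cf ord_max)) => // x _.
by rewrite big_ord_recr.
Qed.

Lemma C1_on_differentiable V W {fV : finDim V} {fW : finDim W} (U : set V) (f : V -> W) x :
  open U -> U x -> Ck 1 U f -> differentiable f x.
Proof.
move=> oU Ux [cf df Df]; apply: C1_differentiable.
  by have nU : nbhs x U := open_nbhs_nbhs (conj oU Ux); apply: filterS nU => y Uy v; exact: df.
by move=> v; exact: (Df v).
Qed.

Lemma diff_comp_derive V W X (f : W -> X) (g : V -> W) (x v : V) :
  differentiable g x -> differentiable f (g x) ->
  is_derive x v (f \o g) ('D_('D_v g x) f (g x)).
Proof.
move=> dg df; have dfg := differentiable_comp dg df.
split; first exact: diff_derivable.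
by rewrite !deriveE// diff_comp.
Qed.

Lemma derive_basis V W {fV : finDim V} (f : V -> W) (x v : V) :
  differentiable f x -> 'D_v f x = \sum_i fcoord i v *: 'D_(fbasis i) f x.
Proof.
move=> df; rewrite deriveE// {1}[v]fcoordK linear_sum; apply: eq_bigr => i _.
by rewrite linearZ /= deriveE.
Qed.

(** In the chain rule the direction of differentiation of f varies with the point. Expanding it in a
    fixed basis gives a sum of products of C^k functions, to which the induction hypothesis
    applies. *)
Lemma Ck_comp V W X {fV : finDim V} {fW : finDim W} {fX : finDim X} k
    (U : set V) (U' : set W) (f : W -> X) (g : V -> W) :
  open U -> open U' -> (forall x, U x -> U' (g x)) ->
  Ck k U' f -> Ck k U g -> Ck k U (f \o g).
Proof.
move=> oU oU' gU; elim: k f g gU => [|k IH] f g gU /=.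
  by move=> cf cg x Ux; exact: (cvg_comp _ _ (cg x Ux) (cf _ (gU x Ux))).
move=> Cf Cg; have [cf df Df] := Cf; have [cg dg Dg] := Cg.
have C1 V' W' (A : set V') (h : V' -> W') : Ck k.+1 A h -> Ck 1 A h.
  case=> ch dh Dh; split=> // v x Ax; exact: (Ck_continuous (Dh v)).
have dfg x : U x -> differentiable g x /\ differentiable f (g x).
  move=> Ux; split; first by apply: (C1_on_differentiable oU Ux); exact: C1.
  by apply: (C1_on_differentiable oU' (gU x Ux)); exact: C1.
split=> [x Ux|x v Ux|v].
- exact: (cvg_comp _ _ (cg x Ux) (cf _ (gU x Ux))).
- by have [dgx dfx] := dfg x Ux; have [] := diff_comp_derive v dgx dfx.
apply: (@Ck_eq _ _ _ _ (fun x => \sum_i fcoord i ('D_v g x) *: 'D_(fbasis i) f (g x))) => //.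
  move=> x Ux; have [dgx dfx] := dfg x Ux; have [_ ->] := diff_comp_derive v dgx dfx.
  by rewrite (derive_basis _ dfx).
apply: Ck_sum => // i; apply: Ck_scale => //.
  by apply: (@Ck_comp_linear _ _ _ _ _ (fcoord i) ('D_v g)) => //; [exact: fcoord_linear|exact: fcoord_continuous].
by apply: (IH _ _ gU (Df _)); exact: (@Ck_succ _ _ k).
Qed.
End SmoothCalculus.

(** * Smoothness at a point and the symmetry of second derivatives *)

Section SmoothAt.
Variable R : realType.
Implicit Types V W X : normedModType R.

Definition smooth_at V W (f : V -> W) (x : V) : Prop :=
  exists2 U, open_nbhs x U & smooth_on U f.

Lemma smooth_at_on V W (U : set V) (f : V -> W) :
  (forall x, U x -> smooth_at f x) -> smooth_on U f.
Proof. by move=> sf vs x Ux; have [A [_ Ax] sA] := sf x Ux; exact: sA. Qed.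

Lemma smooth_at_near V W (f : V -> W) x :
  smooth_at f x -> \forall y \near x, smooth_at f y.
Proof.
move=> [U [oU Ux] sU]; have nU : nbhs x U by exact: open_nbhs_nbhs.
by apply: filterS nU => y Uy; exists U.
Qed.

Lemma smooth_at_eq V W (f g : V -> W) x :
  (\forall y \near x, f y = g y) -> smooth_at f x -> smooth_at g x.
Proof.
rewrite -nbhs_nearE nbhsE => -[A [oA Ax] Afg] [U [oU Ux] /smooth_on_Ck sU].
exists (U `&` A); first by split; [exact: openI|].
apply/smooth_on_Ck => k; apply: (@Ck_eq _ _ _ _ _ f) => //.
- exact: openI.
- by move=> y [_ Ay]; exact: Afg.
apply/smooth_on_Ck: k => vs y [Uy _]; have /smooth_on_Ck := sU; exact.
Qed.

Lemma smooth_at_continuous V W (f : V -> W) x : smooth_at f x -> {for x, continuous f}.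
Proof. by move=> [U [_ Ux] sU]; exact: (sU [::] x Ux).1. Qed.

Lemma smooth_at_derivable V W (f : V -> W) x v : smooth_at f x -> derivable f x v.
Proof. by move=> [U [_ Ux] sU]; exact: (sU [::] x Ux).2. Qed.

Lemma smooth_at_is_derive V W (f : V -> W) x v : smooth_at f x -> is_derive x v f ('D_v f x).
Proof. by move=> sf; exact/derivableP/smooth_at_derivable. Qed.

Lemma smooth_at_differentiable V W {fV : finDim V} {fW : finDim W} (f : V -> W) x :
  smooth_at f x -> differentiable f x.
Proof.
move=> [U [oU Ux] /smooth_on_Ck sU]; exact: C1_on_differentiable oU Ux (sU 1%N).
Qed.

Lemma smooth_at_derive V W (f : V -> W) x v : smooth_at f x -> smooth_at ('D_v f) x.
Proof.
by move=> [U oU sU]; exists U => // vs y Uy; rewrite -iter_derive_rcons; exact: sU.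
Qed.

Lemma smooth_at_cst V W (a : W) (x : V) : smooth_at (fun _ : V => a) x.
Proof.
exists setT; first by split => //; exact: openT.
by apply/smooth_on_Ck => k; exact: Ck_cst.
Qed.

Lemma smooth_at_linear V W (L : V -> W) x : linear L -> continuous L -> smooth_at L x.
Proof.
move=> lL cL; exists setT; first by split => //; exact: openT.
by apply/smooth_on_Ck => k; exact: Ck_linear.
Qed.

Lemma smooth_at_id V (x : V) : smooth_at (fun y : V => y) x.
Proof. by apply: smooth_at_linear => [//|y]; exact: cvg_id. Qed.

Lemma smooth_at_common V W X (f : V -> W) (g : V -> X) x :
  smooth_at f x -> smooth_at g x ->
  exists U, [/\ open U, U x, forall k, Ck k U f & forall k, Ck k U g].
Proof.
move=> [U [oU Ux] sU] [A [oA Ax] sA]; exists (U `&` A); split => //.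
- exact: openI.
- by apply/smooth_on_Ck => vs y [Uy _]; exact: sU.
- by apply/smooth_on_Ck => vs y [_ Ay]; exact: sA.
Qed.

Lemma smooth_at_add V W (f g : V -> W) x :
  smooth_at f x -> smooth_at g x -> smooth_at (fun y => f y + g y) x.
Proof.
move=> sf sg; have [U [oU Ux Cf Cg]] := smooth_at_common sf sg.
by exists U => //; apply/smooth_on_Ck => k; exact: Ck_add.
Qed.

Lemma smooth_at_scale V W (s : V -> R^o) (f : V -> W) x :
  smooth_at s x -> smooth_at f x -> smooth_at (fun y => s y *: f y) x.
Proof.
move=> sf sg; have [U [oU Ux Cf Cg]] := smooth_at_common sf sg.
by exists U => //; apply/smooth_on_Ck => k; exact: Ck_scale.
Qed.

Lemma smooth_at_opp V W (f : V -> W) x :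
  smooth_at f x -> smooth_at (fun y => - f y) x.
Proof.
move=> sf; apply: (@smooth_at_eq _ _ (fun y => (-1 : R^o) *: f y)).
  by near=> y; rewrite scaleN1r.
by apply: smooth_at_scale => //; exact: smooth_at_cst.
Unshelve. all: by end_near. Qed.

Lemma smooth_at_sum V W (I : Type) (r : seq I) (f : I -> V -> W) x :
  (forall i, smooth_at (f i) x) -> smooth_at (fun y => \sum_(i <- r) f i y) x.
Proof.
move=> sf; elim: r => [|i r IH].
  apply: (smooth_at_eq _ (smooth_at_cst 0 x)); near=> y; by rewrite big_nil.
apply: (smooth_at_eq _ (smooth_at_add (sf i) IH)); near=> y; by rewrite big_cons.
Unshelve. all: by end_near. Qed.

Lemma smooth_at_comp V W X {fV : finDim V} {fW : finDim W} {fX : finDim X}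
    (f : W -> X) (g : V -> W) x :
  smooth_at g x -> smooth_at f (g x) -> smooth_at (f \o g) x.
Proof.
move=> [U [oU Ux] sU] [A [oA Ax] sA].
have oB : open (U `&` g @^-1` A).
  rewrite openE => y [Uy Ay]; apply: filterI; first exact: open_nbhs_nbhs.
  by have := (sU [::] y Uy).1; apply; exact: open_nbhs_nbhs.
exists (U `&` g @^-1` A) => //; apply/smooth_on_Ck => k.
apply: (@Ck_comp _ _ _ _ _ _ _ _ _ A) => //; first by move=> y [].
  by move: k; exact/smooth_on_Ck.
by move: k; apply/smooth_on_Ck => vs y [Uy _]; exact: sU.
Qed.

Lemma smooth_at_pair V W X {fV : finDim V} {fW : finDim W} {fX : finDim X}
    (f : V -> W) (g : V -> X) x :
  smooth_at f x -> smooth_at g x -> smooth_at (fun y => (f y, g y)) x.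
Proof.
move=> sf sg.
have l1 : linear (fun y : W => (y, 0 : X)).
  by move=> a u v; rewrite -[_ *: (_, _)]/(_ *: _, _ *: _) -[RHS]/(_ + _, _ + _) scaler0 addr0.
have l2 : linear (fun y : X => (0 : W, y)).
  by move=> a u v; rewrite -[_ *: (_, _)]/(_ *: _, _ *: _) -[RHS]/(_ + _, _ + _) scaler0 addr0.
have c1 : continuous (fun y : W => (y, 0 : X)).
  by move=> y; apply: cvg_pair; [exact: cvg_id|exact: cvg_cst].
have c2 : continuous (fun y : X => (0 : W, y)).
  by move=> y; apply: cvg_pair; [exact: cvg_cst|exact: cvg_id].
pose proof (smooth_at_comp sf (smooth_at_linear (f x) l1 c1)) as s1.
pose proof (smooth_at_comp sg (smooth_at_linear (g x) l2 c2)) as s2.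
apply: smooth_at_eq (smooth_at_add s1 s2); near=> y.
by rewrite /= -[LHS]/(_ + _, _ + _) addr0 add0r.
Unshelve. all: by end_near. Qed.

Lemma derive_comp V W X {fV : finDim V} {fW : finDim W} {fX : finDim X}
    (f : W -> X) (g : V -> W) x v :
  smooth_at g x -> smooth_at f (g x) -> 'D_v (f \o g) x = 'D_('D_v g x) f (g x).
Proof.
by move=> sg sf; have [_ ->] := diff_comp_derive v (smooth_at_differentiable sg) (smooth_at_differentiable sf).
Qed.

Lemma derive_pair V W X (f : V -> W) (g : V -> X) x v df dg :
  is_derive x v f df -> is_derive x v g dg ->
  is_derive x v (fun y => (f y, g y)) (df, dg).
Proof.
move=> /is_derive_is_cvg Df /is_derive_is_cvg Dg; apply: is_derive_cvg.
exact: (cvg_pair Df Dg).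
Qed.

Lemma derive_linear V W {fV : finDim V} {fW : finDim W} (f : V -> W) x :
  smooth_at f x -> linear (fun v => 'D_v f x).
Proof. by move=> /smooth_at_differentiable df a u v; rewrite !deriveE// linearP. Qed.

Lemma derive_dirD V W {fV : finDim V} {fW : finDim W} (f : V -> W) x u v :
  smooth_at f x -> 'D_(u + v) f x = 'D_u f x + 'D_v f x.
Proof. by move=> /smooth_at_differentiable df; rewrite !deriveE// linearD. Qed.

Lemma derive_dirZ V W {fV : finDim V} {fW : finDim W} (f : V -> W) x a v :
  smooth_at f x -> 'D_(a *: v) f x = a *: 'D_v f x.
Proof. by move=> /smooth_at_differentiable df; rewrite !deriveE// linearZ. Qed.

Lemma derive_dirN V W {fV : finDim V} {fW : finDim W} (f : V -> W) x v :
  smooth_at f x -> 'D_(- v) f x = - 'D_v f x.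
Proof. by move=> sf; rewrite -scaleN1r derive_dirZ// scaleN1r. Qed.

Lemma derive_translate V W (f : V -> W) (a x v : V) df :
  is_derive (x + a) v f df -> is_derive x v (fun y => f (y + a)) df.
Proof.
move=> /is_derive_is_cvg D; apply: is_derive_cvg.
by under eq_fun do rewrite -addrA.
Qed.

(** Two uses of the mean value theorem: along u for y |-> f (y + h v) - f y, then along v for the
    derivative of f in direction u. *)
Lemma mixed_difference V (f : V -> R^o) (x u v : V) (h : R) :
  (forall s t, `|s| <= `|h| -> `|t| <= `|h| ->
     derivable f (x + s *: u + t *: v) u /\ derivable ('D_u f) (x + s *: u + t *: v) v) ->
  exists s t, [/\ `|s| <= `|h|, `|t| <= `|h| &
    f (x + h *: u + h *: v) - f (x + h *: u) - f (x + h *: v) + f x =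
    h * (h * 'D_v ('D_u f) (x + s *: u + t *: v))].
Proof.
move=> H; have h0 : `|0 : R| <= `|h| by rewrite normr0 normr_ge0.
pose g y := f (y + h *: v) - f y.
have dg (s : R) : `|s| <= `|h| ->
    is_derive (x + s *: u) u g ('D_u f (x + s *: u + h *: v) - 'D_u f (x + s *: u)).
  move=> sh; apply: is_deriveB; first exact/derive_translate/derivableP/(H s h _ _).1.
  apply: derivableP; have := (H s 0 sh h0).1; by rewrite scale0r addr0.
have [s sh E1] := @MVT_dir _ _ g x u h (fun s sh => @ex_derive _ _ _ _ _ _ _ (dg s sh)).
have [t th E2] := @MVT_dir _ _ ('D_u f) (x + s *: u) v h (fun t th => (H s t sh th).2).
exists s, t; split=> //; rewrite -E2.
have [_ <-] := dg s sh; rewrite -E1 /g.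
by rewrite opprB addrA addrAC.
Qed.

Lemma fcoord_inj V {fV : finDim V} (u v : V) :
  (forall i, fcoord i u = fcoord i v) -> u = v.
Proof. by move=> E; rewrite [u]fcoordK [v]fcoordK; apply: eq_bigr => i _; rewrite E. Qed.

(** The second difference of [mixed_difference] is symmetric in u and v, so the two mixed
    derivatives agree at two points near x, hence at x up to any e by continuity. *)
Lemma derive_sym V W {fV : finDim V} {fW : finDim W} (f : V -> W) x u v :
  smooth_at f x -> 'D_u ('D_v f) x = 'D_v ('D_u f) x.
Proof.
move=> sf.
suff S (g : V -> R^o) : smooth_at g x -> 'D_u ('D_v g) x = 'D_v ('D_u g) x.
  have E (a b : V) i : fcoord i ('D_a ('D_b f) x) = 'D_a ('D_b (fcoord i \o f)) x.
    have [_ <-] := linear_comp_derive (fcoord_linear i) (fcoord_continuous i)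
       (smooth_at_is_derive a (smooth_at_derive b sf)).
    apply: near_eq_derive; apply: filterS (smooth_at_near sf) => y sfy.
    by have [_ ->] := linear_comp_derive (fcoord_linear i) (fcoord_continuous i) (smooth_at_is_derive b sfy).
  apply: (@fcoord_inj _ fW) => i.
  rewrite !E; apply: S; apply: (@smooth_at_comp _ _ _ _ _ _ (fcoord i) f) => //.
  apply: smooth_at_linear; [exact: fcoord_linear|exact: fcoord_continuous].
move=> sg; apply/eqP; rewrite -subr_eq0 -normr_le0; apply/ler_addgt0Pr => e e0; rewrite add0r.
have e2 : 0 < e / 2 by rewrite divr_gt0.
have C a b : \forall y \near x, `|'D_a ('D_b g) x - 'D_a ('D_b g) y| <= e / 2.
  have := smooth_at_continuous (smooth_at_derive a (smooth_at_derive b sg)).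
  by move=> /cvgrPdist_le /(_ _ e2).
have : \forall y \near x, [/\ smooth_at g y, `|'D_u ('D_v g) x - 'D_u ('D_v g) y| <= e / 2
    & `|'D_v ('D_u g) x - 'D_v ('D_u g) y| <= e / 2].
  by apply: filterS3 (smooth_at_near sg) (C u v) (C v u) => y.
move=> /nbhs_ballP[d /= d0 Hd].
(* Keeps every point x + s u + t v with |s|, |t| <= h within distance d of x. *)
pose h := d / (1 + (`|u| + `|v|)).
have B0 : 0 < 1 + (`|u| + `|v|) by rewrite ltr_pwDl// addr_ge0.
have h0 : 0 < h by rewrite divr_gt0.
have bd a b s t : `|a| + `|b| = `|u| + `|v| -> `|s| <= `|h| -> `|t| <= `|h| -> ball x d (x + s *: a + t *: b).
  move=> ab sh th; rewrite -ball_normE /= -addrA opprD addrA subrr sub0r normrN.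
  apply: le_lt_trans (ler_normD _ _) _; rewrite !normrZ.
  apply: (@le_lt_trans _ _ (h * (`|a| + `|b|))).
    by rewrite mulrDr lerD// ler_wpM2r// -[h]gtr0_norm.
  rewrite ab /h mulrAC ltr_pdivrMr// ltr_pM2l//; lra.
have [s|s [t [sh th E1]]] := @mixed_difference _ g x u v h.
  move=> t sh th; have [sgy _ _] := Hd _ (bd u v s t erefl sh th).
  split; first exact: smooth_at_derivable.
  by apply: smooth_at_derivable; exact: smooth_at_derive.
have [s'|s' [t' [sh' th' E2]]] := @mixed_difference _ g x v u h.
  move=> t' sh' th'; have [sgy _ _] := Hd _ (bd v u s' t' (addrC _ _) sh' th').
  split; first exact: smooth_at_derivable.
  by apply: smooth_at_derivable; exact: smooth_at_derive.
have [_ _ B1] := Hd _ (bd u v s t erefl sh th).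
have [_ B2 _] := Hd _ (bd v u s' t' (addrC _ _) sh' th').
move: E1 E2 B1 B2; move: ('D_v ('D_u g) (x + _ + _)) ('D_u ('D_v g) (x + _ + _)) => A B.
move: ('D_u ('D_v g) x) ('D_v ('D_u g) x) => A' B' E1 E2 B1 B2.
have E : A = B.
  apply: (mulfI (lt0r_neq0 h0)); apply: (mulfI (lt0r_neq0 h0)); rewrite -E1 -E2.
  by rewrite (addrAC x) (addrAC (g _)).
rewrite (splitr e); apply: le_trans (lerD B2 B1).
rewrite -E; apply: le_trans (ler_normB _ _).
by rewrite opprB addrA subrK.
Qed.
End SmoothAt.

(** * Ordinary differential equations *)

Section RowNorm.
Variable R : realType.

Lemma rV_norm_le n (v : 'rV[R]_n) (K : R) :
  0 <= K -> (forall i, `|v ord0 i| <= K) -> `|v| <= K.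
Proof.
move=> K0 H; rewrite [leLHS]/Num.Def.normr/= mx_normrE bigmax_le//= => -[i j] _ /=.
by rewrite (ord1 i).
Qed.

Lemma rV_coord_norm n (v : 'rV[R]_n) i : `|v ord0 i| <= `|v|.
Proof. by rewrite [leRHS]/Num.Def.normr/= mx_normrE; exact: (le_bigmax _ _ (ord0, i)). Qed.

Lemma is_derive_rV (V : normedModType R) n (f : V -> 'rV[R]_n) (x v : V) (df : 'rV[R]_n) :
  (forall i, is_derive x v (fun y => f y ord0 i : R^o) (df ord0 i)) -> is_derive x v f df.
Proof.
move=> H; have D : derivable f x v.
  by apply/derivable_mxP => i j; rewrite (ord1 i); have [] := H j.
split=> //; rewrite derive_mx//; apply/rowP => i; rewrite mxE.
by have [_ <-] := H i.
Qed.

Lemma is_derive_rV_coord (V : normedModType R) n (f : V -> 'rV[R]_n) (x v : V) (df : 'rV[R]_n) i :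
  is_derive x v f df -> is_derive x v (fun y => f y ord0 i : R^o) (df ord0 i).
Proof.
move=> [D <-]; have /derivable_mxP D' := D.
by split; [exact: D'|rewrite derive_mx// mxE].
Qed.

(** The norm of a row is the maximum of its coordinates, so the scalar mean value theorem in each
    coordinate loses no constant. *)
Lemma mean_value_bound n (g dg : R^o -> 'rV[R]_n) (t K : R) :
  0 <= K -> (forall s : R, `|s| <= `|t| -> is_derive (s : R^o) (1 : R^o) g (dg s)) ->
  (forall s : R, `|s| <= `|t| -> `|dg s| <= K) -> `|g t - g 0| <= `|t| * K.
Proof.
move=> K0 H B; apply: rV_norm_le => [|i]; first by rewrite mulr_ge0.
pose gi := fun s : R^o => g s ord0 i : R^o.
have E (s : R) : (0 : R^o) + s *: (1 : R^o) = s by rewrite add0r [LHS]mulr1.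
have Hi (s : R) : `|s| <= `|t| -> is_derive (s : R^o) (1 : R^o) gi (dg s ord0 i).
  by move=> st; apply: is_derive_rV_coord; exact: H.
have [s st] := @MVT_dir R R^o gi 0 1 t (fun s st => eq_ind_r (fun z => derivable gi z 1)
   (@ex_derive _ _ _ _ _ _ _ (Hi s st)) (E s)).
rewrite !E /gi => Es; rewrite !mxE Es normrM ler_wpM2l//.
have [_ ->] := Hi s st.
by apply: le_trans (B s st); exact: rV_coord_norm.
Qed.
End RowNorm.

Section Antiderivative.
Variable R : realType.

(** The integral starts at -T rather than at 0, so that the fundamental theorem also applies at
    negative times; its value at 0 is then subtracted. *)
Lemma antiderivative_scalar (f : R -> R) (T : R) : 0 < T -> continuous f ->
  exists P : R^o -> R^o, P 0 = 0 /\
    forall t : R, `|t| < T -> is_derive (t : R^o) (1 : R^o) P (f t).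
Proof.
move=> T0 cf; pose mu := @lebesgue_measure R.
pose F x := (\int[mu]_(t in [set` `[- T, x]]) (f t))%R.
have I : mu.-integrable `[- T, T] (EFin \o f).
  apply: continuous_compact_integrable; first exact: segment_compact.
  exact: continuous_subspaceT.
exists (fun x => F x - F 0); split; first by rewrite subrr.
move=> t; rewrite ltr_norml => /andP[t1 t2].
have [D E] := @continuous_FTC1_closed R f (- T) t T t2 I t1 (cf t).
rewrite -[f t]subr0; apply: is_deriveB.
by split; [exact: D|rewrite -derive1E].
Qed.

Lemma antiderivative n (f : R^o -> 'rV[R]_n) (T : R) : 0 < T -> continuous f ->
  exists P : R^o -> 'rV[R]_n, P 0 = 0 /\
    forall t : R, `|t| < T -> is_derive (t : R^o) (1 : R^o) P (f t).
Proof.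
move=> T0 cf.
have H i : exists P : R^o -> R^o, P 0 = 0 /\
    forall t : R, `|t| < T -> is_derive (t : R^o) (1 : R^o) P (f t ord0 i).
  apply: (@antiderivative_scalar (fun t => f t ord0 i)) => // t.
  exact: (cvg_comp _ _ (cf t) (@coord_continuous R 1 n ord0 i (f t))).
pose P i := sval (cid (H i)).
exists (fun t => \row_i P i t); split.
  by apply/rowP => i; rewrite !mxE /P; case: cid => /= p [].
move=> t tT; apply: is_derive_rV => i.
have -> : (fun y : R^o => (\row_j P j y) ord0 i : R^o) = P i by apply/funext => y; rewrite mxE.
by rewrite /P; case: cid => /= p [_]; exact.
Qed.
End Antiderivative.

(** * Picard iteration for globally Lipschitz vector fields *)

Section Picard.
Variables (R : realType) (n : nat).
Local Notation E := 'rV[R]_n.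

Lemma is_derive1_continuous (g : R^o -> E) (t : R^o) (dg : E) :
  is_derive t (1 : R^o) g dg -> {for t, continuous g}.
Proof. by move=> [D _]; apply/differentiable_continuous/derivable1_diffP. Qed.

Lemma geometric_limit (u : nat -> E) (C : R) :
  (forall k, `|u k.+1 - u k| <= C / 2 ^+ k) ->
  exists l, forall k, `|l - u k| <= 2 * C / 2 ^+ k.
Proof.
move=> H.
have C0 : 0 <= C by have := H 0; rewrite expr0 divr1; exact: le_trans.
have B m k : `|u (k + m)%N - u k| <= 2 * C / 2 ^+ k.
  (* The subtracted tail is what makes the induction on m close. *)
  suff : `|u (k + m)%N - u k| <= 2 * C / 2 ^+ k - 2 * C / 2 ^+ (k + m).
    by move=> h; apply: le_trans h _; rewrite gerBl divr_ge0// ?exprn_ge0// mulr_ge0.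
  elim: m => [|m IH]; first by rewrite addn0 !subrr normr0.
  rewrite addnS -[X in `|X|](subrKA (u (k + m)%N)).
  apply: le_trans (ler_normD _ _) _; apply: le_trans (lerD (H _) IH) _.
  rewrite exprS; have e0 : 2 ^+ (k + m) != 0 :> R by rewrite expf_neq0.
  have e1 : 2 ^+ k != 0 :> R by rewrite expf_neq0.
  by rewrite le_eqVlt; apply/orP; left; apply/eqP; field; rewrite e0 e1.
have E0 (e : R) : 0 < e -> \forall k \near \oo, 2 * C / 2 ^+ k < e.
  have h : `|1 / 2 : R| < 1 by rewrite ger0_norm; lra.
  move=> e0; have := @cvg_geometric R (2 * C) (1 / 2) h.
  move=> /cvgrPdist_lt /(_ e e0); apply: filterS => k /=.
  by rewrite sub0r normrN => /(le_lt_trans (ler_norm _)); rewrite expr_div_n expr1n mul1r.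
have CU : cvg (u @ \oo).
  apply/cauchy_cvgP; apply/cauchy_ballP => e e0; near_simpl.
  have e2 : 0 < e / 2 by rewrite divr_gt0.
  near \oo => N.
  have HN : 2 * C / 2 ^+ N < e / 2 by near: N; exact: E0.
  exists ([set k | (N <= k)%N], [set k | (N <= k)%N]); first by split; exists N.
  move=> [k m] [/= Nk Nm]; rewrite -ball_normE /= (splitr e) -(subrKA (u N)).
  apply: le_lt_trans (ler_normD _ _) _; apply: ltrD.
    by rewrite -(subnKC Nk); exact: le_lt_trans (B _ _) HN.
  by rewrite distrC -(subnKC Nm); exact: le_lt_trans (B _ _) HN.
exists (lim (u @ \oo)) => k.
have D : (fun m => `|u (k + m)%N - u k|) @ \oo --> `|lim (u @ \oo) - u k|.
  apply: cvg_norm; apply: cvgB; last exact: cvg_cst.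
  by have := CU; rewrite -(cvg_shiftn k); under eq_fun do rewrite addnC.
by apply: (cvgr_to_le D); near=> m; exact: B.
Unshelve. all: by end_near. Qed.

Lemma lipschitz_continuous (V W : normedModType R) (f : V -> W) (K : R) :
  0 < K -> (forall u v, `|f u - f v| <= K * `|u - v|) -> continuous f.
Proof.
move=> K0 H x; apply/cvgrPdist_le => e e0; have eK : 0 < e / K by rewrite divr_gt0.
apply/nbhs_ballP; exists (e / K) => //= y; rewrite -ball_normE /= => xy.
by apply: le_trans (H x y) _; rewrite -ler_pdivlMl// mulrC ltW.
Qed.

(** The 1-Lipschitz retraction of the line onto [-r, r]. It serves twice: for the time in the Picard
    iteration, and for the coordinates when a locally Lipschitz field is extended to the whole
    space. *)
Definition clamp (r x : R) : R := if x < - r then - r else if r < x then r else x.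

Lemma clamp_id r x : `|x| <= r -> clamp r x = x.
Proof. by rewrite ler_norml /clamp => /andP[a b]; rewrite !ltNge a b. Qed.

Lemma clamp_bound r x : 0 <= r -> `|clamp r x| <= r.
Proof.
move=> r0; rewrite /clamp ler_norml.
case: ltP => a; first by lra.
by case: ltP => b; lra.
Qed.

Lemma clamp_lipschitz r x y : 0 <= r -> `|clamp r x - clamp r y| <= `|x - y|.
Proof.
move=> r0; rewrite /clamp.
wlog xy : x y / x <= y.
  move=> H; have [|/ltW] := leP x y; first exact: H.
  by move=> /H; rewrite distrC [`|y - x|]distrC.
rewrite [`|x - y|]distrC [leLHS]distrC (@ger0_norm _ (y - x)) ?subr_ge0// ler_norml.
by case: (ltP x (- r)) => a; case: (ltP y (- r)) => b; case: (ltP r x) => c; case: (ltP r y) => d; lra.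
Qed.

Lemma clamp_continuous r : 0 <= r -> continuous (clamp r : R^o -> R^o).
Proof.
move=> r0; apply: (@lipschitz_continuous R^o R^o _ 1) => // u v.
by rewrite mul1r; exact: clamp_lipschitz.
Qed.

Section Iteration.
Variables (X : E -> E) (L e : R) (x0 : E).
Hypotheses (L0 : 0 < L) (e0 : 0 < e) (eL : e * L <= 1 / 2).
Hypothesis lipX : forall u v, `|X u - X v| <= L * `|u - v|.

(* One Picard step contracts distances by 1/2, since e * L <= 1/2. *)
Lemma gronwall_halving (w dw : R^o -> E) (T K : R) :
  0 <= K -> T <= e -> w 0 = 0 ->
  (forall t : R, `|t| <= T -> is_derive (t : R^o) (1 : R^o) w (dw t)) ->
  (forall t, `|t| <= T -> `|dw t| <= L * K) ->
  forall t, `|t| <= T -> `|w t| <= K / 2.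
Proof.
move=> K0 Te w0 Dw B t tT; rewrite -[w t]subr0 -w0.
apply: (@le_trans _ _ (`|t| * (L * K))).
  apply: (@mean_value_bound R n w dw); first by rewrite mulr_ge0// ltW.
    by move=> s st; apply: Dw; exact: le_trans st tT.
  by move=> s st; apply: B; exact: le_trans st tT.
rewrite mulrA [K / 2]mulrC ler_wpM2r//.
apply: (@le_trans _ _ (e * L)); last by rewrite -[2^-1]mul1r.
by rewrite ler_wpM2r ?(ltW L0)//; exact: le_trans tT Te.
Qed.

(** The difference of two solutions is bounded on a compact interval, and any bound can be halved by
    [gronwall_halving]; hence it is 0. *)
Lemma ode_unique (u v : R^o -> E) (T : R) :
  T <= e -> u 0 = v 0 ->
  (forall t : R, `|t| < T -> is_derive (t : R^o) (1 : R^o) u (X (u t))) ->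
  (forall t : R, `|t| < T -> is_derive (t : R^o) (1 : R^o) v (X (v t))) ->
  forall t, `|t| < T -> u t = v t.
Proof.
move=> Te uv Du Dv t tT.
have sT s : `|s| <= `|t| -> `|s| < T by move=> st; exact: le_lt_trans st tT.
pose w := fun s : R^o => u s - v s.
have Dw s : `|s| <= `|t| -> is_derive (s : R^o) (1 : R^o) w (X (u s) - X (v s)).
  by move=> st; apply: is_deriveB; [apply: Du|apply: Dv]; exact: sT.
have [C C0 CP] : exists2 C, 0 <= C & forall s, `|s| <= `|t| -> `|w s| <= C.
  have a : - `|t| <= `|t| by rewrite (@le_trans _ _ 0)// oppr_le0.
  have [|c cab cP] := @EVT_max R (fun s => `|w s|) _ _ a.
    apply: continuous_in_subspaceT => s /[!inE]/=; rewrite in_itv/= -ler_norml => st.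
    by apply: cvg_norm; exact: is_derive1_continuous (Dw s st).
  exists `|w c| => // s st; apply: cP; by rewrite in_itv/= -ler_norml.
have B k : forall s, `|s| <= `|t| -> `|w s| <= C / 2 ^+ k.
  elim: k => [|k IH]; first by rewrite expr0 divr1.
  rewrite exprSr invfM mulrA [_ * _ / 2]mulrAC -[_ / 2 / 2 ^+ k]mulrAC => s st.
  apply: (@gronwall_halving w _ `|t|) Dw _ s st.
  - by rewrite divr_ge0// exprn_ge0.
  - exact: le_trans (ltW tT) Te.
  - by rewrite /w uv subrr.
  - by move=> s' st'; apply: le_trans (lipX _ _) _; rewrite ler_wpM2l ?(ltW L0)//; exact: IH.
apply/eqP; rewrite -subr_eq0 -normr_le0 -/(w t).
have h : `|1 / 2 : R| < 1 by rewrite ger0_norm; lra.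
have D := @cvg_geometric R C (1 / 2) h.
apply: (cvgr_to_ge D); near=> k => /=.
by rewrite expr_div_n expr1n mul1r; exact: B.
Unshelve. all: by end_near. Qed.

(* Picard iteration; clamping the time makes every iterate continuous on the whole line. *)
Lemma ode_exists : exists2 g : R^o -> E, g 0 = x0 &
  forall t : R, `|t| < e -> is_derive (t : R^o) (1 : R^o) g (X (g t)).
Proof.
have e20 : 0 < 2 * e by rewrite mulr_gt0.
have e2 (t : R) : `|t| <= e -> `|t| < 2 * e.
  by move=> te; apply: le_lt_trans te _; rewrite ltr_pMl// ltr1n.
have cX : continuous X := lipschitz_continuous L0 lipX.
(* The antiderivative is taken on (-2e, 2e), so that a time clamped to [-e, e] is an interior point.
   For a discontinuous g any value will do. *)
have step (g : R^o -> E) : {P : R^o -> E | continuous g -> P 0 = 0 /\ forall t : R, `|t| < 2 * e -> is_derive (t : R^o) (1 : R^o) P (X (g t))}.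
  apply: cid; have [cg|ncg] := pselect (continuous g); last by exists (fun=> 0).
  have [t|P HP] := @antiderivative R n (fun t => X (g t)) (2 * e) e20; last by exists P.
  exact: (cvg_comp _ _ (cg t) (cX (g t))).
pose S (g : R^o -> E) : R^o -> E := fun t => x0 + sval (step g) (clamp e t).
have cS g : continuous g -> continuous (S g).
  move=> cg t; apply: cvgD; first exact: cvg_cst.
  have [_ D] := svalP (step g) cg.
  apply: (@continuous_comp _ _ _ (clamp e : R^o -> R^o) (sval (step g)) t).
    by apply: clamp_continuous; exact: ltW.
  by apply: (is_derive1_continuous (D _ (e2 _ _))); exact/clamp_bound/ltW.
pose g k := iter k S (fun=> x0).
have cg k : continuous (g k).
  by elim: k => [|k IH]; [move=> t; exact: cvg_cst|exact: cS].
have cl (t : R) : `|clamp e t| <= e by exact/clamp_bound/ltW.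
have half (f1 f2 : R^o -> E) (K : R) : continuous f1 -> continuous f2 -> 0 <= K ->
    (forall t, `|t| <= e -> `|f1 t - f2 t| <= K) -> forall t, `|S f1 t - S f2 t| <= K / 2.
  move=> c1 c2 K0 B t; rewrite /S opprD addrACA subrr add0r.
  have [z1 D1] := svalP (step f1) c1; have [z2 D2] := svalP (step f2) c2.
  apply: (@gronwall_halving (fun t : R^o => sval (step f1) t - sval (step f2) t)
     (fun t => X (f1 t) - X (f2 t)) e K) => //.
  - by rewrite z1 z2 subrr.
  - by move=> s se; apply: is_deriveB; [apply: D1|apply: D2]; exact: e2.
  - by move=> s se; apply: le_trans (lipX _ _) _; rewrite ler_wpM2l ?(ltW L0)//; exact: B.
have [C C0 CP] : exists2 C, 0 <= C & forall t, `|g 1%N t - g 0%N t| <= C.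
  exists (e * `|X x0|) => [|t]; first by rewrite mulr_ge0// ltW.
  rewrite /g /= /S addrAC subrr add0r.
  case: (step (fun=> x0)) => P /= /(_ (cg 0%N)) [z D].
  rewrite -[P _]subr0 -z; apply: (@le_trans _ _ (`|clamp e t| * `|X x0|)).
    apply: (@mean_value_bound R n _ (fun=> X x0)) => // s st.
    by apply: D; apply: e2; exact: le_trans st (cl t).
  by rewrite ler_wpM2r.
have B k : forall t, `|g k.+1 t - g k t| <= C / 2 ^+ k.
  elim: k => [|k IH] t; first by rewrite expr0 divr1.
  rewrite exprSr invfM mulrA; apply: (half (g k.+1) (g k) _ (cg _) (cg _)) => [|s _]; last exact: IH.
  by rewrite divr_ge0// exprn_ge0.
have LL t := geometric_limit (fun k => B k t).
pose h t := sval (cid (LL t)).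
have hP k t : `|h t - g k t| <= 2 * C / 2 ^+ k by rewrite /h; case: cid.
have E0 (d : R) : 0 < d -> exists k : nat, 2 * C / 2 ^+ k < d.
  move=> d0; have hh : `|1 / 2 : R| < 1 by rewrite ger0_norm; lra.
  have /cvgrPdist_lt /(_ d d0) := @cvg_geometric R (2 * C) (1 / 2) hh.
  move=> [k _ /(_ k (leqnn k))] /= kd; exists k; move: kd.
  by rewrite sub0r normrN => /(le_lt_trans (ler_norm _)); rewrite expr_div_n expr1n mul1r.
have ch : continuous (h : R^o -> E).
  move=> t; apply/cvgrPdist_lt => d d0; have d3 : 0 < d / 3 by rewrite divr_gt0.
  have [k kd] := E0 _ d3.
  have /cvgrPdist_lt /(_ _ d3) := cg k t; apply: filterS => s gs.
  have -> : d = d / 3 + (d / 3 + d / 3) by field.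
  rewrite -(subrKA (g k t)) -[g k t - h s](subrKA (g k s)).
  apply: le_lt_trans (ler_normD _ _) _; apply: ltrD; first exact: le_lt_trans (hP k t) kd.
  apply: le_lt_trans (ler_normD _ _) _; apply: ltrD => //.
  by rewrite distrC; exact: le_lt_trans (hP k s) kd.
(* Both sides are close to g (k + 1) = S (g k): the left one because S halves the distance from h to
   g k, the right one by convergence. *)
have fixh t : S h t = h t.
  apply/eqP; rewrite -subr_eq0 -normr_le0; apply/ler_addgt0Pr => d d0; rewrite add0r.
  have d2 : 0 < d / 2 by rewrite divr_gt0.
  have [k kd] := E0 _ d2.
  rewrite (splitr d) -(subrKA (g k.+1 t)); apply: le_trans (ler_normD _ _) _; apply: lerD.
    apply: (@le_trans _ _ (2 * C / 2 ^+ k / 2)); last by lra.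
    apply: (half h (g k) _ ch (cg _)) => [|s _]; last exact: hP.
    by rewrite divr_ge0// ?exprn_ge0// mulr_ge0.
  rewrite distrC; apply: le_trans (hP _ t) _.
  have : 2 * C / 2 ^+ k.+1 <= 2 * C / 2 ^+ k.
    rewrite exprSr invfM mulrA ler_piMr//; first by rewrite divr_ge0// ?exprn_ge0// mulr_ge0.
    by lra.
  by move=> /le_trans; apply; exact: ltW.
have [z D] := svalP (step h) ch.
exists (fun t => x0 + sval (step h) t); first by rewrite z addr0.
move=> t te; have -> : x0 + sval (step h) t = h t by rewrite -fixh /S clamp_id// ltW.
rewrite -[X (h t)]add0r; apply: is_deriveD.
by apply: D; apply: e2; exact: ltW.
Qed.
End Iteration.

(** Bootstrap: the derivative of g is X composed with g, hence is as regular as g, so each order of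
    regularity gives the next. *)
Lemma ode_smooth (X : E -> E) (g : R^o -> E) (U : set R^o) :
  open U -> (forall t, U t -> smooth_at X (g t)) ->
  (forall t, U t -> is_derive (t : R^o) (1 : R^o) g (X (g t))) ->
  smooth_on U g.
Proof.
move=> oU sX Dg; apply/smooth_on_Ck.
have dg t v : U t -> is_derive (t : R^o) (v : R^o) g (v *: X (g t)).
  move=> Ut; have [D1 D2] := Dg t Ut; have dd : differentiable g t by exact/derivable1_diffP.
  split; first exact: diff_derivable.
  by rewrite -D2 !deriveE// -linearZ; congr ('d g t _); rewrite [RHS]mulr1.
have cg t : U t -> {for t, continuous g} by move=> Ut; exact: is_derive1_continuous (Dg t Ut).
pose A := [set x | smooth_at X x].
have oA : open A by rewrite openE => x Ax; exact: (smooth_at_near Ax).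
have CX k : Ck k A X by move: k; apply/smooth_on_Ck/smooth_at_on.
elim=> [|k IH] //=; split=> // [t v Ut|v]; first by have [] := dg t v Ut.
apply: (@Ck_eq _ _ _ _ _ (fun t => (v : R^o) *: (X \o g) t)) => //.
  by move=> t Ut; have [_ ->] := dg t v Ut.
apply: Ck_scale => //; first exact: Ck_cst.
by apply: (@Ck_comp _ _ _ _ _ _ _ _ _ A).
Qed.
End Picard.

Section LocalODE.
Variables (R : realType) (n : nat).
Local Notation E := 'rV[R]_n.

(* Y is X composed with the retraction onto a cube around x0. *)
Lemma smooth_locally_lipschitz (X : E -> E) (x0 : E) : smooth_at X x0 ->
  exists r L (Y : E -> E), [/\ 0 < r, 0 < L, forall u v, `|Y u - Y v| <= L * `|u - v|
    & forall u, `|u - x0| <= r -> Y u = X u].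
Proof.
move=> sX.
pose K : R := 1 + \sum_i `|'D_(delta_mx ord0 i) X x0|.
have K0 : 0 < K by rewrite ltr_pwDl// sumr_ge0.
have : \forall y \near x0, forall i : 'I_n, `|'D_(delta_mx ord0 i) X y| <= K.
  apply: (@filter_forall _ _ (fun i y => `|'D_(delta_mx ord0 i) X y| <= K) (nbhs x0)) => i.
  have /cvgrPdist_le /(_ _ ltr01) := smooth_at_continuous (smooth_at_derive (delta_mx ord0 i) sX).
  apply: filterS => y; move: ('D_(delta_mx ord0 i) X y) => A By.
  apply: (@le_trans _ _ (1 + `|'D_(delta_mx ord0 i) X x0|)).
    rewrite -[A](subrK ('D_(delta_mx ord0 i) X x0)); apply: le_trans (ler_normD _ _) _.
    by rewrite lerD// distrC.
  by rewrite lerD2l (bigD1 i)//= lerDl sumr_ge0.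
move=> /(filterI (smooth_at_near sX))/nbhs_ballP[d /= d0 Hd].
pose L := K * n%:R + 1.
have L0 : 0 < L by rewrite ltr_wpDl// mulr_ge0// ltW.
(* On the segment from v to u the distance to x0 is at most d/4 + d/2 < d, where the partial
   derivatives are bounded by K. *)
have lip u v : `|u - x0| <= d / 4 -> `|v - x0| <= d / 4 -> `|X u - X v| <= L * `|u - v|.
  move=> ux vx; have [->|uv] := eqVneq u v; first by rewrite !subrr !normr0 mulr0.
  apply: rV_norm_le => [|j]; first by rewrite mulr_ge0// ltW.
  pose h := u - v.
  have B (s : R) : `|s| <= `|1 : R| -> ball x0 d (v + s *: h).
    rewrite normr1 => s1; rewrite -ball_normE /= distrC -addrA [s *: h + _]addrC addrA.
    apply: le_lt_trans (ler_normD _ _) _; rewrite normrZ.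
    have : `|h| <= d / 4 + d / 4.
      rewrite /h -(subrKA x0); apply: le_trans (ler_normD _ _) _.
      by rewrite lerD// distrC.
    have : `|s| * `|h| <= `|h| by rewrite ler_piMl.
    by move: vx; lra.
  have D y : smooth_at X y -> is_derive y h (fun z => X z ord0 j : R^o) ('D_h X y ord0 j).
    by move=> sy; apply: is_derive_rV_coord; exact: smooth_at_is_derive.
  have [s s1] := @MVT_dir R E (fun z => X z ord0 j) v h 1 (fun s s1 => @ex_derive _ _ _ _ _ _ _ (D _ (Hd _ (B s s1)).1)).
  have hv : v + h = u by rewrite /h addrC subrK.
  rewrite scale1r mul1r hv => Ex; rewrite !mxE Ex.
  have [sy yK] := Hd _ (B s s1).
  have [_ ->] := D _ sy; apply: le_trans (rV_coord_norm _ _) _.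
  rewrite (derive_basis _ (smooth_at_differentiable sy)).
  apply: le_trans (ler_norm_sum _ _ _) _.
  apply: (@le_trans _ _ (\sum_(i < n) (K * `|h|))).
    apply: ler_sum => i _; rewrite normrZ mulrC ler_pM//; first exact: yK.
    exact: rV_coord_norm.
  rewrite sumr_const card_ord -[_ *+ _]mulr_natr mulrAC ler_wpM2r// /L.
  by rewrite lerDl ler01.
have r0 : 0 < d / 4 by rewrite divr_gt0.
pose c u : E := x0 + \row_i clamp (d / 4) ((u - x0) ord0 i).
have cb u : `|c u - x0| <= d / 4.
  rewrite /c addrAC subrr add0r; apply: rV_norm_le => [|i]; first exact: ltW.
  by rewrite mxE; exact/clamp_bound/ltW.
exists (d / 4), L, (X \o c); split => // [u v|u ux] /=.
  apply: le_trans (lip _ _ (cb u) (cb v)) _; rewrite ler_wpM2l ?(ltW L0)//.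
  rewrite /c opprD addrACA subrr add0r; apply: rV_norm_le => // i; rewrite !mxE.
  apply: le_trans (clamp_lipschitz _ _ (ltW r0)) _.
  rewrite opprB addrA subrK.
  by apply: le_trans (rV_coord_norm (u - v) i); rewrite !mxE.
congr X; rewrite /c -[RHS](subrK x0) addrC; congr (_ + _).
apply/rowP => i; rewrite !mxE clamp_id//.
by apply: le_trans ux; apply: le_trans (rV_coord_norm (u - x0) i); rewrite !mxE.
Qed.

Lemma time_step (L : R) : 0 < L -> exists2 e, 0 < e & e * L <= 1 / 2.
Proof. by move=> L0; exists (1 / (2 * L)); [rewrite divr_gt0// mulr_gt0|rewrite le_eqVlt; apply/orP; left; apply/eqP; field; rewrite gt_eqF]. Qed.

(** A solution for the globally Lipschitz extension Y is followed only as long as it stays in U and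
    in the ball where Y = X. *)
Lemma local_ode_exists (X : E -> E) (x0 : E) (U : set E) :
  smooth_at X x0 -> nbhs x0 U ->
  exists (e : R) (g : R^o -> E), [/\ 0 < e, g 0 = x0, (forall t : R, `|t| < e -> U (g t))
    & forall t : R, `|t| < e -> is_derive (t : R^o) (1 : R^o) g (X (g t))].
Proof.
move=> sX nU; have [r [L [Y [r0 L0 lip YX]]]] := smooth_locally_lipschitz sX.
have [e e0 eL] := time_step L0.
have [g g0 Dg] := ode_exists x0 L0 e0 eL lip.
have cg : {for (0 : R^o), continuous g}.
  by apply: is_derive1_continuous (Dg 0 _); rewrite normr0.
have N : \forall t \near (0 : R^o), U (g t) /\ `|g t - x0| <= r.
  apply: filterI; first by apply: cg; rewrite g0.
  have /cvgrPdist_le /(_ _ r0) := cg; rewrite g0.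
  by apply: filterS => t; rewrite distrC.
have /nbhs_ballP[d /= d0 Hd] := N.
have b (t : R) : `|t| < Num.min e d -> `|t| < e /\ ball (0 : R^o) d t.
  by rewrite lt_min => /andP[te td]; split=> //; rewrite -ball_normE /= sub0r normrN.
exists (Num.min e d), g; split=> //; first by rewrite lt_min e0 d0.
  by move=> t /b[_ /Hd[]].
by move=> t /b[te /Hd[_ gr]]; rewrite -YX//; exact: Dg.
Qed.

Lemma local_ode_unique (X : E -> E) (x0 : E) : smooth_at X x0 ->
  exists r e : R, [/\ 0 < r, 0 < e & forall (T : R) (u v : R^o -> E), T <= e -> u 0 = v 0 ->
    (forall t, `|t| < T -> `|u t - x0| <= r) -> (forall t, `|t| < T -> `|v t - x0| <= r) ->
    (forall t : R, `|t| < T -> is_derive (t : R^o) (1 : R^o) u (X (u t))) ->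
    (forall t : R, `|t| < T -> is_derive (t : R^o) (1 : R^o) v (X (v t))) ->
    forall t, `|t| < T -> u t = v t].
Proof.
move=> sX; have [r [L [Y [r0 L0 lip YX]]]] := smooth_locally_lipschitz sX.
have [e e0 eL] := time_step L0.
exists r, e; split=> // T u v Te uv0 ur vr Du Dv.
apply: (ode_unique L0 eL lip Te uv0) => s sT; first by rewrite YX; [exact: Du|exact: ur].
by rewrite YX; [exact: Dv|exact: vr].
Qed.
End LocalODE.

Lemma smooth_on_nbhs (R : realType) (V W : normedModType R) (A : set V) (f : V -> W) x :
  nbhs x A -> smooth_on A f -> smooth_at f x.
Proof.
move=> nA sA; exists A^°; first by split; [exact: open_interior|exact: nA].
by move=> vs y /interior_subset; exact: sA.
Qed.

(** * Manifolds *)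

Section Charts.
Variables (R : realType) (P : manifold R).
Implicit Types (c d : chart R (mdim P) P) (p : P) (z : 'rV[R]_(mdim P)).

Definition chart_around c p : Prop := atlas P c /\ dom c p.

Lemma chart_around_at p : chart_around (chart_at P p) p.
Proof. by split; [exact: atlas_chart_at|exact: dom_chart_at]. Qed.

Lemma psi_phi c p : chart_around c p -> psi c (phi c p) = p.
Proof. by move=> [/atlas_chart[_ _ + _ _]]; exact. Qed.

Lemma phi_continuous c p : chart_around c p -> {for p, continuous (phi c)}.
Proof. by move=> [/atlas_chart[_ _ _ + _]]; exact. Qed.

Lemma img_phi c p : dom c p -> img c (phi c p).
Proof. by move=> cp; exists p. Qed.

Lemma psi_continuous c p : chart_around c p -> {for phi c p, continuous (psi c)}.
Proof. by move=> [/atlas_chart[_ _ _ _ H] cp]; exact/H/img_phi. Qed.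

Lemma img_ex c z : atlas P c -> img c z -> exists2 p, chart_around c p & z = phi c p.
Proof. by move=> ac [p cp <-]; exists p. Qed.

Lemma chart_around_psi c z : atlas P c -> img c z -> chart_around c (psi c z).
Proof. by move=> ac /(img_ex ac)[p cp ->]; rewrite psi_phi. Qed.

Lemma phi_psi c z : atlas P c -> img c z -> phi c (psi c z) = z.
Proof. by move=> ac /(img_ex ac)[p cp ->]; rewrite psi_phi. Qed.

Lemma near_img c p : chart_around c p -> \forall z \near phi c p, img c z.
Proof.
move=> [ac cp]; have [_ oi _ _ _] := atlas_chart ac.
by apply: open_nbhs_nbhs; split => //; exact: img_phi.
Qed.

Lemma near_dom c p : chart_around c p -> \forall q \near p, chart_around c q.
Proof.
move=> [ac cp]; have [od _ _ _ _] := atlas_chart ac.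
have nd : nbhs p (dom c) by apply: open_nbhs_nbhs.
by apply: filterS nd.
Qed.

Lemma near_psi c p (A : set P) : chart_around c p -> nbhs p A ->
  \forall z \near phi c p, A (psi c z).
Proof. by move=> cp nA; apply: (psi_continuous cp); rewrite psi_phi. Qed.

Lemma near_phi_psi c p : chart_around c p -> \forall z \near phi c p, phi c (psi c z) = z.
Proof. by move=> cp; apply: filterS (near_img cp) => z; apply: phi_psi; case: cp. Qed.
End Charts.

(** * Smooth maps and their differentials in arbitrary charts *)

Section SmoothMaps.
Variable R : realType.
Implicit Types P Q S : manifold R.

Definition loc_rep P Q (F : P -> Q) (c : chart R (mdim P) P) (d : chart R (mdim Q) Q) :=
  phi d \o F \o psi c.

Definition smooth_map_at P Q (F : P -> Q) (p : P) : Prop :=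
  {for p, continuous F} /\
  forall c d, chart_around c p -> chart_around d (F p) -> smooth_at (loc_rep F c d) (phi c p).

Lemma smooth_map_loc P Q (F : P -> Q) p : smooth_map F -> smooth_map_at F p.
Proof.
move=> [cF sF]; split; first exact: cF.
move=> c d cp dq; apply: smooth_on_nbhs (sF c d cp.1 dq.1).
have N : \forall z \near phi c p, dom d (F (psi c z)).
  apply: (near_psi (A := fun q => dom d (F q)) cp); apply: cF.
  by apply: filterS (near_dom dq) => q [].
apply: filterS2 (near_img cp) N => z iz dz.
exists (psi c z); last exact: phi_psi cp.1 iz.
by split => //; case: (chart_around_psi cp.1 iz).
Qed.

Lemma near_dom2 P1 P2 Q (F : P1 -> P2 -> Q) p1 p2 c1 c2 d : smooth_map2 F ->
  chart_around c1 p1 -> chart_around c2 p2 -> chart_around d (F p1 p2) ->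
  \forall z \near (phi c1 p1, phi c2 p2),
    [/\ img c1 z.1, img c2 z.2 & dom d (F (psi c1 z.1) (psi c2 z.2))].
Proof.
move=> [cF _] c1p c2p dq; have := cF (p1, p2); move=> /(_ (dom d)) /= H.
have {H} : nbhs (p1, p2) (fun w : P1 * P2 => dom d (F w.1 w.2)).
  by apply: H; apply: filterS (near_dom dq) => q [].
case=> -[A B] /= [nA nB] AB.
exists ([set z | img c1 z /\ A (psi c1 z)], [set z | img c2 z /\ B (psi c2 z)]) => /=.
  by split; apply: filterI; [exact: near_img|exact: near_psi|exact: near_img|exact: near_psi].
move=> [z1 z2] /= [[i1 A1] [i2 B2]]; split=> //.
exact: (AB (psi c1 z1, psi c2 z2) (conj A1 B2)).
Qed.

Lemma smooth_map2_loc P1 P2 Q (F : P1 -> P2 -> Q) p1 p2 c1 c2 d : smooth_map2 F ->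
  chart_around c1 p1 -> chart_around c2 p2 -> chart_around d (F p1 p2) ->
  smooth_at (fun z => phi d (F (psi c1 z.1) (psi c2 z.2))) (phi c1 p1, phi c2 p2).
Proof.
move=> sF c1p c2p dq; apply: smooth_on_nbhs (sF.2 c1 c2 d c1p.1 c2p.1 dq.1).
exact: near_dom2.
Qed.

Lemma smooth_map_at_id P (p : P) : smooth_map_at id p.
Proof.
split=> [|c d cp dp]; first exact: cvg_id.
apply: smooth_on_nbhs (atlas_compatible cp.1 dp.1).
apply: filterS2 (near_img cp) (near_psi cp (near_dom dp)) => z iz [_ dz].
exists (psi c z); last exact: phi_psi cp.1 iz.
by split => //; case: (chart_around_psi cp.1 iz).
Qed.

Lemma loc_rep_comp P Q S (F : P -> Q) (G : Q -> S) p c d e :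
  {for p, continuous F} -> chart_around c p -> chart_around d (F p) ->
  \forall z \near phi c p, loc_rep G d e (loc_rep F c d z) = loc_rep (G \o F) c e z.
Proof.
move=> cF cp dq; apply: filterS (near_psi cp (cF _ (near_dom dq))) => z dz.
by rewrite /loc_rep /= psi_phi.
Qed.

Lemma loc_rep_phi P Q (F : P -> Q) p c d : chart_around c p -> loc_rep F c d (phi c p) = phi d (F p).
Proof. by move=> cp; rewrite /loc_rep /= psi_phi. Qed.

Lemma smooth_map_at_comp P Q S (F : P -> Q) (G : Q -> S) p :
  smooth_map_at F p -> smooth_map_at G (F p) -> smooth_map_at (G \o F) p.
Proof.
move=> [cF sF] [cG sG]; split; first exact: (@continuous_comp _ _ _ F G p cF cG).
move=> c e cp es; have da := chart_around_at (F p).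
apply: smooth_at_eq (loc_rep_comp G e cF cp da) _.
apply: (@smooth_at_comp _ _ _ _ _ _ _ (loc_rep G _ e) (loc_rep F c _)); first exact: sF.
by rewrite loc_rep_phi//; exact: sG.
Qed.

(** Common form of [tmap] (preferred charts) and of [to_chart] and [of_chart] (F the identity).
    Every change of charts is then an instance of the chain rule [loc_diff_comp]. *)
Definition loc_diff P Q (F : P -> Q) c d (p : P) u := 'D_u (loc_rep F c d) (phi c p).

Lemma loc_diff_comp P Q S (F : P -> Q) (G : Q -> S) p c d e u :
  smooth_map_at F p -> smooth_map_at G (F p) ->
  chart_around c p -> chart_around d (F p) -> chart_around e (G (F p)) ->
  loc_diff (G \o F) c e p u = loc_diff G d e (F p) (loc_diff F c d p u).
Proof.
move=> sF sG cp dq es; rewrite /loc_diff -(near_eq_derive _ (loc_rep_comp G e sF.1 cp dq)).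
rewrite -(loc_rep_phi F d cp).
apply: (@derive_comp _ _ _ _ _ _ _ (loc_rep G d e) (loc_rep F c d)).
  exact: sF.2.
by rewrite loc_rep_phi//; exact: sG.2.
Qed.

Lemma loc_diff_linear P Q (F : P -> Q) p c d : smooth_map_at F p ->
  chart_around c p -> chart_around d (F p) -> linear (loc_diff F c d p).
Proof. by move=> [_ sF] cp dq; apply: derive_linear; exact: sF. Qed.

Lemma loc_diff_id P (p : P) c u : chart_around c p -> loc_diff id c c p u = u.
Proof.
move=> cp; have N : \forall z \near phi c p, id z = loc_rep id c c z.
  by apply: filterS (near_phi_psi cp) => z E; rewrite /loc_rep /= E.
by rewrite /loc_diff -(near_eq_derive _ N) derive_id.
Qed.

Lemma tmapE P Q (F : P -> Q) p u : tmap F p u = loc_diff F (chart_at P p) (chart_at Q (F p)) p u.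
Proof. by []. Qed.

Lemma to_chartE P (c : chart R (mdim P) P) p u : to_chart c p u = loc_diff id (chart_at P p) c p u.
Proof. by []. Qed.

Lemma of_chartE P (c : chart R (mdim P) P) p u : chart_around c p ->
  of_chart c (phi c p) u = loc_diff id c (chart_at P p) p u.
Proof. by move=> cp; rewrite /of_chart psi_phi. Qed.

Lemma loc_diff_idr P Q (F : P -> Q) p c d e u : smooth_map_at F p ->
  chart_around c p -> chart_around d (F p) -> chart_around e (F p) ->
  loc_diff id d e (F p) (loc_diff F c d p u) = loc_diff F c e p u.
Proof. by move=> sF cp dq eq; rewrite -(loc_diff_comp _ sF)//; exact: smooth_map_at_id. Qed.

Lemma loc_diff_idl P Q (F : P -> Q) p c d e u : smooth_map_at F p ->
  chart_around c p -> chart_around d p -> chart_around e (F p) ->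
  loc_diff F d e p (loc_diff id c d p u) = loc_diff F c e p u.
Proof.
by move=> sF cp dq eq; rewrite -(@loc_diff_comp _ _ _ id F)//; exact: smooth_map_at_id.
Qed.

Lemma tmap_comp P Q S (F : P -> Q) (G : Q -> S) p u :
  smooth_map_at F p -> smooth_map_at G (F p) -> tmap (G \o F) p u = tmap G (F p) (tmap F p u).
Proof.
by move=> sF sG; rewrite !tmapE (loc_diff_comp (d := chart_at Q (F p)) _ sF sG)//; exact: chart_around_at.
Qed.

Lemma tmap_linear P Q (F : P -> Q) p : smooth_map_at F p -> linear (tmap F p).
Proof. by move=> sF; apply: loc_diff_linear => //; exact: chart_around_at. Qed.

Lemma tmap_id P (p : P) u : tmap id p u = u.
Proof. by rewrite tmapE loc_diff_id//; exact: chart_around_at. Qed.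

Lemma of_to_chart P (c : chart R (mdim P) P) p u : chart_around c p ->
  of_chart c (phi c p) (to_chart c p u) = u.
Proof.
move=> cp; rewrite of_chartE// to_chartE (loc_diff_idr _ (smooth_map_at_id p))//.
- exact/loc_diff_id/chart_around_at.
- exact: chart_around_at.
- exact: chart_around_at.
Qed.

Lemma form_loc_pullback P Q (F : P -> Q) (al : diff_form Q) p c d s :
  smooth_map_at F p -> chart_around c p -> chart_around d (F p) ->
  form_loc c (pullback F al) (phi c p) s =
  form_loc d al (phi d (F p)) [seq loc_diff F c d p u | u <- s].
Proof.
move=> sF cp dq; rewrite /form_loc /pullback !psi_phi// -!map_comp; congr (al _ _).
apply: eq_map => u /=; rewrite !of_chartE// tmapE.
have ap := chart_around_at p; have aq := chart_around_at (F p).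
by rewrite loc_diff_idl// loc_diff_idr.
Qed.

Lemma form_loc_contract P (X : vfield P) (al : diff_form P) p c s : chart_around c p ->
  form_loc c (Defs.contract X al) (phi c p) s = form_loc c al (phi c p) (to_chart c p (X p) :: s).
Proof. by move=> cp; rewrite /form_loc /Defs.contract /= psi_phi// of_to_chart. Qed.
End SmoothMaps.

Section PartialMaps.
Variable R : realType.
Implicit Types P Q S : manifold R.

Lemma smooth_map2_continuous P1 P2 Q (F : P1 -> P2 -> Q) p1 p2 : smooth_map2 F ->
  {for p1, continuous (F^~ p2)} /\ {for p2, continuous (F p1)}.
Proof.
move=> [cF _]; split.
  apply: (@continuous_comp _ _ _ (fun q => (q, p2)) (fun z => F z.1 z.2) p1); last exact: cF.
  by apply: cvg_pair; [exact: cvg_id|exact: cvg_cst].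
apply: (@continuous_comp _ _ _ (fun q => (p1, q)) (fun z => F z.1 z.2) p2); last exact: cF.
by apply: cvg_pair; [exact: cvg_cst|exact: cvg_id].
Qed.

Lemma smooth_map2_left P1 P2 Q (F : P1 -> P2 -> Q) p1 p2 : smooth_map2 F ->
  smooth_map_at (F^~ p2) p1.
Proof.
move=> sF; split; first exact: (smooth_map2_continuous p1 p2 sF).1.
move=> c d cp dq; have ap := chart_around_at p2.
have sL := smooth_map2_loc sF cp ap dq.
have sP : smooth_at (fun z => (z, phi (chart_at P2 p2) p2)) (phi c p1).
  apply: smooth_at_pair; last exact: smooth_at_cst.
  exact: smooth_at_id.
pose proof (smooth_at_comp sP sL) as sC.
apply: smooth_at_eq sC; near=> z.
by rewrite /loc_rep /= psi_phi.
Unshelve. all: by end_near. Qed.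

Lemma smooth_map2_right P1 P2 Q (F : P1 -> P2 -> Q) p1 p2 : smooth_map2 F ->
  smooth_map_at (F p1) p2.
Proof.
move=> sF; split; first exact: (smooth_map2_continuous p1 p2 sF).2.
move=> c d cp dq; have ap := chart_around_at p1.
have sL := smooth_map2_loc sF ap cp dq.
have sP : smooth_at (fun z => (phi (chart_at P1 p1) p1, z)) (phi c p2).
  apply: smooth_at_pair; first exact: smooth_at_cst.
  exact: smooth_at_id.
pose proof (smooth_at_comp sP sL) as sC.
apply: smooth_at_eq sC; near=> z.
by rewrite /loc_rep /= psi_phi.
Unshelve. all: by end_near. Qed.
End PartialMaps.

(** * Lie groups *)

Section LieGroupAlgebra.
Variables (R : realType) (G : lieGroup R).
Local Notation e := (lone G).
Implicit Types a b c : G.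

Lemma lmul_cancel a b c : lmul a b = lmul a c -> b = c.
Proof. by move=> E; rewrite -[b]lmul1g -[c]lmul1g -(lmulVg a) -!lmulA E. Qed.

Lemma lmulgV a : lmul a (linv a) = e.
Proof.
rewrite -[LHS]lmul1g -(lmulVg (linv a)) -lmulA [lmul (linv a) (lmul a _)]lmulA.
by rewrite lmulVg lmul1g.
Qed.

Lemma lmulg1 a : lmul a e = a.
Proof. by rewrite -(lmulVg a) lmulA lmulgV lmul1g. Qed.

Lemma linv_unique a b : lmul a b = e -> linv a = b.
Proof. by move=> E; apply: (@lmul_cancel a); rewrite lmulgV. Qed.

Lemma linvM a b : linv (lmul a b) = lmul (linv b) (linv a).
Proof. by apply: linv_unique; rewrite -lmulA [lmul b _]lmulA lmulgV lmul1g lmulgV. Qed.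

Definition lpow a (n : nat) := iter n (lmul a) e.

Lemma lpowS a n : lpow a n.+1 = lmul a (lpow a n). Proof. by []. Qed.

Lemma lpowD a n m : lpow a (n + m) = lmul (lpow a n) (lpow a m).
Proof. by elim: n => [|n IH]; rewrite ?lmul1g// addSn !lpowS IH lmulA. Qed.

Lemma lpowSr a n : lpow a n.+1 = lmul (lpow a n) a.
Proof. by rewrite -addn1 lpowD /lpow /= lmulg1. Qed.

Lemma lpowM a n m : lpow a (n * m) = lpow (lpow a n) m.
Proof. by elim: m => [|m IH]; rewrite ?muln0// mulnS lpowD IH. Qed.

Lemma lpow_commute a b n : lmul a b = lmul b a -> lmul (lpow a n) b = lmul b (lpow a n).
Proof.
move=> ab; elim: n => [|n IH]; first by rewrite /lpow /= lmul1g lmulg1.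
by rewrite lpowS -lmulA IH !lmulA ab.
Qed.

Lemma lpowMl a b n : lmul a b = lmul b a -> lpow (lmul a b) n = lmul (lpow a n) (lpow b n).
Proof.
move=> ab; elim: n => [|n IH]; first by rewrite /lpow /= lmul1g.
by rewrite !lpowS IH -!lmulA; congr (lmul a _); rewrite !lmulA lpow_commute.
Qed.

(** N = 0 has to be excluded, as t / 0 is 0 and would satisfy the bound. *)
Definition time_split (d t : R) (N : nat) : Prop := (0 < N)%N /\ `|t / N%:R| < d.

Lemma time_split_ex d s t : 0 < d ->
  exists N, [/\ time_split d s N, time_split d t N & time_split d (s + t) N].
Proof.
move=> d0; have [N] : exists N : nat, (`|s| + `|t|) / d < N%:R.
  by exists (Num.truncn ((`|s| + `|t|) / d)).+1; exact: truncnS_gt.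
rewrite ltr_pdivrMr// => H.
have N0 : 0 < N%:R :> R.
  rewrite lt_def ler0n andbT; apply: contraTneq H => ->.
  by rewrite mul0r -leNgt addr_ge0.
exists N; rewrite /time_split !normf_div (@ger0_norm _ N%:R)// !ltr_pdivrMr// ![d * _]mulrC.
have Nn : (0 < N)%N by rewrite -(ltr0n R).
have a := normr_ge0 s; have b := normr_ge0 t; have c := ler_normD s t.
by split; split => //; apply: le_lt_trans H; lra.
Qed.

Section LocalHomomorphism.
Variables (l : R -> G) (d : R).
Hypotheses (d0 : 0 < d)
  (lD : forall s t, `|s| < d -> `|t| < d -> l (s + t) = lmul (l s) (l t)).

Lemma local_hom0 : l 0 = e.
Proof.
have z : `|0 : R| < d by rewrite normr0.
by apply: (@lmul_cancel (l 0)); rewrite lmulg1 -lD// addr0.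
Qed.

Lemma local_hom_pow s n : `|s * n%:R| < d -> l (s * n%:R) = lpow (l s) n.
Proof.
elim: n => [|n IH]; first by rewrite mulr0 local_hom0.
move=> H; have le1 : `|s * n%:R| <= `|s * n.+1%:R|.
  by rewrite !normrM ler_wpM2l// !ger0_norm// ler_nat.
have le2 : `|s| <= `|s * n.+1%:R|.
  by rewrite normrM ler_peMr// ger0_norm// ler1n.
rewrite lpowSr -IH; last exact: le_lt_trans le1 H.
rewrite -lD; [|exact: le_lt_trans le1 H|exact: le_lt_trans le2 H].
by congr l; rewrite -addn1 natrD mulrDr mulr1.
Qed.

(** Both sides equal the power obtained from the common refinement N M. *)
Lemma local_hom_split t N M : time_split d t N -> time_split d t M ->
  lpow (l (t / N%:R)) N = lpow (l (t / M%:R)) M.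
Proof.
suff S N' M' : time_split d t N' -> (0 < M')%N ->
    lpow (l (t / N'%:R)) N' = lpow (l (t / (N' * M')%:R)) (N' * M').
  by move=> sN sM; rewrite (S N M)// ?sM.1// (S M N)// ?sN.1// mulnC.
move=> [N0 tN] M0; rewrite mulnC lpowM; congr lpow.
have E : t / (M' * N')%:R * M'%:R = t / N'%:R.
  by rewrite natrM; field; rewrite !pnatr_eq0 -!lt0n N0 M0.
by rewrite -local_hom_pow E.
Qed.

(** The extension is h t = l (t / N)^N for N large, which does not depend on N by [local_hom_split].
    Additivity uses one N valid for s, t and s + t, and the commutation of l (s / N) with l (t /
    N). *)
Lemma local_hom_extends : exists2 h : R -> G,
  forall s t, h (s + t) = lmul (h s) (h t) & forall t, `|t| < d -> h t = l t.
Proof.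
have ex t : {N | time_split d t N}.
  by apply: cid; have [N [sN _ _]] := time_split_ex t 0 d0; exists N.
pose h t := lpow (l (t / (sval (ex t))%:R)) (sval (ex t)).
have hE t N : time_split d t N -> h t = lpow (l (t / N%:R)) N.
  by move=> sN; apply: local_hom_split => //; exact: (svalP (ex t)).
exists h => [s t|t td].
  have [N [sN tN stN]] := time_split_ex s t d0.
  rewrite (hE s N)// (hE t N)// (hE (s + t) N)// mulrDl lD ?sN.2 ?tN.2//.
  by rewrite lpowMl// -!lD ?sN.2 ?tN.2// addrC.
rewrite (hE t 1%N); last by split; rewrite // divr1.
by rewrite divr1 /lpow /= lmulg1.
Qed.
End LocalHomomorphism.

Lemma hom_eq (h k : R -> G) (d : R) : 0 < d ->
  (forall s t, h (s + t) = lmul (h s) (h t)) -> (forall s t, k (s + t) = lmul (k s) (k t)) ->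
  (forall t, `|t| < d -> h t = k t) -> h = k.
Proof.
move=> d0 hD kD hk; apply/funext => t.
have [N [[N0 tN] _ _]] := time_split_ex t 0 d0.
have E (f : R -> G) : (forall s t, f (s + t) = lmul (f s) (f t)) -> f t = lpow (f (t / N%:R)) N.
  (* A global homomorphism is a local one on every interval; this radius makes the interval contain
     t. *)
  move=> fD; have ltd : 0 < `|t| + 1 by rewrite ltr_wpDl.
  rewrite -(@local_hom_pow f (`|t| + 1) ltd (fun s t _ _ => fD s t)).
    by rewrite divfK// pnatr_eq0 -lt0n.
  by rewrite divfK ?pnatr_eq0 -?lt0n// ltrDl.
by rewrite (E h hD) (E k kD) hk.
Qed.
End LieGroupAlgebra.

(** * One-parameter subgroups, the exponential and fundamental fields *)

Section OneParameterSubgroups.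
Variables (R : realType) (G : lieGroup R).
Local Notation e := (lone G).
Local Notation E := 'rV[R]_(mdim G).
Local Notation ce := (chart_at G e).
Local Notation e0 := (phi ce e).

Definition locmul (z : E * E) : E := phi ce (lmul (psi ce z.1) (psi ce z.2)).

(** The set where [locmul] really is the group law in the chart; elsewhere [phi] and [psi] have
    unspecified values. *)
Definition locmul_dom (z : E * E) : Prop :=
  [/\ img ce z.1, img ce z.2 & dom ce (lmul (psi ce z.1) (psi ce z.2))].

Let aro : chart_around ce e. Proof. exact: chart_around_at. Qed.
Let ace : atlas G ce. Proof. by case: aro. Qed.

Lemma psi_one : psi ce e0 = e. Proof. exact: psi_phi. Qed.
Lemma img_one : img ce e0. Proof. by apply: img_phi; case: aro. Qed.

Lemma locmul_smooth z : locmul_dom z -> smooth_at locmul z.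
Proof.
case: z => a b [/= ia ib dab].
have := @smooth_map2_loc _ _ _ _ (@lmul R G) (psi ce a) (psi ce b) ce ce ce (lmul_smooth G)
   (chart_around_psi ace ia) (chart_around_psi ace ib) (conj ace dab).
by rewrite !phi_psi.
Qed.

Lemma near_locmul_dom : \forall z \near (e0, e0), locmul_dom z.
Proof. by apply: (near_dom2 (lmul_smooth G)) => //; rewrite lmul1g. Qed.

Lemma psi_locmul z : locmul_dom z -> psi ce (locmul z) = lmul (psi ce z.1) (psi ce z.2).
Proof. by case=> _ _ d; rewrite /locmul psi_phi. Qed.

Lemma img_locmul z : locmul_dom z -> img ce (locmul z).
Proof. by case=> _ _ d; exact: img_phi. Qed.

Lemma locmul_dom_r1 a : img ce a -> locmul_dom (a, e0).
Proof.
by move=> ia; split=> //=; rewrite ?psi_one ?lmulg1; [exact: img_one|case: (chart_around_psi ace ia)].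
Qed.

Lemma locmul_dom_l1 a : img ce a -> locmul_dom (e0, a).
Proof.
by move=> ia; split=> //=; rewrite ?psi_one ?lmul1g; [exact: img_one|case: (chart_around_psi ace ia)].
Qed.

Lemma locmul_r1 a : img ce a -> locmul (a, e0) = a.
Proof. by move=> ia; rewrite /locmul /= psi_one lmulg1 phi_psi. Qed.

Lemma locmul_l1 a : img ce a -> locmul (e0, a) = a.
Proof. by move=> ia; rewrite /locmul /= psi_one lmul1g phi_psi. Qed.

(** The left-invariant field generated by x, in the chart at the unit. *)
Definition locfield (x : E) (b : E) : E := 'D_(0, x) locmul (b, e0).

Lemma locfield_smooth x b : img ce b -> smooth_at (locfield x) b.
Proof.
move=> ib; have s1 := smooth_at_derive (0, x) (locmul_smooth (locmul_dom_r1 ib)).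
have s2 : smooth_at (fun c => (c, e0)) b.
  by apply: smooth_at_pair; [exact: smooth_at_id|exact: smooth_at_cst].
exact: (smooth_at_comp s2 s1).
Qed.

Lemma locfield_one x : locfield x e0 = x.
Proof.
rewrite /locfield; have N : \forall h \near e0, h = (locmul \o (fun h => (e0, h))) h.
  by apply: filterS (near_img aro) => h ih /=; rewrite locmul_l1.
have := near_eq_derive x N; rewrite derive_id => {2}->.
have sp : smooth_at (fun h => (e0, h)) e0.
  by apply: smooth_at_pair; [exact: smooth_at_cst|exact: smooth_at_id].
rewrite (derive_comp _ sp (locmul_smooth (locmul_dom_r1 img_one))).
by have [_ ->] := derive_pair (is_derive_cst e0 e0 x) (is_derive_id e0 x).
Qed.

Lemma locmul_dom_near_r a b : locmul_dom (a, b) -> \forall h \near e0, locmul_dom (b, h) /\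
  [/\ locmul_dom (a, locmul (b, h)), locmul_dom (locmul (a, b), h) &
      locmul (a, locmul (b, h)) = locmul (locmul (a, b), h)].
Proof.
move=> Dab; have [/= ia ib dab] := Dab.
have N g : chart_around ce g -> \forall h \near e0, dom ce (lmul g (psi ce h)).
  move=> cg; have cF := (smooth_map2_continuous g e (lmul_smooth G)).2.
  apply: (near_psi (A := fun q => dom ce (lmul g q)) aro); apply: cF.
  by rewrite lmulg1; apply: filterS (near_dom cg) => q [].
have N1 := N _ (chart_around_psi ace ib).
have N2 := N _ (conj ace dab).
apply: filterS3 (near_img aro) N1 N2 => h ih h1 h2.
have Dbh : locmul_dom (b, h) by [].
split=> //; split.
- by split=> //=; [exact: img_locmul|rewrite psi_locmul//= lmulA].
- by split=> //=; [exact: img_locmul|rewrite psi_locmul].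
- by rewrite {1}/locmul [RHS]/locmul /= !psi_locmul//= lmulA.
Qed.

(** Differentiate a (b h) = (a b) h with respect to h at the unit. *)
Lemma locfield_left_invariant x z : locmul_dom z ->
  'D_(0, locfield x z.2) locmul z = locfield x (locmul z).
Proof.
case: z => a b Dab; have [/= ia ib dab] := Dab.
have N : \forall h \near e0, (locmul \o (fun h => (a, locmul (b, h)))) h =
    (locmul \o (fun h => (locmul (a, b), h))) h.
  by apply: filterS (locmul_dom_near_r Dab) => h [_ [_ _]].
have := near_eq_derive x N.
have s1 : smooth_at (fun h => (b, h)) e0.
  by apply: smooth_at_pair; [exact: smooth_at_cst|exact: smooth_at_id].
have D1 : is_derive e0 x (fun h => (b, h)) (0, x).
  exact: (derive_pair (is_derive_cst b e0 x) (is_derive_id e0 x)).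
have sb := locmul_smooth (locmul_dom_r1 ib).
pose proof (smooth_at_comp s1 sb) as s2.
have D2 : 'D_x (locmul \o (fun h => (b, h))) e0 = locfield x b.
  by rewrite (derive_comp _ s1 sb); have [_ ->] := D1.
have s3 : smooth_at (fun h => (a, (locmul \o (fun h => (b, h))) h)) e0.
  by apply: smooth_at_pair; [exact: smooth_at_cst|exact: s2].
have D3 : is_derive e0 x (fun h => (a, (locmul \o (fun h => (b, h))) h)) (0, locfield x b).
  by rewrite -D2; exact: (derive_pair (is_derive_cst a e0 x) (smooth_at_is_derive x s2)).
have E0 : (a, locmul (b, e0)) = (a, b) by rewrite locmul_r1.
have L : 'D_x (locmul \o (fun h => (a, (locmul \o (fun h => (b, h))) h))) e0 =
    'D_(0, locfield x b) locmul (a, b).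
  have sab : smooth_at locmul (a, (locmul \o (fun h => (b, h))) e0).
    by rewrite /= E0; exact: locmul_smooth.
  rewrite (derive_comp _ s3 sab).
  by have [_ ->] := D3; rewrite /= E0.
rewrite -[X in 'D_x X _ = _]/(locmul \o (fun h => (a, (locmul \o (fun h => (b, h))) h))) L => ->.
have s4 : smooth_at (fun h => (locmul (a, b), h)) e0.
  by apply: smooth_at_pair; [exact: smooth_at_cst|exact: smooth_at_id].
rewrite (derive_comp _ s4 (locmul_smooth (locmul_dom_r1 (img_locmul Dab)))).
by have [_ ->] := derive_pair (is_derive_cst (locmul (a, b)) e0 x) (is_derive_id e0 x).
Qed.

Section Hom.
Variable gam : R^o -> G.
Hypothesis gamD : forall s t, gam (s + t) = lmul (gam s) (gam t).

Lemma hom0 : gam 0 = e.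
Proof. by apply: (@lmul_cancel _ _ (gam 0)); rewrite lmulg1 -gamD addr0. Qed.

(** Differentiating gam (t + s) = gam t gam s with respect to s at 0 shows that gam is an integral
    curve of the left-invariant field. *)
Lemma hom_ode (x : E) : smooth_at (phi ce \o gam) (0 : R^o) -> {for (0 : R^o), continuous gam} ->
  'D_(1 : R^o) (phi ce \o gam) (0 : R^o) = x ->
  \forall t \near (0 : R^o), is_derive t (1 : R^o) (phi ce \o gam) (locfield x ((phi ce \o gam) t)).
Proof.
move=> sc cg Dx; set c := phi ce \o gam.
have c0 : c 0 = e0 by rewrite /c /= hom0.
have N : \forall t \near (0 : R^o), dom ce (gam t).
  by apply: cg; rewrite hom0; apply: filterS (near_dom aro) => q [].
apply: filterS N => t dt.
have at_ : chart_around ce (gam t) by [].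
have ic : img ce (c t) by exact: img_phi.
have s1 : smooth_at (fun s => (c t, c s)) (0 : R^o).
  by apply: smooth_at_pair; [exact: smooth_at_cst|exact: sc].
have Dm : locmul_dom (c t, c 0) by rewrite c0; exact: locmul_dom_r1.
have s2 := locmul_smooth Dm.
have D : is_derive (0 : R^o) (1 : R^o) (locmul \o (fun s => (c t, c s))) (locfield x (c t)).
  pose proof (smooth_at_comp s1 s2) as s3.
  have D1 : is_derive (0 : R^o) (1 : R^o) (fun s => (c t, c s)) (0, x).
    by rewrite -Dx; exact: (derive_pair (is_derive_cst (c t) (0 : R^o) (1 : R^o)) (smooth_at_is_derive (1 : R^o) sc)).
  have := smooth_at_is_derive (1 : R^o) s3.
  by rewrite (derive_comp _ s1 s2); have [_ ->] := D1; rewrite /locfield -c0.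
have N2 : \forall s \near (0 : R^o), (locmul \o (fun s => (c t, c s))) s = c (s + t).
  have N3 : \forall s \near (0 : R^o), dom ce (gam s).
    by apply: cg; rewrite hom0; apply: filterS (near_dom aro) => q [].
  apply: filterS N3 => s ds; rewrite /locmul /c /= !psi_phi//.
  by rewrite -gamD addrC.
have := near_eq_is_derive N2 D => /is_derive_is_cvg D'.
apply: is_derive_cvg; move: D'; rewrite add0r.
by under eq_fun do rewrite addr0.
Qed.
End Hom.

Lemma smooth_curve_at (P : manifold R) (gam : R^o -> P) t c : smooth_curve gam -> chart_around c (gam t) ->
  smooth_at (phi c \o gam) t.
Proof.
move=> [cg sg] [ac dc]; apply: (smooth_on_nbhs _ (sg c ac)); apply: cg.
by apply: filterS (near_dom (conj ac dc)) => q [].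
Qed.

(** In the chart both curves solve the same equation near time 0, hence agree there, and
    homomorphisms that agree near 0 are equal. *)
Lemma one_parameter_subgroup_unique (x : E) (h k : R^o -> G) :
  one_parameter_subgroup x h -> one_parameter_subgroup x k -> h = k.
Proof.
move=> [sh hD vh] [sk kD vk].
have H f : smooth_curve f -> (forall s t, f (s + t) = lmul (f s) (f t)) -> velocity f 0 = x ->
    \forall t \near (0 : R^o), is_derive t (1 : R^o) (phi ce \o f) (locfield x ((phi ce \o f) t)).
  move=> sf fD vf; have f0 := hom0 fD; apply: (hom_ode fD).
  - by apply: smooth_curve_at => //; rewrite f0.
  - by case: sf => + _; exact.
  - by rewrite -vf /velocity f0.
have sX := locfield_smooth x img_one.
have [r [d [r0 d0 U]]] := local_ode_unique sX.
have B f : smooth_curve f -> (forall s t, f (s + t) = lmul (f s) (f t)) -> velocity f 0 = x ->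
  \forall t \near (0 : R^o), [/\ chart_around ce (f t), `|(phi ce \o f) t - e0| <= r &
     is_derive t (1 : R^o) (phi ce \o f) (locfield x ((phi ce \o f) t))].
  move=> sf fD vf; have f0 := hom0 fD.
  have n1 : \forall t \near (0 : R^o), chart_around ce (f t).
    by case: (sf) => cf _; apply: cf; rewrite f0; exact: near_dom.
  have sc : smooth_at (phi ce \o f) (0 : R^o) by apply: smooth_curve_at => //; rewrite f0.
  have n2 : \forall t \near (0 : R^o), `|(phi ce \o f) t - e0| <= r.
    have /cvgrPdist_le /(_ _ r0) := smooth_at_continuous sc.
    by apply: filterS => t; rewrite /= f0 distrC.
  by apply: filterS3 n1 n2 (H f sf fD vf) => t.
have NN : \forall t \near (0 : R^o), [/\ chart_around ce (h t), `|(phi ce \o h) t - e0| <= r &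
     is_derive t (1 : R^o) (phi ce \o h) (locfield x ((phi ce \o h) t))] /\
  [/\ chart_around ce (k t), `|(phi ce \o k) t - e0| <= r &
     is_derive t (1 : R^o) (phi ce \o k) (locfield x ((phi ce \o k) t))].
  by apply: filterI; exact: B.
move: NN => /nbhs_ballP[m /= m0 Hm].
have T0 : 0 < Num.min d m by rewrite lt_min d0 m0.
have HT (t : R) : `|t| < Num.min d m -> ball (0 : R^o) m t.
  by rewrite lt_min => /andP[_ tm]; rewrite -ball_normE /= sub0r normrN.
apply: (hom_eq T0 hD kD) => t tT.
have [[a _ _] [b _ _]] := Hm _ (HT t tT).
rewrite -(psi_phi a) -(psi_phi b); congr (psi ce _).
apply: (U (Num.min d m) (phi ce \o h) (phi ce \o k) _ _ _ _ _ _ t tT).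
- by rewrite ge_min lexx.
- by rewrite /= (hom0 hD) (hom0 kD).
- by move=> s /HT /Hm[[]].
- by move=> s /HT /Hm[_ []].
- by move=> s /HT /Hm[[]].
- by move=> s /HT /Hm[_ []].
Qed.

(** A short integral curve f of the left-invariant field is a local homomorphism: u |-> f (s + u)
    and u |-> f s f u are integral curves with the same start. Its extension h is smooth at any t0
    because h t = h t0 f (t - t0) for t near t0. *)
Lemma one_parameter_subgroup_exists (x : E) : exists gam, one_parameter_subgroup x gam.
Proof.
have sX := locfield_smooth x img_one.
have [r [d [r0 d0 Un]]] := local_ode_unique sX.
have near2 : \forall z \near (e0, e0), locmul_dom z /\ `|locmul z - e0| <= r.
  apply: filterI; first exact: near_locmul_dom.
  have /cvgrPdist_le /(_ _ r0) := smooth_at_continuous (locmul_smooth (locmul_dom_r1 img_one)).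
  rewrite (locmul_r1 img_one) => H; apply: filterS H => z; rewrite distrC; exact.
case: near2 => -[A B] /= [nA nB] AB.
have nU : nbhs e0 (A `&` B `&` [set b | `|b - e0| <= r]).
  apply: filterI; first exact: filterI.
  apply/nbhs_ballP; exists r => // b; rewrite -ball_normE /= distrC; exact: ltW.
have [e1 [f [e10 f0 fU Df]]] := local_ode_exists sX nU.
(* Below e1 / 2 the sum of two times stays in the domain of f; below d uniqueness applies. *)
pose T := Num.min d (e1 / 2).
have T0 : 0 < T by rewrite lt_min d0 divr_gt0.
have Td : T <= d by rewrite ge_min lexx.
have Te : T <= e1 / 2 by rewrite ge_min lexx orbT.
have T1 (t : R) : `|t| < T -> `|t| < e1 by move=> h; apply: lt_trans (lt_le_trans h Te) _; lra.
have fA (t : R) : `|t| < T -> A (f t) by move=> /T1 /fU [[]].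
have fB (t : R) : `|t| < T -> B (f t) by move=> /T1 /fU [[]].
have locD (s t : R) : `|s| < T -> `|t| < T -> f (s + t) = locmul (f s, f t).
  move=> sT tT.
  have st u : `|u| < T -> `|s + u| < e1.
    by move=> uT; apply: le_lt_trans (ler_normD _ _) _; lra.
  apply/esym; apply: (Un T (fun u => locmul (f s, f u)) (fun u => f (s + u)) Td) tT.
  - by rewrite addr0 f0 locmul_r1//; have [[/= ia _ _] _] := AB (f s, f s) (conj (fA s sT) (fB s sT)).
  - by move=> u uT; have [_] := AB (f s, f u) (conj (fA s sT) (fB u uT)).
  - by move=> u /st /fU [].
  - move=> u uT; have [Dm _] := AB (f s, f u) (conj (fA s sT) (fB u uT)).
    have sm := locmul_smooth Dm.
    have Dp : is_derive (u : R^o) (1 : R^o) (fun y : R^o => (f s, f y)) (0, locfield x (f u)).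
      exact: (derive_pair (is_derive_cst (f s) (u : R^o) (1 : R^o)) (Df u (T1 u uT))).
    have -> : locfield x (locmul (f s, f u)) = 'D_(0, locfield x (f u)) locmul (f s, f u).
      by rewrite -locfield_left_invariant.
    have dp : differentiable (fun y : R^o => (f s, f y)) u.
      by apply/derivable1_diffP; case: Dp.
    pose proof (diff_comp_derive (1 : R^o) dp (smooth_at_differentiable sm)) as D2.
    by move: D2; have [_ ->] := Dp.
  - move=> u uT.
    have D3 : is_derive (u + s : R^o) (1 : R^o) f (locfield x (f (s + u))).
      by rewrite addrC; exact: Df (st u uT).
    have -> : (fun y : R^o => f (s + y)) = (fun y : R^o => f (y + s)).
      by apply/funext => y; rewrite addrC.
    exact: derive_translate D3.
have fd (t : R) : `|t| < e1 -> chart_around ce (psi ce (f t)).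
  move=> /fU [[At Bt] _]; have [[/= ia _ _] _] := AB (f t, f t) (conj At Bt).
  exact: chart_around_psi.
have imgf (t : R) : `|t| < e1 -> img ce (f t).
  by move=> /fU [[At Bt] _]; have [[/= ia _ _] _] := AB (f t, f t) (conj At Bt).
have lD (s t : R) : `|s| < T -> `|t| < T -> psi ce (f (s + t)) = lmul (psi ce (f s)) (psi ce (f t)).
  move=> sT tT; rewrite locD// psi_locmul//.
  by have [] := AB (f s, f t) (conj (fA s sT) (fB t tT)).
have [h hD hl] := local_hom_extends T0 lD.
have smf : smooth_at f (0 : R^o).
  have N0 : nbhs (0 : R^o) [set t : R^o | `|t| < e1].
    by apply/nbhs_ballP; exists e1 => // t; rewrite -ball_normE /= sub0r normrN.
  apply: (smooth_on_nbhs N0); apply: (ode_smooth (X := locfield x)).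
  - rewrite openE => t /= te; have p : 0 < e1 - `|t| by rewrite subr_gt0.
    apply/nbhs_ballP; exists (e1 - `|t|) => // s; rewrite -ball_normE /= => ts.
    rewrite distrC in ts; have := ler_normD t (s - t).
    have -> : t + (s - t) = s by rewrite addrC subrK.
    by move: ts => /=; lra.
  - by move=> t te; apply: locfield_smooth; exact: imgf.
have Nh t0 : \forall t \near (t0 : R^o), h t = lmul (h t0) (psi ce (f (t - t0))).
  apply/nbhs_ballP; exists T => // t; rewrite -ball_normE /= => tT.
  by rewrite -hl 1?distrC// -hD addrC subrK.
have smt (t0 : R^o) : smooth_at (fun t : R^o => f (t - t0)) t0.
  have s1 : smooth_at (fun t : R^o => t + (- t0)) t0.
    by apply: smooth_at_add; [exact: smooth_at_id|exact: smooth_at_cst].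
  have s2 : smooth_at f (t0 + - t0) by rewrite subrr.
  exact: (smooth_at_comp s1 s2).
have f00 (t0 : R^o) : f (t0 - t0) = e0 by rewrite subrr f0.
have sL g : smooth_map_at (lmul g) e by exact: (smooth_map2_right g e (lmul_smooth G)).
exists h; split=> //; last first.
  rewrite /velocity (hom0 hD).
  have N : \forall t \near (0 : R^o), f t = (phi ce \o h) t.
    apply/nbhs_ballP; exists T => // t; rewrite -ball_normE /= sub0r normrN => tT.
    by rewrite /= hl// phi_psi//; exact: imgf (T1 t tT).
  rewrite -(near_eq_derive _ N); have z : `|0 : R| < e1 by rewrite normr0.
  by have [_ ->] := Df 0 z; rewrite f0 locfield_one.
split.
  move=> t0.
  have C1 : {for t0, continuous (fun t : R^o => psi ce (f (t - t0)))}.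
    apply: (@continuous_comp _ _ _ (fun t : R^o => f (t - t0)) (psi ce) t0).
      exact: smooth_at_continuous (smt t0).
    by rewrite f00; exact: psi_continuous.
  have C2 : {for t0, continuous (fun t : R^o => lmul (h t0) (psi ce (f (t - t0))))}.
    apply: (@continuous_comp _ _ _ (fun t : R^o => psi ce (f (t - t0))) (lmul (h t0)) t0) => //.
    by rewrite f00 psi_one; exact: (sL (h t0)).1.
  have E0 : lmul (h t0) (psi ce (f (t0 - t0))) = h t0 by rewrite f00 psi_one lmulg1.
  have C3 : (fun t : R^o => lmul (h t0) (psi ce (f (t - t0)))) @ t0 --> h t0.
    by rewrite -[X in _ --> X]E0; exact: C2.
  apply: cvg_trans C3; apply: near_eq_cvg.
  by apply: filterS (Nh t0) => t ->.
move=> c ac; apply: smooth_at_on => t0 dc.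
have cc : chart_around c (lmul (h t0) e) by rewrite lmulg1.
have s1 := (sL (h t0)).2 ce c aro cc; rewrite -(f00 t0) in s1.
pose proof (smooth_at_comp (smt t0) s1) as s2.
apply: smooth_at_eq s2; apply: filterS (Nh t0) => t E /=.
by rewrite /loc_rep /= E.
Qed.

(** s |-> gam (t s) is a one-parameter subgroup with velocity t x, and uniqueness forces the choice
    made in [lexp] to be this one. *)
Lemma lexp_one_parameter (x : E) gam (t : R) : one_parameter_subgroup x gam ->
  lexp (t *: x) = gam t.
Proof.
move=> [sg gD vg].
have smt (s : R^o) : smooth_at (fun s : R^o => t * s : R^o) s.
  by apply: smooth_at_scale; [exact: smooth_at_cst|exact: smooth_at_id].
have H : one_parameter_subgroup (t *: x) (fun s => gam (t * s)).
  split.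
  - split.
      move=> s; apply: (@continuous_comp _ _ _ (fun s : R^o => t * s : R^o) gam s).
        exact: smooth_at_continuous (smt s).
      by case: sg => + _; exact.
    move=> c ac; apply: smooth_at_on => s dc.
    have s1 : smooth_at (phi c \o gam) (t * s : R^o) by apply: smooth_curve_at.
    exact: (smooth_at_comp (smt s) s1).
  - by move=> s u; rewrite mulrDr gD.
  - rewrite /velocity mulr0.
    have s1 : smooth_at (phi (chart_at G (gam 0)) \o gam) (t * (0 : R^o) : R^o).
      by rewrite mulr0; apply: smooth_curve_at => //; exact: chart_around_at.
    have -> : phi (chart_at G (gam 0)) \o (fun s : R^o => gam (t * s)) =
      (phi (chart_at G (gam 0)) \o gam) \o (fun s : R^o => t * s : R^o) by [].
    rewrite (derive_comp _ (smt 0) s1) mulr0.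
    have -> : 'D_(1 : R^o) (fun s : R^o => t * s : R^o) (0 : R^o) = t *: (1 : R^o).
      have lt : linear (fun s : R^o => t * s : R^o) by move=> a u v; rewrite mulrDr mulrCA.
      by have [_ ->] := linear_is_derive (0 : R^o) (1 : R^o) lt.
    by rewrite mulr0 in s1; rewrite (derive_dirZ _ _ s1) -vg.
rewrite /lexp; case: xgetP => [g _ [k Hk ->]|/(_ (gam t))].
  by rewrite (one_parameter_subgroup_unique Hk H) mulr1.
case; exists (fun s => gam (t * s)) => //; by rewrite mulr1.
Qed.

(** The minus sign is that of exp(-tx). From here on fundamental fields are derivatives of orbit
    maps, and the exponential is no longer met. *)
Lemma fund_fieldE (P : manifold R) (act : G -> P -> P) x p : is_action act ->
  fund_field act x p = - tmap (fun g => act g p) e x.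
Proof.
move=> [sA a1 aM]; have [gam Hg] := one_parameter_subgroup_exists x.
have [sg gD vg] := Hg; have g0 := hom0 gD.
have E : (fun t : R^o => act (lexp (- t *: x)) p) = (fun t : R^o => act (gam (- t)) p).
  by apply/funext => t; rewrite (lexp_one_parameter (- t) Hg).
rewrite /fund_field E /velocity oppr0 g0 a1.
have sm : smooth_map_at (fun g => act g p) e by exact: (smooth_map2_left e p sA).
have cp : chart_around (chart_at P p) (act e p) by rewrite a1; exact: chart_around_at.
have s1 := sm.2 ce (chart_at P p) aro cp.
have so : smooth_at (fun t : R^o => - t : R^o) (0 : R^o).
  by apply: smooth_at_opp; exact: smooth_at_id.
have sc0 : smooth_at (phi ce \o gam) (- (0 : R^o)).
  by rewrite oppr0; apply: smooth_curve_at => //; rewrite g0.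
pose proof (smooth_at_comp so sc0) as sc.
have c0 : ((phi ce \o gam) \o (fun t : R^o => - t : R^o)) 0 = e0 by rewrite /= oppr0 g0.
have N : \forall t \near (0 : R^o),
   (loc_rep (fun g => act g p) ce (chart_at P p) \o ((phi ce \o gam) \o (fun t : R^o => - t : R^o))) t =
   (phi (chart_at P p) \o (fun t : R^o => act (gam (- t)) p)) t.
  have n1 : \forall t \near (0 : R^o), chart_around ce (gam (- t)).
    have C : {for (0 : R^o), continuous (fun t : R^o => gam (- t))}.
      apply: (@continuous_comp _ _ _ (fun t : R^o => - t : R^o) gam 0).
        exact: smooth_at_continuous so.
      by case: sg => + _; exact.
    by apply: C; rewrite oppr0 g0; exact: near_dom.
  by apply: filterS n1 => t ct; rewrite /loc_rep /= psi_phi.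
have s1' : smooth_at (loc_rep (fun g => act g p) ce (chart_at P p))
    (((phi ce \o gam) \o (fun t : R^o => - t : R^o)) 0) by rewrite c0.
rewrite -(near_eq_derive _ N) (derive_comp _ sc s1') (derive_comp _ so sc0) c0.
have -> : 'D_(1 : R^o) (fun t : R^o => - t : R^o) (0 : R^o) = (-1 : R) *: (1 : R^o).
  have lo : linear (fun t : R^o => - t : R^o) by move=> a u v; rewrite opprD scalerN.
  by have [_ ->] := linear_is_derive (0 : R^o) (1 : R^o) lo; rewrite scaleN1r.
rewrite (derive_dirZ _ _ sc0) oppr0.
have -> : 'D_(1 : R^o) (phi ce \o gam) (0 : R^o) = x by rewrite -vg /velocity g0.
by rewrite scaleN1r (derive_dirN _ s1) tmapE /loc_diff a1.
Qed.
End OneParameterSubgroups.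

(** * Actions and the adjoint representation *)

Section SecondOrder.
Variable R : realType.
Implicit Types U V W X : normedModType R.

Lemma derive_basis_near V W {fV : finDim V} {fW : finDim W} (f : V -> W) x w :
  smooth_at f x -> \forall y \near x, 'D_w f y = \sum_i fcoord i w *: 'D_(fbasis i) f y.
Proof.
move=> sf; apply: filterS (smooth_at_near sf) => y sy.
exact: derive_basis (smooth_at_differentiable sy).
Qed.

Lemma is_derive_sumr V W (I : Type) (r : seq I) (f : I -> V -> W) (df : I -> W) x v :
  (forall i, is_derive x v (f i) (df i)) ->
  is_derive x v (fun y => \sum_(i <- r) f i y) (\sum_(i <- r) df i).
Proof.
move=> H; elim: r => [|i r IH].
  rewrite big_nil (_ : (fun y => _) = cst 0); first exact: is_derive_cst.
  by apply/funext => y; rewrite big_nil.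
rewrite big_cons (_ : (fun y => _) = f i + (fun y => \sum_(j <- r) f j y)); first exact: is_deriveD.
by apply/funext => y; rewrite big_cons.
Qed.

(** Product rule for a directional derivative whose direction and base point both move: the
    direction is expanded in a basis. *)
Lemma derive_derive_dir V W X {fV : finDim V} {fW : finDim W} {fX : finDim X}
    (f : W -> X) (g w : V -> W) x u :
  smooth_at f (g x) -> smooth_at g x -> smooth_at w x ->
  'D_u (fun y => 'D_(w y) f (g y)) x = 'D_('D_u w x) f (g x) + 'D_('D_u g x) ('D_(w x) f) (g x).
Proof.
move=> sf sg sw.
have N0 : \forall y \near x, smooth_at f (g y).
  exact: (smooth_at_continuous sg (smooth_at_near sf)).
have N : \forall y \near x, \sum_i fcoord i (w y) *: 'D_(fbasis i) f (g y) = 'D_(w y) f (g y).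
  by apply: filterS N0 => y sy; rewrite [RHS](derive_basis _ (smooth_at_differentiable sy)).
rewrite -(near_eq_derive u N).
have Di i : is_derive x u (fun y => fcoord i (w y) *: 'D_(fbasis i) f (g y))
    (fcoord i ('D_u w x) *: 'D_(fbasis i) f (g x) +
     fcoord i (w x) *: 'D_('D_u g x) ('D_(fbasis i) f) (g x)).
  have sD := smooth_at_derive (fbasis i) sf.
  have D1 : is_derive x u (fun y => 'D_(fbasis i) f (g y)) ('D_('D_u g x) ('D_(fbasis i) f) (g x)).
    pose proof (diff_comp_derive u (smooth_at_differentiable sg) (smooth_at_differentiable sD)) as D0.
    exact: D0.
  have D2 : is_derive x u (fun y => fcoord i (w y)) (fcoord i ('D_u w x)).
    exact: (linear_comp_derive (fcoord_linear i) (fcoord_continuous i) (smooth_at_is_derive u sw)).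
  apply: (is_derive_scale _ D2 D1).
  pose proof (smooth_at_comp sg sD) as sDg; exact: (smooth_at_continuous sDg).
have [_ ->] := is_derive_sumr (index_enum _) Di.
rewrite big_split /= (derive_basis _ (smooth_at_differentiable sf)); congr (_ + _).
rewrite (near_eq_derive _ (derive_basis_near (w x) sf)).
have Ei i : is_derive (g x) ('D_u g x) (fun y => fcoord i (w x) *: 'D_(fbasis i) f y)
    (fcoord i (w x) *: 'D_('D_u g x) ('D_(fbasis i) f) (g x)).
  by apply: is_deriveZ; apply: smooth_at_is_derive; exact: smooth_at_derive.
by have [_ ->] := is_derive_sumr (index_enum _) Ei.
Qed.

Lemma derive_compl U V W X {fU : finDim U} {fV : finDim V} {fW : finDim W} {fX : finDim X}
    (f : V * W -> X) (g : U -> V) b x u :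
  smooth_at g x -> smooth_at f (g x, b) ->
  'D_u (fun y => f (g y, b)) x = 'D_('D_u g x, 0) f (g x, b) /\ smooth_at (fun y => f (g y, b)) x.
Proof.
move=> sg sf; have sp : smooth_at (fun z => (g z, b)) x.
  by apply: smooth_at_pair; [exact: sg|exact: smooth_at_cst].
split; last exact: (smooth_at_comp sp sf).
have [_ E] := derive_pair (smooth_at_is_derive u sg) (is_derive_cst b x u).
by rewrite -E; exact: (derive_comp u sp sf).
Qed.

Lemma derive_slice V W X {fV : finDim V} {fW : finDim W} {fX : finDim X}
   (f : V * W -> X) x y u : smooth_at f (x, y) ->
   'D_u (fun z => f (z, y)) x = 'D_(u, 0) f (x, y) /\ smooth_at (fun z => f (z, y)) x.
Proof.
by move=> sf; have [D s] := derive_compl u (smooth_at_id x) sf; split=> //; move: D; rewrite derive_id.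
Qed.

Lemma derive_slice_r V W X {fV : finDim V} {fW : finDim W} {fX : finDim X}
   (f : V * W -> X) x y u : smooth_at f (x, y) ->
   'D_u (fun z => f (x, z)) y = 'D_(0, u) f (x, y) /\ smooth_at (fun z => f (x, z)) y.
Proof.
move=> sf; have sp : smooth_at (fun z => (x, z)) y.
  by apply: smooth_at_pair; [exact: smooth_at_cst|exact: smooth_at_id].
split; last exact: (smooth_at_comp sp sf).
have [_ E] := derive_pair (is_derive_cst x y u) (is_derive_id y u).
by rewrite -E; exact: (derive_comp u sp sf).
Qed.
End SecondOrder.

(** * The Leibniz rule for forms with moving base point and moving arguments *)

Section MultilinearFamilies.
Variables (R : realType) (n : nat).
Local Notation E := 'rV[R]_n.

(** Multilinearity is asked only near z, because a form read in a chart need not be multilinear off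
    the image of the chart. *)
Definition smooth_family (a : E -> seq E -> R^o) (z : E) : Prop :=
  (\forall y \near z, multilinear (a y)) /\ forall s, smooth_at (a^~ s) z.

Lemma multilinear_basis (W : lmodType R) (A : seq E -> W) s1 v s2 : multilinear A ->
  A (s1 ++ v :: s2) = \sum_i fcoord i v *: A (s1 ++ fbasis i :: s2).
Proof.
move=> mA; pose L (u : E) : W := A (s1 ++ u :: s2).
have lL : linear L by move=> a u w; exact: mA.
pose L' : {linear E -> W} := HB.pack L (GRing.isLinear.Build R E W *:%R L lL).
rewrite -[LHS]/(L' v) {1}[v]fcoordK linear_sum; apply: eq_bigr => i _.
by rewrite linearZ.
Qed.

(** Induction on the list L of moving arguments: the first one is expanded in a basis, and each
    basis vector joins the constant prefix s1, which is why s1 is general. *)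
Lemma multilinear_family_derive_cat (V : normedModType R) {fV : finDim V}
    (a : E -> seq E -> R^o) (zeta : V -> E) (L : seq (V -> E)) (s1 s2 : seq E) x :
  smooth_at zeta x -> smooth_family a (zeta x) ->
  (forall i, smooth_at (nth (fun=> 0) L i) x) ->
  smooth_at (fun t => a (zeta t) (s1 ++ [seq f t | f <- L] ++ s2)) x /\
  forall v, 'D_v (fun t => a (zeta t) (s1 ++ [seq f t | f <- L] ++ s2)) x =
    'D_('D_v zeta x) (fun z => a z (s1 ++ [seq f x | f <- L] ++ s2)) (zeta x) +
    \sum_(i < size L) a (zeta x) (s1 ++ set_nth 0 [seq f x | f <- L] i ('D_v (nth (fun=> 0) L i) x) ++ s2).
Proof.
move=> sz [ma sa]; have maz := nbhs_singleton ma.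
have max : \forall t \near x, multilinear (a (zeta t)) by exact: (smooth_at_continuous sz ma).
elim: L s1 => [|f L IH] s1 sL.
  split; first exact: (smooth_at_comp sz (sa (s1 ++ s2))).
  by move=> v; rewrite big_ord0 addr0; exact: (derive_comp v sz (sa (s1 ++ s2))).
have sf : smooth_at f x := sL 0%N.
have sL' i : smooth_at (nth (fun=> 0) L i) x := sL i.+1.
have N : \forall t \near x,
    \sum_i fcoord i (f t) *: a (zeta t) (rcons s1 (fbasis i) ++ [seq f t | f <- L] ++ s2) =
    a (zeta t) (s1 ++ f t :: [seq f t | f <- L] ++ s2).
  apply: filterS max => t mt; rewrite [RHS](multilinear_basis _ _ _ mt).
  by apply: eq_bigr => i _; rewrite cat_rcons.
have sc i : smooth_at (fun t => fcoord i (f t)) x.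
  by apply: (smooth_at_comp sf); apply: smooth_at_linear; [exact: fcoord_linear|exact: fcoord_continuous].
split.
  apply: smooth_at_eq N _; apply: smooth_at_sum => i; apply: smooth_at_scale; first exact: sc.
  exact: (IH (rcons s1 (fbasis i)) sL').1.
move=> v; rewrite -[LHS](near_eq_derive v N).
have Di i : is_derive x v
    (fun t => fcoord i (f t) *: a (zeta t) (rcons s1 (fbasis i) ++ [seq f t | f <- L] ++ s2))
    (fcoord i ('D_v f x) *: a (zeta x) (rcons s1 (fbasis i) ++ [seq f x | f <- L] ++ s2) +
     fcoord i (f x) *: ('D_('D_v zeta x) (fun z => a z (rcons s1 (fbasis i) ++ [seq f x | f <- L] ++ s2)) (zeta x) +
    \sum_(j < size L) a (zeta x) (rcons s1 (fbasis i) ++ set_nth 0 [seq f x | f <- L] j ('D_v (nth (fun=> 0) L j) x) ++ s2))).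
  have [s3 D2] := IH (rcons s1 (fbasis i)) sL'.
  apply: is_derive_scale; first exact: smooth_at_continuous s3.
    exact: (linear_comp_derive (fcoord_linear i) (fcoord_continuous i) (smooth_at_is_derive v sf)).
  by rewrite -D2; exact: smooth_at_is_derive.
have [_ ->] := is_derive_sumr (index_enum _) Di.
have C (u : E) (l : seq E) : a (zeta x) (s1 ++ u :: l) = \sum_i fcoord i u *: a (zeta x) (rcons s1 (fbasis i) ++ l).
  by rewrite (multilinear_basis _ _ _ maz); apply: eq_bigr => i _; rewrite cat_rcons.
have Na : \forall z \near zeta x, a z (s1 ++ f x :: [seq f x | f <- L] ++ s2) =
    \sum_i fcoord i (f x) *: a z (rcons s1 (fbasis i) ++ [seq f x | f <- L] ++ s2).
  apply: filterS ma => z mz; rewrite (multilinear_basis _ _ _ mz).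
  by apply: eq_bigr => i _; rewrite cat_rcons.
rewrite /= (near_eq_derive _ Na).
have Ei i : is_derive (zeta x) ('D_v zeta x)
   (fun z => fcoord i (f x) *: a z (rcons s1 (fbasis i) ++ [seq f x | f <- L] ++ s2))
   (fcoord i (f x) *: 'D_('D_v zeta x) (fun z => a z (rcons s1 (fbasis i) ++ [seq f x | f <- L] ++ s2)) (zeta x)).
  by apply: is_deriveZ; exact: smooth_at_is_derive.
have [_ ->] := is_derive_sumr (index_enum _) Ei.
rewrite big_ord_recl /= C big_split /= addrCA; congr (_ + _).
under eq_bigr do rewrite scalerDr; rewrite big_split /=; congr (_ + _).
under [RHS]eq_bigr do rewrite C; rewrite exchange_big; apply: eq_bigr => i _.
by rewrite scaler_sumr.
Qed.

Lemma multilinear_family_derive (V : normedModType R) {fV : finDim V}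
    (a : E -> seq E -> R^o) (zeta : V -> E) (L : seq (V -> E)) x :
  smooth_at zeta x -> smooth_family a (zeta x) ->
  (forall i, smooth_at (nth (fun=> 0) L i) x) ->
  smooth_at (fun t => a (zeta t) [seq f t | f <- L]) x /\
  forall v, 'D_v (fun t => a (zeta t) [seq f t | f <- L]) x =
    'D_('D_v zeta x) (fun z => a z [seq f x | f <- L]) (zeta x) +
    \sum_(i < size L) a (zeta x) (set_nth 0 [seq f x | f <- L] i ('D_v (nth (fun=> 0) L i) x)).
Proof.
move=> sz sa sL; pose proof (multilinear_family_derive_cat [::] [::] sz sa sL) as H.
move: H; under eq_fun do rewrite /= cats0; move=> [s D]; split=> // v; rewrite {}D.
rewrite cats0; congr (_ + _); by apply: eq_bigr => i _; rewrite /= cats0.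
Qed.
End MultilinearFamilies.

Lemma form_loc_multilinear (R : realType) (P : manifold R) (al : diff_form P)
    (c : chart R (mdim P) P) p : (forall q, multilinear (al q)) -> chart_around c p ->
  multilinear (form_loc c al (phi c p)).
Proof.
move=> ml cp l1 l2 b u v; rewrite /form_loc !map_cat /= -ml.
congr (al _ (_ ++ _ :: _)); rewrite !of_chartE//.
apply: loc_diff_linear => //; [exact: smooth_map_at_id|exact: chart_around_at].
Qed.

Lemma form_smooth_family (R : realType) (P : manifold R) (al : diff_form P)
    (c : chart R (mdim P) P) p : is_form al -> chart_around c p ->
  smooth_family (form_loc c al) (phi c p).
Proof.
move=> [ml _ sm] cp; split; last first.
  by move=> t; apply: (smooth_on_nbhs (near_img cp)); apply: sm; case: cp.
apply: filterS (near_img cp) => y iy; have [q cq ->] := img_ex cp.1 iy.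
exact: form_loc_multilinear.
Qed.

(** * Actions in charts *)

Section LocalAction.
Variables (R : realType) (G : lieGroup R) (P : manifold R) (act : G -> P -> P).
Hypothesis actP : is_action act.
Local Notation e := (lone G).
Local Notation EG := 'rV[R]_(mdim G).
Local Notation EP := 'rV[R]_(mdim P).
Local Notation ce := (chart_at G e).
Local Notation e0 := (phi ce e).
Variable c : chart R (mdim P) P.
Hypothesis ac : atlas P c.

Let aro : chart_around ce e. Proof. exact: chart_around_at. Qed.
Let ace : atlas G ce. Proof. by case: aro. Qed.
Let act1 p : act e p = p. Proof. by case: actP. Qed.
Let actM g h p : act (lmul g h) p = act g (act h p). Proof. by case: actP. Qed.
Let sA : smooth_map2 act. Proof. by case: actP. Qed.

Definition locact (w : EG * EP) : EP := phi c (act (psi ce w.1) (psi c w.2)).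

Lemma locact_smooth g z : img ce g -> img c z -> dom c (act (psi ce g) (psi c z)) ->
  smooth_at locact (g, z).
Proof.
move=> ig iz d.
have := @smooth_map2_loc _ _ _ _ act (psi ce g) (psi c z) ce c c sA
   (chart_around_psi ace ig) (chart_around_psi ac iz) (conj ac d).
by rewrite !phi_psi.
Qed.

Lemma locact_smooth_one z : img c z -> smooth_at locact (e0, z).
Proof.
move=> iz; apply: locact_smooth => //; first exact: img_one.
by rewrite psi_one act1; case: (chart_around_psi ac iz).
Qed.

Lemma locact_one z : img c z -> locact (e0, z) = z.
Proof. by move=> iz; rewrite /locact /= psi_one act1 phi_psi. Qed.

(** The generator of exp(tx), that is the opposite of the fundamental field, in the chart c. *)
Definition locfund (x : EG) (z : EP) : EP := 'D_(x, 0) locact (e0, z).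

Lemma locfund_smooth x z : img c z -> smooth_at (locfund x) z.
Proof.
by move=> iz; have [_] := derive_slice_r 0 (smooth_at_derive (x, 0) (locact_smooth_one iz)).
Qed.

Lemma locfund_linear z : img c z -> linear (locfund^~ z).
Proof.
move=> iz a x y; have sl := locact_smooth_one iz; rewrite /locfund.
rewrite -(derive_dirZ a (x, 0) sl) -(derive_dirD _ _ sl); congr ('D_ _ _ _).
by rewrite -[a *: (x, 0)]/(a *: x, a *: 0) -[RHS]/(_ + _, _ + _) scaler0 addr0.
Qed.

Lemma to_chart_fund x p : chart_around c p ->
  to_chart c p (fund_field act x p) = - locfund x (phi c p).
Proof.
move=> cp; rewrite (fund_fieldE x p actP) to_chartE.
have sid := @smooth_map_at_id _ _ p.
have sm : smooth_map_at (fun g => act g p) e by exact: (smooth_map2_left e p sA).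
have lN : linear (loc_diff id (chart_at P p) c p).
  by apply: loc_diff_linear => //; exact: chart_around_at.
rewrite (linear_funN lN); congr (- _).
have ap := chart_around_at p.
have cp' : chart_around c (act e p) by rewrite act1.
have ap' : chart_around (chart_at P p) (act e p) by rewrite act1.
have := loc_diff_idr x sm aro ap' cp'; rewrite act1 => E.
rewrite tmapE act1 E /loc_diff.
have [L _] := derive_slice x (locact_smooth_one (img_phi cp.2)).
have -> : loc_rep (fun g => act g p) ce c = (fun g => locact (g, phi c p)).
  by apply/funext => g; rewrite /locact /loc_rep /= psi_phi.
exact: L.
Qed.

(* The second derivative of the product at the unit; the bracket is its antisymmetrization. *)
Definition locB (x y : EG) : EG := 'D_(x, 0) ('D_(0, y) (@locmul R G)) (e0, e0).

Lemma locmul_smooth_one : smooth_at (@locmul R G) (e0, e0).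
Proof. apply: locmul_smooth; apply: locmul_dom_r1; exact: img_one. Qed.

Lemma locB_sym x y : locB x y = 'D_(0, y) ('D_(x, 0) (@locmul R G)) (e0, e0).
Proof. exact: (derive_sym _ _ locmul_smooth_one). Qed.

Lemma locmul_r1_derive (h x : EG) : img ce h -> 'D_(x, 0) (@locmul R G) (h, e0) = x.
Proof.
move=> ih; have [<- _] := derive_slice x (locmul_smooth (locmul_dom_r1 ih)).
have N : \forall g \near h, id g = locmul (g, e0).
  have nh : nbhs h (img ce).
    by have [p cp ->] := img_ex ace ih; exact: near_img.
  by apply: filterS nh => g ig; rewrite locmul_r1.
by rewrite -(near_eq_derive x N) derive_id.
Qed.

Lemma near_dom_act z : img c z -> \forall g \near e0, dom c (act (psi ce g) (psi c z)).
Proof.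
move=> iz; have cF := (smooth_map2_continuous e (psi c z) sA).1.
apply: (near_psi (A := fun q => dom c (act q (psi c z))) aro); apply: cF.
by rewrite act1; apply: filterS (near_dom (chart_around_psi ac iz)) => q [].
Qed.

Lemma near_mul_compat z h : img ce h -> img c z -> dom c (act (psi ce h) (psi c z)) ->
  \forall g \near e0, locact (locmul (g, h), z) = locact (g, locact (h, z)).
Proof.
move=> ih iz d.
have N : \forall g \near e0, dom ce (lmul (psi ce g) (psi ce h)).
  have cF := (smooth_map2_continuous e (psi ce h) (lmul_smooth G)).1.
  apply: (near_psi (A := fun q => dom ce (lmul q (psi ce h))) aro); apply: cF.
  by rewrite lmul1g; apply: filterS (near_dom (chart_around_psi ace ih)) => q [].
apply: filterS2 (near_img aro) N => g ig dg.
have D : locmul_dom (g, h) by [].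
have cq : chart_around c (act (psi ce h) (psi c z)) by [].
by rewrite {1}/locact [RHS]/locact /= psi_locmul// actM {1}/locact psi_phi.
Qed.

(* Differentiates act (g h) z = act g (act h z) in g and then in h at the unit. *)
Lemma locfund_second x y z : img c z ->
  'D_(locfund y z) (locfund x) z =
  locfund (locB x y) z + 'D_(y, 0) ('D_(x, 0) locact) (e0, z).
Proof.
move=> iz; have s1 := locact_smooth_one iz; have sm := locmul_smooth_one.
pose rho h := 'D_(x, 0) (@locmul R G) (e0, h).
have srho : smooth_at rho e0.
  by have [_] := derive_slice_r 0 (smooth_at_derive (x, 0) sm).
have rho1 : rho e0 = x by rewrite /rho locmul_r1_derive//; exact: img_one.
have N : \forall h \near e0, 'D_(rho h, 0) locact (h, z) = locfund x (locact (h, z)).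
  apply: filterS2 (near_img aro) (near_dom_act iz) => h ih dh.
  have sh := locact_smooth ih iz dh.
  have Dh := locmul_dom_l1 ih.
  have [E1 s2] := derive_slice x (locmul_smooth Dh).
  have s3 : smooth_at locact (locmul (e0, h), z) by rewrite locmul_l1.
  have [E2 _] := derive_compl x s2 s3.
  rewrite /rho -E1 -[X in (X, z)](locmul_l1 ih) -E2.
  rewrite (near_eq_derive x (near_mul_compat ih iz dh)).
  have ia : img c (locact (h, z)) by exact: img_phi.
  by rewrite (locmul_l1 ih); exact: (derive_slice x (locact_smooth_one ia)).1.
have := near_eq_derive y N.
have sp1 : smooth_at (fun h => (h, z)) e0.
  by apply: smooth_at_pair; [exact: smooth_at_id|exact: smooth_at_cst].
have sp2 : smooth_at (fun h => (rho h, 0 : EP)) e0.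
  by apply: smooth_at_pair; [exact: srho|exact: smooth_at_cst].
rewrite (derive_derive_dir y s1 sp1 sp2) rho1.
have [_ ->] := derive_pair (smooth_at_is_derive y srho) (is_derive_cst (0 : EP) e0 y).
have [_ ->] := derive_pair (is_derive_id e0 y) (is_derive_cst z e0 y).
have [-> _] := derive_slice_r y (smooth_at_derive (x, 0) sm).
rewrite -locB_sym -[X in X + _]/(locfund (locB x y) z) => ->.
have [E2 s2] := derive_slice y s1.
have sl : smooth_at (locfund x) (locact (e0, z)) by rewrite locact_one//; exact: locfund_smooth.
pose proof (derive_comp y s2 sl) as D; move: D; rewrite E2 (locact_one iz) => D.
exact: esym D.
Qed.

(** In the antisymmetrization of [locfund_second] the second derivatives of the action cancel by
    symmetry. *)
Lemma locfund_bracket x y z : img c z ->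
  locfund (locB x y - locB y x) z =
  'D_(locfund y z) (locfund x) z - 'D_(locfund x z) (locfund y) z.
Proof.
move=> iz; have E1 := locfund_second x y iz; have E2 := locfund_second y x iz.
pose proof (derive_sym (y, 0) (x, 0) (locact_smooth_one iz)) as S.
have aux (a b r t d d' : EP) : a = r + d -> b = t + d' -> d = d' -> r - t = a - b.
  by move=> -> -> ->; rewrite opprD addrACA subrr addr0.
exact: etrans (linear_funB (locfund_linear iz) _ _) (aux _ _ _ _ _ _ E1 E2 S).
Qed.

(* Differentiates the hypothesis along g = exp(t x).  The coefficients C j are constant
   for an invariant form, and the coordinates of Ad g y for an equivariant cochain. *)
Lemma infinitesimal_invariance (k : nat) (C : 'I_k -> G -> R^o) (al : 'I_k -> diff_form P) p x s :
  (forall j, is_form (al j)) -> (forall j, smooth_at (C j \o psi ce) e0) -> chart_around c p ->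
  (forall g, \sum_j C j g *: pullback (act g) (al j) p = \sum_j C j e *: al j p) ->
  \sum_j 'D_x (C j \o psi ce) e0 *: form_loc c (al j) (phi c p) s +
  \sum_j C j e *: ('D_(locfund x (phi c p)) (fun z => form_loc c (al j) z s) (phi c p) +
     \sum_(i < size s) form_loc c (al j) (phi c p)
        (set_nth 0 s i ('D_(nth 0 s i) (locfund x) (phi c p)))) = 0.
Proof.
move=> fal sC cp inv; set z := phi c p.
have iz : img c z by exact: (img_phi cp.2).
have s1 := locact_smooth_one iz.
pose a j := form_loc c (al j).
have sfam j : smooth_family (a j) z by exact: form_smooth_family.
(* The arguments pushed forward by the action of g: the hypothesis becomes the constancy in g of the
   forms evaluated on these moving vectors at the moving point g z. *)
pose L := [seq (fun g : EG => 'D_(0, u) locact (g, z)) | u <- s].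
have nthL i : nth (fun=> 0) L i = (fun g => if (i < size s)%N then 'D_(0, nth 0 s i) locact (g, z) else 0).
  apply/funext => g; case: ltnP => si; first by rewrite (nth_map 0).
  by rewrite nth_default// size_map.
have sD u : smooth_at (fun g => 'D_(0, u) locact (g, z)) e0.
  by have [_] := derive_slice 0 (smooth_at_derive (0, u) s1).
have sL i : smooth_at (nth (fun=> 0) L i) e0.
  by rewrite nthL; case: (i < size s)%N; [exact: sD|exact: smooth_at_cst].
have [Ez sz] := derive_slice x s1.
have sfam' j : smooth_family (a j) (locact (e0, z)) by rewrite locact_one.
pose proof (fun j => multilinear_family_derive sz (sfam' j) sL) as M.
have Le : [seq f e0 | f <- L] = s.
  rewrite /L -map_comp -[RHS]map_id; apply: eq_map => u /=.
  have [<- _] := derive_slice_r u s1.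
  have N : \forall y \near z, id y = locact (e0, y).
    by apply: filterS (near_img cp) => y iy; rewrite locact_one.
  by rewrite -(near_eq_derive u N) derive_id.
have N : \forall g \near e0, \sum_j C j (psi ce g) *: a j (locact (g, z)) [seq f g | f <- L] =
   \sum_j C j e *: a j z s.
  apply: filterS2 (near_img aro) (near_dom_act iz) => g ig dg.
  have := inv (psi ce g); rewrite -[p](psi_phi cp) -/z => I.
  have I' := congr1 (fun f => f [seq of_chart c z u | u <- s]) I; move: I'; rewrite !fct_sumE => I'.
  rewrite [RHS](_ : _ = \sum_j (C j e *: al j (psi c z)) [seq of_chart c z u | u <- s])// -I'.
  apply: eq_bigr => j _; congr (_ *: _).
  have sg : smooth_map_at (act (psi ce g)) (psi c z) by exact: (smooth_map2_right (psi ce g) (psi c z) sA).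
  have cz := chart_around_psi ac iz.
  have := form_loc_pullback (al j) s sg cz (conj ac dg); rewrite phi_psi// => E.
  transitivity (form_loc c (pullback (act (psi ce g)) (al j)) z s); last by [].
  rewrite E; congr (form_loc c (al j) _ _).
  rewrite /L -map_comp; apply: eq_map => u /=.
  have [<- _] := derive_slice_r u (locact_smooth ig iz dg).
  by rewrite /loc_diff phi_psi.
have := near_eq_derive x N; rewrite [X in _ = X -> _]derive_cst.
(* Exchanging the two derivatives turns the variation of a pushed-forward vector into a derivative
   of the generator. *)
have Lx u : 'D_x (fun g => 'D_(0, u) locact (g, z)) e0 = 'D_u (locfund x) z.
  rewrite (derive_slice x (smooth_at_derive (0, u) s1)).1 (derive_sym _ _ s1).
  by rewrite -(derive_slice_r u (smooth_at_derive (x, 0) s1)).1.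
have Dj j : is_derive e0 x (fun g => C j (psi ce g) *: a j (locact (g, z)) [seq f g | f <- L])
   ('D_x (C j \o psi ce) e0 *: a j z s +
    C j e *: ('D_(locfund x z) (fun y => a j y s) z +
      \sum_(i < size s) a j z (set_nth 0 s i ('D_(nth 0 s i) (locfund x) z)))).
  have [s2 D2] := M j; have {}D2 := D2 x.
  have E2 : 'D_x (fun g => a j (locact (g, z)) [seq f g | f <- L]) e0 =
      'D_(locfund x z) (fun y => a j y s) z +
      \sum_(i < size s) a j z (set_nth 0 s i ('D_(nth 0 s i) (locfund x) z)).
    rewrite D2 Ez Le locact_one// size_map; congr (_ + _); apply: eq_bigr => i _.
    by rewrite nthL ltn_ord Lx.
  rewrite -E2; have E0 : a j (locact (e0, z)) [seq f e0 | f <- L] = a j z s.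
    by rewrite locact_one// Le.
  have := is_derive_scale (smooth_at_continuous s2) (smooth_at_is_derive x (sC j)) (smooth_at_is_derive x s2).
  by rewrite E0 /= psi_one.
have [_ ->] := is_derive_sumr (index_enum _) Dj.
by rewrite big_split.
Qed.
End LocalAction.

(** * The adjoint action and the Lie bracket *)

Section AdjointAction.
Variables (R : realType) (G : lieGroup R).
Local Notation e := (lone G).
Local Notation E := 'rV[R]_(mdim G).
Local Notation ce := (chart_at G e).
Local Notation e0 := (phi ce e).
Implicit Types (x y : E) (g h : G).

Let aro : chart_around ce e. Proof. exact: chart_around_at. Qed.
Let ace : atlas G ce. Proof. by case: aro. Qed.

Definition lconj g h : G := lmul (lmul g h) (linv g).

Lemma lconj1 g : lconj g e = e.
Proof. by rewrite /lconj lmulg1 lmulgV. Qed.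

Lemma lconj_smooth g h : smooth_map_at (lconj g) h.
Proof.
have s1 := smooth_map2_right g h (lmul_smooth G).
have s2 := smooth_map2_left (lmul g h) (linv g) (lmul_smooth G).
exact: (smooth_map_at_comp s1 s2).
Qed.

Lemma AdE g x : Ad g x = tmap (lconj g) e x.
Proof. by []. Qed.

Lemma Ad_linear g : linear (Ad g).
Proof. exact: (tmap_linear (lconj_smooth g e)). Qed.

Lemma Ad_one x : Ad e x = x.
Proof.
rewrite AdE (_ : lconj e = id) ?tmap_id//; apply/funext => h.
by rewrite /lconj lmul1g (linv_unique (lmul1g e)) lmulg1.
Qed.

Lemma Ad_mul g h x : Ad (lmul g h) x = Ad g (Ad h x).
Proof.
rewrite !AdE (_ : lconj (lmul g h) = lconj g \o lconj h); last first.
  by apply/funext => k; rewrite /lconj /= linvM !lmulA.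
by rewrite (tmap_comp _ (lconj_smooth h e) (lconj_smooth g _)) lconj1.
Qed.

Lemma AdK g x : Ad (linv g) (Ad g x) = x.
Proof. by rewrite -Ad_mul lmulVg Ad_one. Qed.

Lemma AdVK g x : Ad g (Ad (linv g) x) = x.
Proof. by rewrite -Ad_mul lmulgV Ad_one. Qed.

Lemma tmap_fund_field (P : manifold R) (act : G -> P -> P) g x p : is_action act ->
  tmap (act g) p (fund_field act x p) = fund_field act (Ad g x) (act g p).
Proof.
move=> aP; have [sA a1 aM] := aP; rewrite !fund_fieldE//.
have sg q : smooth_map_at (act g) q by exact: (smooth_map2_right g q sA).
have so q h : smooth_map_at (fun k => act k q) h by exact: (smooth_map2_left h q sA).
rewrite (linear_funN (tmap_linear (sg p))); congr (- _).
have -> : tmap (act g) p (tmap (fun h => act h p) e x) =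
    tmap (act g \o (fun h => act h p)) e x.
  by rewrite (tmap_comp x (so p e) (sg (act e p))) a1.
have -> : act g \o (fun h => act h p) = (fun k => act k (act g p)) \o lconj g.
  by apply/funext => h; rewrite /lconj /= -!aM -lmulA lmulVg lmulg1.
by rewrite (tmap_comp x (lconj_smooth g e) (so (act g p) _)) AdE lconj1.
Qed.

Definition locconj (c : chart R (mdim G) G) (w : E * E) : E :=
  phi ce (lconj (psi c w.1) (psi ce w.2)).

(** Joint smoothness in g and h is needed to differentiate Ad g with respect to g. The factors g h
    and g^-1 are read in charts around g and g^-1 before they are multiplied. *)
Lemma locconj_smooth c g : chart_around c g -> smooth_at (locconj c) (phi c g, e0).
Proof.
move=> cg; have cge : chart_around c (lmul g e) by rewrite lmulg1.
have s1 := smooth_map2_loc (lmul_smooth G) cg aro cge.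
have cv := chart_around_at (linv g); set c' := chart_at G (linv g) in cv.
have s2 := (smooth_map_loc (linv g) (linv_smooth G)).2.
have si : smooth_at (loc_rep (@linv R G) c c') (phi c g).
  exact: ((smooth_map_loc g (linv_smooth G)).2 c c' cg cv).
have ceg : chart_around ce (lmul g (linv g)) by rewrite lmulgV.
have s3 := smooth_map2_loc (lmul_smooth G) cg cv ceg.
have sfst : smooth_at (fun w : E * E => w.1) (phi c g, e0).
  by apply: smooth_at_linear => [a u v|w]; [by []|exact: cvg_fst].
pose proof (smooth_at_comp sfst si) as s4.
pose proof (smooth_at_pair s1 s4) as s5.
have E5 : (phi c (lmul (psi c (phi c g, e0).1) (psi ce (phi c g, e0).2)),
   (loc_rep (@linv R G) c c' \o (fun w : E * E => w.1)) (phi c g, e0)) = (phi c g, phi c' (linv g)).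
  by rewrite /loc_rep /= !psi_phi// lmulg1.
rewrite -E5 in s3; pose proof (smooth_at_comp s5 s3) as s6.
have C1 : {for (phi c g, e0), continuous (fun w : E * E => lmul (psi c w.1) (psi ce w.2))}.
  apply: (@continuous_comp _ _ _ (fun w : E * E => (psi c w.1, psi ce w.2)) (fun z => lmul z.1 z.2)).
    apply: cvg_pair => /=.
      exact: (@continuous_comp _ _ _ fst (psi c) (phi c g, e0) (@cvg_fst _ _ _ _ _) (psi_continuous cg)).
    exact: (@continuous_comp _ _ _ snd (psi ce) (phi c g, e0) (@cvg_snd _ _ _ _ _) (psi_continuous aro)).
  by have [cF _] := lmul_smooth G; exact: cF.
have C2 : {for (phi c g, e0), continuous (fun w : E * E => linv (psi c w.1))}.
  apply: (@continuous_comp _ _ _ (fun w : E * E => psi c w.1) (@linv R G)).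
    exact: (@continuous_comp _ _ _ fst (psi c) (phi c g, e0) (@cvg_fst _ _ _ _ _) (psi_continuous cg)).
  by case: (linv_smooth G) => + _; exact.
have N1 : \forall w \near (phi c g, e0), chart_around c (lmul (psi c w.1) (psi ce w.2)).
  by apply: C1 => /=; rewrite !psi_phi//; exact: near_dom.
have N2 : \forall w \near (phi c g, e0), chart_around c' (linv (psi c w.1)).
  by apply: C2 => /=; rewrite !psi_phi//; exact: near_dom.
apply: smooth_at_eq s6; apply: filterS2 N1 N2 => w w1 w2.
by rewrite /locconj /loc_rep /lconj /= (psi_phi w1) (psi_phi w2).
Qed.

Lemma Ad_locconj c g y : chart_around c g -> Ad g y = 'D_(0, y) (locconj c) (phi c g, e0).
Proof.
move=> cg; rewrite AdE tmapE lconj1 /loc_diff.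
have [<- _] := derive_slice_r y (locconj_smooth cg).
have -> // : loc_rep (lconj g) ce ce = (fun z => locconj c (phi c g, z)).
by apply/funext => h; rewrite /locconj /loc_rep /= psi_phi.
Qed.

Lemma Ad_smooth c g y : chart_around c g -> smooth_at (fun a => Ad (psi c a) y) (phi c g).
Proof.
move=> cg; have [_ s] := derive_slice 0 (smooth_at_derive (0, y) (locconj_smooth cg)).
apply: smooth_at_eq s; apply: filterS (near_img cg) => a ia.
by rewrite (Ad_locconj _ (chart_around_psi cg.1 ia)) phi_psi//; case: cg.
Qed.

Lemma Ad_continuous y : continuous (fun g => Ad g y).
Proof.
move=> g; have cg := chart_around_at g; set c := chart_at G g in cg.
have C : {for g, continuous ((fun a => Ad (psi c a) y) \o phi c)}.
  apply: continuous_comp; first exact: phi_continuous.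
  exact: smooth_at_continuous (Ad_smooth y cg).
have E0 : ((fun a => Ad (psi c a) y) \o phi c) g = Ad g y by rewrite /= psi_phi.
have C' : ((fun a => Ad (psi c a) y) \o phi c) @ g --> Ad g y by rewrite -E0; exact: C.
apply: cvg_trans C'; apply: near_eq_cvg.
by apply: filterS (near_dom cg) => h ch /=; rewrite psi_phi.
Qed.

(** This is where compactness enters: the norm of Ad g on each basis vector is continuous in g,
    hence attains a maximum. *)
Lemma Ad_bounded : compact [set: G] -> exists2 C, 0 < C & forall g x, `|Ad g x| <= C * `|x|.
Proof.
move=> cG.
have B i : exists2 K, 0 <= K & forall g, `|Ad g (delta_mx ord0 i)| <= K.
  have [| | |g _ gP] := @compact_EVT_max G R (fun g => `|Ad g (delta_mx ord0 i)|) [set: G].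
  - by exists e.
  - exact: cG.
  - apply: continuous_subspaceT => g; apply: cvg_norm; exact: Ad_continuous.
  - exists `|Ad g (delta_mx ord0 i)|; first exact: normr_ge0.
    by move=> h; apply: gP; rewrite inE.
pose K i := sval (cid2 (B i)).
have K0 i : 0 <= K i by rewrite /K; case: cid2.
have KP i g : `|Ad g (delta_mx ord0 i)| <= K i by rewrite /K; case: cid2.
exists (1 + \sum_i K i); first by rewrite ltr_pwDl// sumr_ge0.
move=> g x; rewrite {1}[x]fcoordK (linear_fun_sum (Ad_linear g)).
apply: le_trans (ler_norm_sum _ _ _) _; rewrite mulrDl mul1r mulr_suml -[leLHS]add0r lerD//.
apply: ler_sum => i _; rewrite (linear_funZ (Ad_linear g)) normrZ mulrC ler_pM//; first exact: KP.
exact: rV_coord_norm.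
Qed.

Lemma locB_linearl y : linear (fun x : E => locB x y).
Proof.
have s := smooth_at_derive (0, y) (locmul_smooth_one G).
move=> a u v; rewrite /locB -(derive_dirZ a (u, 0) s) -(derive_dirD _ _ s); congr ('D_ _ _ _).
by rewrite -[a *: (u, 0)]/(a *: u, a *: 0) -[RHS]/(_ + _, _ + _) scaler0 addr0.
Qed.

Lemma locB_linearr x : linear (fun y : E => locB x y).
Proof.
have s := smooth_at_derive (x, 0) (locmul_smooth_one G).
move=> a u v; rewrite !locB_sym -(derive_dirZ a (0, u) s) -(derive_dirD _ _ s); congr ('D_ _ _ _).
by rewrite -[a *: (0, u)]/(a *: 0, a *: u) -[RHS]/(_ + _, _ + _) scaler0 addr0.
Qed.

Lemma locfield_derive x y : 'D_x (locfield y) e0 = locB x y.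
Proof.
have s := smooth_at_derive (0, y) (locmul_smooth_one G).
exact: (derive_slice x s).1.
Qed.

(** Near the unit the left-invariant field of u reads [locfield u], whose derivative at the unit is
    a second derivative of the product. *)
Lemma lbracketE x y : lbracket x y = locB x y - locB y x.
Proof.
have L u : left_field u e = u by rewrite /left_field (_ : lmul e = id) ?tmap_id//; apply/funext => h; rewrite lmul1g.
rewrite /lbracket /vbracket !L.
have N u : \forall b \near e0, vfield_loc ce (left_field u) b = locfield u b.
  apply: filterS (near_img aro) => b ib; rewrite /vfield_loc /left_field to_chartE.
  have sb := smooth_map2_right (psi ce b) e (lmul_smooth G).
  have cb := chart_around_psi ace ib.
  have ce1 : chart_around (chart_at G (lmul (psi ce b) e)) (lmul (psi ce b) e) by exact: chart_around_at.
  have cb1 : chart_around ce (lmul (psi ce b) e) by rewrite lmulg1.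
  have := loc_diff_idr u sb aro ce1 cb1; rewrite -tmapE lmulg1 => ->.
  rewrite /loc_diff /locfield.
  by have [<- _] := derive_slice_r u (locmul_smooth (locmul_dom_r1 ib)).
have D (u v : E) : ('D_u (vfield_loc ce (left_field v)) e0 : E) = locB u v.
  by have -> := near_eq_derive u (N v); exact: (locfield_derive u v).
exact (congr2 (fun a b : E => a - b) (D x y) (D y x)).
Qed.

Lemma lbracket_linearl y : linear (fun x : E => lbracket x y).
Proof.
move=> a u v; rewrite !lbracketE locB_linearl locB_linearr.
by rewrite opprD addrACA -scalerN -scalerDr.
Qed.

Lemma lbracketC x y : lbracket x y = - lbracket y x.
Proof. by rewrite !lbracketE opprB. Qed.

Lemma lbracket_linearr x : linear (fun y : E => lbracket x y).
Proof.
by move=> a u v; rewrite !(lbracketC x) lbracket_linearl opprD scalerN.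
Qed.

Lemma lbracketxx x : lbracket x x = 0.
Proof. by rewrite lbracketE subrr. Qed.

(** Writing conjugation as (a h a^-1) a = a h avoids differentiating the inverse. The derivative in
    h at the unit gives the identity N, and the derivative of N in a gives [locB x y] as the sum of
    the left side and [locB y x]. *)
Lemma Ad_derive x y : 'D_x (fun a => Ad (psi ce a) y) e0 = lbracket x y.
Proof.
have sm := locmul_smooth_one G.
pose al a := Ad (psi ce a) y.
have sal : smooth_at al e0 := Ad_smooth y aro.
have al0 : al e0 = y by rewrite /al psi_one Ad_one.
have N : \forall a \near e0, 'D_(al a, 0) (@locmul R G) (e0, a) = locfield y a.
  apply: filterS (near_img aro) => a ia; have ca := chart_around_psi ace ia.
  have := locconj_smooth ca; rewrite phi_psi// => sK.
  have [Dk sk] := derive_slice_r y sK.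
  have K0 : locconj ce (a, e0) = e0 by rewrite /locconj /= psi_one lconj1.
  have Da := locmul_dom_l1 ia.
  have smK : smooth_at (@locmul R G) (locconj ce (a, e0), a) by rewrite K0; exact: locmul_smooth.
  have [E1 _] := derive_compl y sk smK.
  have -> : al a = 'D_y (fun z => locconj ce (a, z)) e0.
    by rewrite Dk /al (Ad_locconj y ca) phi_psi.
  rewrite K0 in E1; rewrite -E1.
  have N1 : \forall h \near e0, locmul (locconj ce (a, h), a) = locmul (a, h).
    have n1 : \forall h \near e0, dom ce (lconj (psi ce a) (psi ce h)).
      apply: (near_psi (A := fun q => dom ce (lconj (psi ce a) q)) aro).
      apply: (lconj_smooth (psi ce a) e).1; rewrite lconj1.
      by apply: filterS (near_dom aro) => q [].
    apply: filterS n1 => h dh; rewrite /locmul /locconj /= psi_phi//.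
    by rewrite /lconj -lmulA lmulVg lmulg1.
  rewrite (near_eq_derive y N1).
  by have [-> _] := derive_slice_r y (locmul_smooth (locmul_dom_r1 ia)).
have := near_eq_derive x N.
have sp1 : smooth_at (fun a : E => (e0, a)) e0.
  by apply: smooth_at_pair; [exact: smooth_at_cst|exact: smooth_at_id].
have sp2 : smooth_at (fun a => (al a, 0 : E)) e0.
  by apply: smooth_at_pair; [exact: sal|exact: smooth_at_cst].
rewrite (derive_derive_dir x sm sp1 sp2) al0.
have [_ ->] := derive_pair (smooth_at_is_derive x sal) (is_derive_cst (0 : E) e0 x).
have [_ ->] := derive_pair (is_derive_cst e0 e0 x) (is_derive_id e0 x).
rewrite (locmul_r1_derive _ (img_one G)) locfield_derive -locB_sym => H.
have aux (p q r : E) : p + q = r -> p = r - q by move=> <-; rewrite addrK.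
exact (etrans (aux _ _ _ H) (esym (lbracketE x y))).
Qed.

Lemma linear_finDim_continuous (V W : normedModType R) {fV : finDim V} (f : V -> W) :
  linear f -> continuous f.
Proof.
move=> lf u; rewrite (_ : f = fun v => \sum_i fcoord i v *: f (fbasis i)); last first.
  apply/funext => v; rewrite {1}[v]fcoordK (linear_fun_sum lf); apply: eq_bigr => i _.
  exact: (linear_funZ lf).
apply: continuous_sumr => i; apply: cvgZ; first exact: fcoord_continuous.
exact: cvg_cst.
Qed.

(** Differentiate Ad g Ad a = Ad (g a g^-1) Ad g with respect to a at the unit, using
    [Ad_derive]. *)
Lemma Ad_lbracket g x y : Ad g (lbracket x y) = lbracket (Ad g x) (Ad g y).
Proof.
set z := Ad g y; rewrite -(Ad_derive (Ad g x) z).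
have -> : y = Ad (linv g) z by rewrite AdK.
rewrite -Ad_derive.
have lA := Ad_linear g; pose proof (linear_finDim_continuous lA) as cA.
have D1 := linear_comp_derive lA cA (smooth_at_is_derive x (Ad_smooth (Ad (linv g) z) aro)).
have [_ <-] := D1.
have se := (lconj_smooth g e).2 ce ce aro; rewrite lconj1 in se; have sk := se aro.
have k0 : loc_rep (lconj g) ce ce e0 = e0 by rewrite /loc_rep /= psi_one lconj1.
have N : \forall a \near e0, (Ad g \o (fun b => Ad (psi ce b) (Ad (linv g) z))) a =
    ((fun b => Ad (psi ce b) z) \o loc_rep (lconj g) ce ce) a.
  have n1 : \forall a \near e0, dom ce (lconj g (psi ce a)).
    apply: (near_psi (A := fun q => dom ce (lconj g q)) aro).
    by apply: (lconj_smooth g e).1; rewrite lconj1; apply: filterS (near_dom aro) => q [].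
  by apply: filterS n1 => a da; rewrite /loc_rep /= psi_phi// /lconj !Ad_mul.
rewrite (near_eq_derive x N).
have sz : smooth_at (fun b => Ad (psi ce b) z) (loc_rep (lconj g) ce ce e0).
  by rewrite k0; exact: Ad_smooth.
by rewrite (derive_comp x sk sz) k0 AdE tmapE lconj1.
Qed.
End AdjointAction.

(** * An equivariant section of the bracket *)

Section Averaging.
Variable R : realType.

Lemma geometric_limit_scalar (u : nat -> R) (C : R) :
  (forall k, `|u k.+1 - u k| <= C / 2 ^+ k) ->
  exists l, forall k, `|l - u k| <= 2 * C / 2 ^+ k.
Proof.
move=> H; have H' k : `|const_mx (u k.+1) - const_mx (u k) : 'rV[R]_1| <= C / 2 ^+ k.
  apply: rV_norm_le => [|i]; first exact: le_trans (normr_ge0 _) (H k).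
  by rewrite !mxE; exact: H.
have [l lP] := geometric_limit H'; exists (l ord0 ord0) => k.
by apply: le_trans (lP k); apply: le_trans (rV_coord_norm _ ord0); rewrite !mxE.
Qed.

Lemma geometric_bound0 (a C : R) : (forall k : nat, `|a| <= C / 2 ^+ k) -> a = 0.
Proof.
move=> H; apply/eqP; rewrite -normr_le0.
have h : `|1 / 2 : R| < 1 by rewrite ger0_norm; lra.
have D := @cvg_geometric R C (1 / 2) h.
apply: (cvgr_to_ge D); near=> k => /=.
by rewrite expr_div_n expr1n mul1r; exact: H.
Unshelve. all: by end_near. Qed.

Variables (I J : finType) (T : Type) (M : T -> I -> I -> R) (B : R).
Implicit Types (u v : I -> R) (g h : T).

Definition sqnorm v : R := \sum_i v i ^+ 2.
Definition lact g v : I -> R := fun i => \sum_j M g i j * v j.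

Lemma sqnorm_ge0 v : 0 <= sqnorm v.
Proof. by apply: sumr_ge0 => i _; exact: sqr_ge0. Qed.

Lemma sqnorm_coord v i (c : R) : 0 <= c -> sqnorm v <= c ^+ 2 -> `|v i| <= c.
Proof.
move=> c0 H; rewrite -(@ler_pXn2r _ 2)// ?nnegrE//.
rewrite -normrX ger0_norm ?sqr_ge0//; apply: le_trans H.
by rewrite /sqnorm (bigD1 i)//= lerDl sumr_ge0// => j _; exact: sqr_ge0.
Qed.

Lemma sqnorm_parallelogram u v :
  sqnorm (fun i => (u i + v i) / 2) =
  (sqnorm u + sqnorm v) / 2 - sqnorm (fun i => u i - v i) / 4.
Proof.
rewrite /sqnorm -big_split /= !mulr_suml -sumrB; apply: eq_bigr => i _.
by field.
Qed.

Hypothesis MB : forall g i j, `|M g i j| <= B.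

(** A crude bound suffices, but it must be uniform in g: applied to inverses, it also bounds the
    norm of g v from below. The 1 makes the constant positive. *)
Lemma lact_bounded g v : sqnorm (lact g v) <= (1 + #|I|%:R * (#|I|%:R * B) ^+ 2) * sqnorm v.
Proof.
pose s := Num.sqrt (sqnorm v).
have s0 : 0 <= s by exact: sqrtr_ge0.
have ss : s ^+ 2 = sqnorm v by rewrite sqr_sqrtr// sqnorm_ge0.
have vs i : `|v i| <= s by apply: sqnorm_coord => //; rewrite ss.
apply: (@le_trans _ _ (\sum_(i in I) (#|I|%:R * B * s) ^+ 2)).
  apply: ler_sum => i _; rewrite -[X in X <= _]ger0_norm ?sqr_ge0// normrX.
  have b : `|lact g v i| <= #|I|%:R * B * s.
    apply: le_trans (ler_norm_sum _ _ _) _.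
    apply: (@le_trans _ _ (\sum_(j in I) B * s)).
      by apply: ler_sum => j _; rewrite normrM ler_pM.
    by rewrite sumr_const -[_ *+ _]mulr_natl mulrA.
  by rewrite lerXn2r// ?nnegrE//; exact: le_trans (normr_ge0 _) b.
rewrite sumr_const -[_ *+ _]mulr_natl exprMn ss mulrDl mul1r mulrA lerDr.
exact: sqnorm_ge0.
Qed.

Variables (e : T) (mul : T -> T -> T) (inv : T -> T).
Hypotheses (actM : forall g h v, lact (mul g h) v = lact g (lact h v))
  (actV : forall g v, lact (inv g) (lact g v) = v).

Variables (c : J -> I -> R) (d : J -> R).
Definition affine v : Prop := forall m, \sum_i c m i * v i = d m.
Hypotheses (affine_inv : forall g v, affine v -> affine (lact g v))
  (affine_ex : exists v, affine v).

(* The function v |-> sup_g |g v|^2 is invariant and uniformly convex, so that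
   a minimizing sequence in an invariant affine subspace is Cauchy, and its
   limit is fixed by the action. *)
Lemma affine_fixed_point : exists2 v, affine v & forall g, lact g v = v.
Proof.
pose D : R := 1 + #|I|%:R * (#|I|%:R * B) ^+ 2.
have D0 : 0 < D by rewrite ltr_pwDl// mulr_ge0// sqr_ge0.
pose S v := [set sqnorm (lact g v) | g in [set: T]].
have Sub v : ubound (S v) (D * sqnorm v) by move=> _ [g _ <-]; exact: lact_bounded.
have Ssup v : has_sup (S v).
  by split; [exists (sqnorm (lact e v)), e|exists (D * sqnorm v)].
pose f v := sup (S v).
have fge g v : sqnorm (lact g v) <= f v by apply: ub_le_sup; [exact: (Ssup v).2|exists g].
have fle v b : (forall g, sqnorm (lact g v) <= b) -> f v <= b.
  by move=> H; apply: ge_sup; [exact: (Ssup v).1|move=> _ [g _ <-]].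
have f0 v : 0 <= f v by exact: le_trans (sqnorm_ge0 _) (fge e v).
have finv g v : f (lact g v) <= f v by apply: fle => h; rewrite -actM.
have lactD g u v (a b : R) : lact g (fun i => a * u i + b * v i) = (fun i => a * lact g u i + b * lact g v i).
  apply/funext => i; rewrite /lact !mulr_sumr -big_split /=; apply: eq_bigr => j _.
  by rewrite mulrDr !(mulrCA (M g i j)).
(* Uniform convexity: the parallelogram identity for each g, where |g (u - v)|^2 is at least |u -
   v|^2 / D because g has a bounded inverse. *)
have fmid u v : f (fun i => (u i + v i) / 2) <= (f u + f v) / 2 - sqnorm (fun i => u i - v i) / (4 * D).
  apply: fle => g.
  have -> : lact g (fun i => (u i + v i) / 2) = (fun i => (lact g u i + lact g v i) / 2).
    have -> : (fun i => (u i + v i) / 2) = (fun i => 2^-1 * u i + 2^-1 * v i).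
      by apply/funext => i; rewrite mulrDl !(mulrC 2^-1).
    by rewrite lactD; apply/funext => i; rewrite mulrDl !(mulrC 2^-1).
  rewrite sqnorm_parallelogram.
  have Ed : (fun i => lact g u i - lact g v i) = lact g (fun i => u i - v i).
    have -> : (fun i => u i - v i) = (fun i => 1 * u i + -1 * v i).
      by apply/funext => i; rewrite mul1r mulN1r.
    by rewrite lactD; apply/funext => i; rewrite mul1r mulN1r.
  have : sqnorm (fun i => u i - v i) <= D * sqnorm (fun i => lact g u i - lact g v i).
    by rewrite Ed -{1}(actV g (fun i => u i - v i)); exact: lact_bounded.
  have := fge g u; have := fge g v.
  move: (sqnorm (lact g u)) (sqnorm (lact g v)) (sqnorm (fun i => lact g u i - lact g v i))
    (sqnorm (fun i => u i - v i)) => a b q p bv au pq.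
  have : p / (4 * D) <= q / 4.
    rewrite ler_pdivrMr ?mulr_gt0//; apply: le_trans pq _.
    by rewrite le_eqVlt; apply/orP; left; apply/eqP; field.
  by lra.
pose K := [set f v | v in [set v | affine v]].
have Kinf : has_inf K.
  split; first by have [v av] := affine_ex; exists (f v), v.
  by exists 0 => _ [v _ <-].
pose m := inf K.
have mle v : affine v -> m <= f v by move=> av; apply: ge_inf; [exact: Kinf.2|exists v].
(* By [fmid], two points of the affine subspace where f is within eps k of its infimum are at
   distance at most 1 / 2^k. *)
pose eps (k : nat) : R := (1 / 2 ^+ k) ^+ 2 / (4 * D).
have eps0 k : 0 < eps k.
  by rewrite divr_gt0 ?exprn_gt0 ?mulr_gt0// divr_gt0// exprn_gt0.
have ex k : {v | affine v /\ f v <= m + eps k}.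
  apply: cid; have [_ [v av <-] vm] := inf_adherent (eps0 k) Kinf.
  by exists v; split => //; exact: ltW.
pose u k := sval (ex k).
have au k : affine (u k) by rewrite /u; case: (ex k) => v [].
have fu k : f (u k) <= m + eps k by rewrite /u; case: (ex k) => v [].
have amid v w : affine v -> affine w -> affine (fun i => (v i + w i) / 2).
  move=> av aw j; have -> : \sum_i c j i * ((v i + w i) / 2) = (\sum_i c j i * v i + \sum_i c j i * w i) / 2.
    by rewrite -big_split /= mulr_suml; apply: eq_bigr => i _; ring.
  by rewrite av aw; field.
have close k v w : affine v -> affine w -> f v <= m + eps k -> f w <= m + eps k ->
    forall i, `|v i - w i| <= 1 / 2 ^+ k.
  move=> av aw fv fw i; apply: (@sqnorm_coord (fun i => v i - w i)).
    by rewrite divr_ge0// exprn_ge0.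
  have := le_trans (mle _ (amid v w av aw)) (fmid v w); rewrite -/(eps k) => H.
  have : sqnorm (fun i => v i - w i) / (4 * D) <= eps k by move: H; lra.
  by rewrite /eps ler_pM2r// invr_gt0 mulr_gt0.
have epsS k : eps k.+1 <= eps k.
  rewrite /eps ler_pM2r ?invr_gt0 ?mulr_gt0// lerXn2r ?nnegrE ?divr_ge0 ?exprn_ge0//.
  by rewrite ler_pM2l// lef_pV2 ?posrE ?exprn_gt0// exprS ler_peMl ?exprn_ge0// ler1n.
have lim i := geometric_limit_scalar (fun k => close k (u k.+1) (u k) (au _) (au _)
  (le_trans (fu k.+1) (lerD (lexx m) (epsS k))) (fu k) i).
pose l i := sval (cid (lim i)).
have lP i k : `|l i - u k i| <= 2 / 2 ^+ k.
  by rewrite /l; case: cid => x /= /(_ k); rewrite mulr1.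
have sum_bound (a : I -> R) k : `|\sum_i a i * (l i - u k i)| <= (2 * \sum_i `|a i|) / 2 ^+ k.
  apply: le_trans (ler_norm_sum _ _ _) _; rewrite mulrAC mulr_sumr; apply: ler_sum => i _.
  by rewrite normrM mulrC ler_wpM2r.
exists l => [j|g].
  apply/eqP; rewrite -subr_eq0; apply/eqP/(@geometric_bound0 _ (2 * \sum_i `|c j i|)) => k.
  rewrite -(au k j) -sumrB; under eq_bigr do rewrite -mulrBr; exact: sum_bound.
apply/funext => i; apply/eqP; rewrite -subr_eq0; apply/eqP.
(* Split g l - l into g (l - u k), g (u k) - u k and l - u k. The middle term is at most 1 / 2^k
   since g (u k) is as nearly minimal as u k; the last gives the remaining 2. *)
apply: (@geometric_bound0 _ (2 * \sum_j `|M g i j| + 3)) => k.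
have -> : lact g l i - l i = (\sum_j M g i j * (l j - u k j)) + (lact g (u k) i - u k i) - (l i - u k i).
  rewrite [X in X + _ - _](_ : _ = lact g l i - lact g (u k) i); first by ring.
  by rewrite /lact -sumrB; apply: eq_bigr => j _; rewrite mulrBr.
have -> : (2 * (\sum_j `|M g i j|) + 3) / 2 ^+ k =
    (2 * \sum_j `|M g i j|) / 2 ^+ k + 1 / 2 ^+ k + 2 / 2 ^+ k by ring.
apply: le_trans (ler_normB _ _) _; apply: lerD; last exact: lP.
apply: le_trans (ler_normD _ _) _; apply: lerD; first exact: sum_bound.
apply: (close k (lact g (u k)) (u k)) => //; first exact: affine_inv.
exact: le_trans (finv _ _) (fu k).
Qed.
End Averaging.

Lemma sum_pair (V : nmodType) (I J : finType) (F : I * J -> V) :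
  \sum_p F p = \sum_i \sum_j F (i, j).
Proof. by rewrite pair_bigA; apply: eq_bigr => -[]. Qed.

(** * The tensor square as a space of matrices *)

Section BilinearExtension.
Variables (R : realType) (n : nat).
Local Notation E := 'rV[R]_n.
Local Notation "'b_ i" := (delta_mx ord0 i : E) (at level 0, i at level 2).

Definition bilinear_fun (W : lmodType R) (beta : E -> E -> W) : Prop :=
  (forall y, linear (fun x => beta x y)) /\ (forall x, linear (beta x)).

(** The linear map on E (x) E induced by a bilinear map. A matrix stands for the tensor with these
    coordinates, and [tens a b] for a (x) b. *)
Definition ext (W : lmodType R) (beta : E -> E -> W) (T : 'M[R]_n) : W :=
  \sum_i \sum_j T i j *: beta 'b_i 'b_j.

Definition tens (a b : E) : 'M[R]_n := \matrix_(i, j) (a ord0 i * b ord0 j).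

Lemma ext_linear (W : lmodType R) (beta : E -> E -> W) : linear (ext beta).
Proof.
move=> a T S; rewrite /ext scaler_sumr -big_split; apply: eq_bigr => i _ /=.
rewrite scaler_sumr -big_split; apply: eq_bigr => j _ /=.
by rewrite !mxE scalerDl scalerA.
Qed.

Lemma lin_sumZ (W : lmodType R) (f : E -> W) (x : E) :
  linear f -> f x = \sum_i x ord0 i *: f 'b_i.
Proof.
move=> lf; pose f' : {linear E -> W} := HB.pack f (GRing.isLinear.Build R E W *:%R f lf).
rewrite -[LHS]/(f' x) {1}[x]row_sum_delta linear_sum; apply: eq_bigr => i _.
by rewrite linearZ.
Qed.

Lemma tens_bilinear : bilinear_fun tens.
Proof.
by split => y a u v; apply/matrixP => i j; rewrite !mxE; ring.
Qed.

Lemma ext_tens (W : lmodType R) (beta : E -> E -> W) a b :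
  bilinear_fun beta -> ext beta (tens a b) = beta a b.
Proof.
move=> [bl br]; rewrite (lin_sumZ a (bl b)); apply: eq_bigr => i _.
rewrite (lin_sumZ b (br _)) scaler_sumr; apply: eq_bigr => j _.
by rewrite mxE scalerA.
Qed.

Lemma ext_comp (W X : lmodType R) (L : W -> X) (beta : E -> E -> W) T : linear L ->
  L (ext beta T) = ext (fun a b => L (beta a b)) T.
Proof.
move=> lL; pose L' : {linear W -> X} := HB.pack L (GRing.isLinear.Build R W X *:%R L lL).
rewrite -[LHS]/(L' _) linear_sum; apply: eq_bigr => i _.
by rewrite linear_sum; apply: eq_bigr => j _; rewrite linearZ.
Qed.

Lemma ext_eq (W : lmodType R) (beta gamma : E -> E -> W) T :
  (forall a b, beta a b = gamma a b) -> ext beta T = ext gamma T.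
Proof. by move=> H; apply: eq_bigr => i _; apply: eq_bigr => j _; rewrite H. Qed.

Lemma ext_tens_id T : ext tens T = T.
Proof.
apply/matrixP => i j; rewrite /ext summxE (bigD1 i)//= [X in _ + X]big1 ?addr0.
  rewrite summxE (bigD1 j)//= [X in _ + X]big1 ?addr0; first by rewrite !mxE !eqxx !mulr1.
  by move=> k kj; rewrite !mxE eqxx (eq_sym j) (negbTE kj) !mulr0.
move=> k ki; rewrite summxE big1// => l _.
by rewrite !mxE eqxx (eq_sym i) (negbTE ki) mul0r mulr0.
Qed.

Lemma bilinear_comp (W : lmodType R) (beta : E -> E -> W) (f : E -> E) :
  bilinear_fun beta -> linear f -> bilinear_fun (fun a b => beta (f a) (f b)).
Proof. by move=> [bl br] lf; split => y a u v; rewrite lf ?bl ?br. Qed.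
End BilinearExtension.

(** * The fixed point among the sections of the bracket *)

Section EquivariantSection.
Variables (R : realType) (G : lieGroup R).
Local Notation e := (lone G).
Local Notation n := (mdim G).
Local Notation E := 'rV[R]_n.
Local Notation "'b_ i" := (delta_mx ord0 i : E) (at level 0, i at level 2).

Definition Ad2 (g : G) : 'M[R]_n -> 'M[R]_n := ext (fun a b => tens (Ad g a) (Ad g b)).

Lemma ext_Ad2 (W : lmodType R) (beta : E -> E -> W) g T : bilinear_fun beta ->
  ext beta (Ad2 g T) = ext (fun a b => beta (Ad g a) (Ad g b)) T.
Proof.
move=> bb; rewrite /Ad2 (ext_comp _ _ (ext_linear beta)).
by apply: ext_eq => a b; rewrite ext_tens.
Qed.

Lemma Ad2_mul g h T : Ad2 (lmul g h) T = Ad2 g (Ad2 h T).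
Proof.
rewrite {2}/Ad2 (ext_Ad2 h T (bilinear_comp (tens_bilinear R n) (Ad_linear g))).
by apply: ext_eq => a b; rewrite !Ad_mul.
Qed.

Lemma Ad2_one T : Ad2 e T = T.
Proof. by rewrite -[RHS]ext_tens_id; apply: ext_eq => a b; rewrite !Ad_one. Qed.

Lemma lbracket_bilinear : bilinear_fun (@lbracket R G : E -> E -> E).
Proof. by split; [exact: lbracket_linearl|exact: lbracket_linearr]. Qed.

Local Notation I := ('I_n * ('I_n * 'I_n))%type.

(** The linear map g -> g (x) g with coordinates v; plain coordinate vectors are what
    [affine_fixed_point] acts on. *)
Definition tens3 (v : I -> R) (x : E) : 'M[R]_n :=
  \sum_k x ord0 k *: \matrix_(i, j) v (k, (i, j)).

Lemma tens3_linear v : linear (tens3 v).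
Proof.
move=> a x y; rewrite /tens3 scaler_sumr -big_split; apply: eq_bigr => k _ /=.
by rewrite !mxE scalerDl scalerA.
Qed.

Lemma tens3_basis v k : tens3 v 'b_k = \matrix_(i, j) v (k, (i, j)).
Proof.
rewrite /tens3 (bigD1 k)//= [X in _ + X]big1 ?addr0; first by rewrite mxE !eqxx scale1r.
by move=> l lk; rewrite mxE (negbTE lk) andbF scale0r.
Qed.

(** The matrix of the action of g on Hom(g, g (x) g), sending T to Ad2 g T Ad g^-1
    ([tens3_lact]). *)
Definition tens3_act (g : G) (p q : I) : R :=
  Ad (linv g) 'b_(p.1) ord0 q.1 *
  (Ad g 'b_(q.2.1) ord0 p.2.1 * Ad g 'b_(q.2.2) ord0 p.2.2).

Lemma tens3_lact g v x : tens3 (lact tens3_act g v) x = Ad2 g (tens3 v (Ad (linv g) x)).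
Proof.
have l1 : linear (fun x => Ad2 g (tens3 v (Ad (linv g) x))).
  by move=> a y z; rewrite Ad_linear tens3_linear /Ad2 ext_linear.
rewrite [RHS](lin_sumZ x l1) /=; apply: eq_bigr => k _; congr (_ *: _).
apply/matrixP => i j; rewrite mxE /lact.
rewrite sum_pair.
rewrite {1}/tens3 /Ad2 (linear_fun_sum (f := ext _)); last exact: ext_linear.
rewrite summxE; apply: eq_bigr => k' _.
rewrite (linear_funZ (f := ext _)); last exact: ext_linear.
rewrite mxE /ext summxE mulr_sumr.
rewrite sum_pair.
apply: eq_bigr => i' _; rewrite summxE mulr_sumr; apply: eq_bigr => j' _.
by rewrite !mxE /tens3_act /=; ring.
Qed.

Lemma tens3_ext v w : (forall x, tens3 v x = tens3 w x) -> v = w.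
Proof.
move=> H; apply/funext => -[k [i j]].
by have := H 'b_k; rewrite !tens3_basis => /matrixP/(_ i j); rewrite !mxE.
Qed.

(** Equation m = (k, l) reads off the l-th coordinate of the bracket of the image of the k-th basis
    vector; a section has the value 1 if k = l and 0 otherwise. *)
Definition section_coef (m : 'I_n * 'I_n) (p : I) : R :=
  (m.1 == p.1)%:R * lbracket 'b_(p.2.1) 'b_(p.2.2) ord0 m.2.

Lemma section_coefE v m :
  \sum_p section_coef m p * v p = ext (@lbracket R G) (tens3 v 'b_(m.1)) ord0 m.2.
Proof.
case: m => k l; rewrite sum_pair.
rewrite (bigD1 k)//= [X in _ + X]big1 ?addr0; last first.
  by move=> k' k'k; rewrite big1// => ij _; rewrite /section_coef /= (eq_sym k) (negbTE k'k) !mul0r.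
rewrite tens3_basis /ext summxE.
rewrite sum_pair.
apply: eq_bigr => i _; rewrite summxE; apply: eq_bigr => j _.
rewrite /section_coef /= eqxx mul1r mulrC [RHS]mxE; congr (_ * _).
by rewrite mxE.
Qed.

Lemma affine_sectionP v : affine section_coef (fun m => (m.1 == m.2)%:R) v <->
  forall x, ext (@lbracket R G) (tens3 v x) = x.
Proof.
split=> [H x|H [k l]]; last by rewrite section_coefE H mxE eqxx (eq_sym k).
have l1 : linear (fun x => ext (@lbracket R G) (tens3 v x) : E).
  by move=> a y z; rewrite tens3_linear ext_linear.
rewrite (lin_sumZ x l1) [RHS]row_sum_delta; apply: eq_bigr => k _; congr (_ *: _).
by apply/rowP => l; have := H (k, l); rewrite section_coefE /= => ->; rewrite mxE eqxx eq_sym.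
Qed.

(** Sections exist because each basis vector is a combination of brackets, and G permutes them
    because Ad preserves the bracket. A fixed section is precisely an equivariant one. *)
Lemma equivariant_section : compact [set: G] -> derived_algebra G = [set: lieAlg G] ->
  exists sigma : E -> 'M[R]_n, [/\ linear sigma,
    forall x, ext (@lbracket R G) (sigma x) = x
  & forall g x, sigma (Ad g x) = Ad2 g (sigma x)].
Proof.
move=> cG pG; have [C C0 CP] := Ad_bounded cG.
have MB g p q : `|tens3_act g p q| <= C * (C * C).
  have b h k l : `|Ad h 'b_k ord0 l| <= C.
    apply: le_trans (rV_coord_norm _ _) _; apply: le_trans (CP _ _) _.
    rewrite ler_piMr ?(ltW C0)//; apply: rV_norm_le => // i; rewrite mxE eqxx /=.
    by case: (_ == _); rewrite ?normr1 ?normr0.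
  by rewrite /tens3_act !normrM !ler_pM ?mulr_ge0//; exact: b.
have act1 v : lact tens3_act e v = v.
  apply: tens3_ext => x; rewrite tens3_lact Ad2_one.
  by rewrite (linv_unique (lmul1g e)) Ad_one.
have actM g h v : lact tens3_act (lmul g h) v = lact tens3_act g (lact tens3_act h v).
  by apply: tens3_ext => x; rewrite !tens3_lact Ad2_mul linvM Ad_mul.
have actV g v : lact tens3_act (linv g) (lact tens3_act g v) = v.
  by rewrite -actM lmulVg act1.
have inv g v : affine section_coef (fun m => (m.1 == m.2)%:R) v ->
    affine section_coef (fun m => (m.1 == m.2)%:R) (lact tens3_act g v).
  move=> /affine_sectionP H; apply/affine_sectionP => x; rewrite tens3_lact.
  rewrite (ext_Ad2 _ _ lbracket_bilinear).
  rewrite -[RHS](AdVK g) -{2}[Ad (linv g) x]H (ext_comp _ _ (Ad_linear g)).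
  by apply: ext_eq => a b; rewrite Ad_lbracket.
have ex k : {T : 'M[R]_n | ext (@lbracket R G) T = 'b_k}.
  apply: cid; have : derived_algebra G 'b_k by rewrite pG.
  case=> s ->; exists (\sum_(t <- s) t.1 *: tens t.2.1 t.2.2).
  rewrite (linear_fun_sum (f := ext _)); last exact: ext_linear.
  apply: eq_bigr => t _; rewrite (linear_funZ (f := ext _)); last exact: ext_linear.
  by rewrite ext_tens//; exact: lbracket_bilinear.
have nonempty : exists v, affine section_coef (fun m => (m.1 == m.2)%:R) v.
  exists (fun p => sval (ex p.1) p.2.1 p.2.2); case=> k l; rewrite section_coefE tens3_basis /=.
  have -> : \matrix_(i, j) sval (ex k) i j = sval (ex k) by apply/matrixP => i j; rewrite mxE.
  by case: (ex k) => T /= ->; rewrite mxE eqxx (eq_sym k).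
have [v /affine_sectionP vP fixv] := affine_fixed_point MB e actM actV inv nonempty.
exists (tens3 v); split; [exact: tens3_linear|exact: vP|move=> g x].
by rewrite -{1}(fixv g) tens3_lact AdK.
Qed.
End EquivariantSection.

(** * Cartan calculus *)

Section FormCalculus.
Variables (R : realType) (P : manifold R).
Local Notation E := 'rV[R]_(mdim P).
Implicit Types (al be : diff_form P) (p : P) (s : seq E).

Lemma form_loc_at al p s : form_loc (chart_at P p) al (phi (chart_at P p) p) s = al p s.
Proof.
have cp := chart_around_at p; rewrite /form_loc psi_phi//; congr (al p _).
rewrite -[RHS]map_id; apply: eq_map => u /=.
by rewrite of_chartE// loc_diff_id.
Qed.

Lemma is_form_lin a al be : is_form al -> is_form be -> is_form (a *: al + be).
Proof.
move=> [m1 a1 s1] [m2 a2 s2]; split.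
- move=> p l1 l2 b u v.
  rewrite -[LHS]/(a *: al p _ + be p _) m1 m2 -[RHS]/(b *: (a *: al p _ + be p _) + (a *: al p _ + be p _)).
  by rewrite !scalerDr !addrA; congr (_ + _); rewrite addrAC !scalerA mulrC.
- move=> p l1 l2 l3 u.
  by rewrite -[LHS]/(a *: al p _ + be p _) a1 a2 scaler0 addr0.
move=> c s ac; apply: smooth_at_on => z iz.
have nz : nbhs z (img c) by have [p cp ->] := img_ex ac iz; exact: near_img.
apply: smooth_at_add; last exact: smooth_on_nbhs nz (s2 c s ac).
by apply: smooth_at_scale; [exact: smooth_at_cst|exact: smooth_on_nbhs nz (s1 c s ac)].
Qed.

Lemma Omega_lin k a al be : Omega P k al -> Omega P k be -> Omega P k (a *: al + be).
Proof.
move=> [f1 z1] [f2 z2]; split; first exact: is_form_lin.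
by move=> p s sk; rewrite -[LHS]/(a *: al p s + be p s) z1// z2// scaler0 addr0.
Qed.

Lemma Omega0 k : Omega P k 0.
Proof.
split=> //; split.
- by move=> p l1 l2 b u v; rewrite -[RHS]/(b *: (0 : R^o) + 0) scaler0 addr0.
- by [].
- by move=> c s ac; apply: smooth_at_on => z _; exact: smooth_at_cst.
Qed.

Lemma Omega_sum k n (a : 'I_n -> R) (al : 'I_n -> diff_form P) :
  (forall i, Omega P k (al i)) -> Omega P k (\sum_i a i *: al i).
Proof.
move=> H; elim/big_ind: _ => [|f g Hf Hg|i _]; first exact: Omega0.
  by rewrite -[f]scale1r; exact: Omega_lin.
by rewrite -[_ *: _]addr0; apply: Omega_lin => //; exact: Omega0.
Qed.

Lemma Omega_form k al : Omega P k al -> is_form al.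
Proof. by case. Qed.

Lemma form_loc_smooth al p s : is_form al ->
  smooth_at (fun x => form_loc (chart_at P p) al x s) (phi (chart_at P p) p).
Proof. by move=> fal; have [_] := form_smooth_family fal (chart_around_at p); exact. Qed.

Lemma dform_lin a al be : is_form al -> is_form be ->
  dform (a *: al + be) = a *: dform al + dform be.
Proof.
move=> fa fb; apply/funext => p; apply/funext => s; rewrite -[RHS]/(a *: dform al p s + dform be p s) /dform scaler_sumr -big_split.
apply: eq_bigr => i _ /=; set l := take i s ++ _.
have D1 := smooth_at_is_derive (nth 0 s i) (form_loc_smooth p l fa).
have D2 := smooth_at_is_derive (nth 0 s i) (form_loc_smooth p l fb).
have D4 := is_deriveZ a D1.
have [_ D3] := is_deriveD D4 D2.
rewrite -[X in derive X _ _]/((a \*: (fun x => form_loc (chart_at P p) al x l)) +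
  (fun x => form_loc (chart_at P p) be x l)) D3.
by rewrite scalerDr !scalerA mulrC.
Qed.

Lemma dform0 : dform (0 : diff_form P) = 0.
Proof.
have f0 := Omega_form (Omega0 0).
by have := dform_lin (-1) f0 f0; rewrite !scaleN1r oppr0 addr0 addNr.
Qed.

Lemma dform_sum k n (a : 'I_n -> R) (al : 'I_n -> diff_form P) :
  (forall i, Omega P k (al i)) -> dform (\sum_i a i *: al i) = \sum_i a i *: dform (al i).
Proof.
move=> H; suff [] : dform (\sum_i a i *: al i) = \sum_i a i *: dform (al i) /\ Omega P k (\sum_i a i *: al i) by [].
elim/big_rec2: _ => [|i f g _ [<- Hg]]; first by split; [exact: dform0|exact: Omega0].
by split; [rewrite dform_lin//; [exact: Omega_form (H i)|exact: Omega_form Hg]|exact: Omega_lin].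
Qed.

Lemma dform_degree k al p s : Omega P k al -> size s != k.+1 -> dform al p s = 0.
Proof.
move=> [_ z] sk; rewrite /dform big1// => i _.
rewrite (_ : (fun x => _) = cst 0) ?derive_cst ?scaler0//.
apply/funext => x; rewrite /form_loc z// size_map size_cat size_takel; last by rewrite ltnW.
rewrite size_drop; apply: contra sk => /eqP <-.
by rewrite -addnS -subSn// subSS subnKC// ltnW.
Qed.

Lemma form_swap al p l1 l2 u v : is_form al ->
  al p (l1 ++ u :: v :: l2) = - al p (l1 ++ v :: u :: l2).
Proof.
move=> [ml alt _]; have H := alt p l1 [::] l2 (u + v).
have add1 l l' x y : al p (l ++ (x + y) :: l') = al p (l ++ x :: l') + al p (l ++ y :: l').
  by rewrite -[x]scale1r ml !scale1r.
have add2 x : al p (l1 ++ x :: (u + v) :: l2) = al p (l1 ++ x :: u :: l2) + al p (l1 ++ x :: v :: l2).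
  by have := add1 (rcons l1 x) l2 u v; rewrite !cat_rcons.
move: H; rewrite /= add1 !add2.
have := alt p l1 [::] l2 u; have := alt p l1 [::] l2 v; rewrite /= => -> ->.
by rewrite add0r addr0 => /eqP; rewrite addr_eq0 => /eqP.
Qed.

Lemma form_linear al p l1 l2 : is_form al -> linear (fun u => al p (l1 ++ u :: l2)).
Proof. by move=> [ml _ _] a u v; exact: ml. Qed.

Lemma derive_loc1 (a : E -> seq E -> R^o) (X : E -> E) z u l :
  smooth_family a z -> smooth_at X z ->
  'D_u (fun y => a y (X y :: l)) z = 'D_u (fun y => a y (X z :: l)) z + a z ('D_u X z :: l).
Proof.
move=> fa sX.
have sL i : smooth_at (nth (fun=> 0) [:: X] i) z.
  case: i => [|i]; first exact: sX.
  by rewrite /= nth_nil; exact: smooth_at_cst.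
have [_ /(_ u)] := multilinear_family_derive_cat [::] l (smooth_at_id z) fa sL.
by rewrite big_ord1 /= derive_id.
Qed.

Lemma smooth_loc1 (a : E -> seq E -> R^o) (X : E -> E) z l :
  smooth_family a z -> smooth_at X z -> smooth_at (fun y => a y (X y :: l)) z.
Proof.
move=> fa sX.
have sL i : smooth_at (nth (fun=> 0) [:: X] i) z.
  case: i => [|i]; first exact: sX.
  by rewrite /= nth_nil; exact: smooth_at_cst.
by have [] := multilinear_family_derive_cat [::] l (smooth_at_id z) fa sL.
Qed.

Lemma derive_loc2 (a : E -> seq E -> R^o) (X Y : E -> E) z u l :
  smooth_family a z -> smooth_at X z -> smooth_at Y z ->
  'D_u (fun y => a y (X y :: Y y :: l)) z = 'D_u (fun y => a y (X z :: Y z :: l)) z +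
     (a z ('D_u X z :: Y z :: l) + a z (X z :: 'D_u Y z :: l)).
Proof.
move=> fa sX sY.
have sL i : smooth_at (nth (fun=> 0) [:: X; Y] i) z.
  case: i => [|[|i]]; [exact: sX|exact: sY|].
  by rewrite /= nth_nil; exact: smooth_at_cst.
have [_ /(_ u)] := multilinear_family_derive_cat [::] l (smooth_at_id z) fa sL.
by rewrite !big_ord_recl big_ord0 addr0 /= derive_id.
Qed.
End FormCalculus.

(** * Lie derivatives along fundamental fields *)

Section FundamentalCalculus.
Variables (R : realType) (G : lieGroup R) (P : manifold R) (act : G -> P -> P).
Hypothesis actP : is_action act.
Local Notation EG := 'rV[R]_(mdim G).
Local Notation EP := 'rV[R]_(mdim P).
Implicit Types (al : diff_form P) (p : P) (s : seq EP) (x y : EG).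
Local Notation v := (fund_field act).

Definition locv (c : chart R (mdim P) P) x (z : EP) : EP := - locfund act c x z.

Lemma locv_to_chart c x p : chart_around c p -> to_chart c p (v x p) = locv c x (phi c p).
Proof. by move=> cp; rewrite to_chart_fund//; case: cp. Qed.

Lemma locv_at x p : locv (chart_at P p) x (phi (chart_at P p) p) = v x p.
Proof.
have cp := chart_around_at p.
by rewrite -locv_to_chart// to_chartE loc_diff_id.
Qed.

Lemma locv_smooth c x z : atlas P c -> img c z -> smooth_at (locv c x) z.
Proof. by move=> ac iz; apply: smooth_at_opp; exact: locfund_smooth. Qed.

Lemma derive_opp_opp (f : EP -> EP) z u : smooth_at f z ->
  'D_(- u) (fun t : EP => - f t) z = 'D_u f z.
Proof.
move=> sf; rewrite (derive_dirN _ (smooth_at_opp sf)).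
have [_ ->] := is_deriveN (smooth_at_is_derive u sf).
by rewrite opprK.
Qed.

Lemma locv_bracket c x y z : atlas P c -> img c z ->
  (locv c (lbracket x y) z : EP) = 'D_(locv c x z) (locv c y) z - 'D_(locv c y z) (locv c x) z.
Proof.
move=> ac iz.
have Dd a b : ('D_(locv c a z) (locv c b) z : EP) = 'D_(locfund act c a z) (locfund act c b) z.
  by apply: derive_opp_opp; exact: locfund_smooth.
have aux (r a b : EP) : r = a - b -> - r = b - a by move=> ->; rewrite opprB.
have := locfund_bracket actP ac x y iz; rewrite -lbracketE => H.
exact (etrans (aux _ _ _ H) (esym (congr2 (fun a b : EP => a - b) (Dd x y) (Dd y x)))).
Qed.

Lemma contract_loc al c x z s : atlas P c -> img c z ->
  form_loc c (Defs.contract (v x) al) z s = form_loc c al z (locv c x z :: s).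
Proof.
move=> ac iz; have [p cp ->] := img_ex ac iz.
by rewrite form_loc_contract// locv_to_chart.
Qed.

Lemma Omega_contract k al x : Omega P k.+1 al -> Omega P k (Defs.contract (v x) al).
Proof.
move=> [fal z]; have [ml alt sm] := fal; split; last by move=> p s sk; rewrite /Defs.contract z.
split.
- by move=> p l1 l2 a u w; exact: (ml p (v x p :: l1)).
- by move=> p l1 l2 l3 u; exact: (alt p (v x p :: l1)).
move=> c s ac; apply: smooth_at_on => y iy.
have ny : nbhs y (img c) by have [p cp ->] := img_ex ac iy; exact: near_img.
have fam : smooth_family (form_loc c al) y.
  by have [p cp ->] := img_ex ac iy; exact: form_smooth_family.
apply: smooth_at_eq (smooth_loc1 s fam (locv_smooth x ac iy)).
by apply: filterS ny => t it; rewrite contract_loc.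
Qed.

Lemma contract0 al x : Omega P 0 al -> Defs.contract (v x) al = 0.
Proof. by move=> [_ z]; apply/funext => p; apply/funext => s; rewrite /Defs.contract z. Qed.

Lemma locv_linear c z : atlas P c -> img c z -> linear (fun x => locv c x z).
Proof.
move=> ac iz a x y; rewrite /locv (locfund_linear actP ac iz).
by rewrite opprD scalerN.
Qed.

Lemma fund_field_linear p : linear (fun x => v x p).
Proof.
move=> a x y; rewrite -!locv_at; apply: locv_linear; first exact: atlas_chart_at.
exact/img_phi/dom_chart_at.
Qed.

Lemma form_set_nthN al p s (i : 'I_(size s)) w : is_form al ->
  al p (set_nth 0 s i (- w)) = - al p (set_nth 0 s i w).
Proof.
move=> fal; have E u : set_nth 0 s i u = take i s ++ u :: drop i.+1 s.
  by rewrite set_nthE ltn_ord.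
by rewrite !E (linear_funN (form_linear p (take i s) (drop i.+1 s) fal)).
Qed.

(** [infinitesimal_invariance] in the preferred chart. Replacing the generator by its opposite v_x
    moves the Lie derivative to the other side of the equation. *)
Lemma lie_derivative_cochain (k : nat) (C : 'I_k -> G -> R^o) (al : 'I_k -> diff_form P) p x s :
  let c := chart_at P p in let z := phi c p in
  let c1 := chart_at G (lone G) in let e0 := phi c1 (lone G) in
  (forall j, is_form (al j)) -> (forall j, smooth_at (C j \o psi c1) e0) ->
  (forall g, \sum_j C j g *: pullback (act g) (al j) p = \sum_j C j (lone G) *: al j p) ->
  \sum_j 'D_x (C j \o psi c1) e0 *: al j p s =
  \sum_j C j (lone G) *: ('D_(v x p) (fun t => form_loc c (al j) t s) z +
    \sum_(i < size s) al j p (set_nth 0 s i ('D_(nth 0 s i) (locv c x) z))).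
Proof.
move=> c z c1 e0 fal sC inv; have cp := chart_around_at p.
have iz : img c z := img_phi cp.2.
have := infinitesimal_invariance actP cp.1 x s fal sC cp inv.
move/eqP; rewrite addr_eq0 => /eqP H.
transitivity (\sum_j 'D_x (C j \o psi c1) e0 *: form_loc c (al j) z s).
  by apply: eq_bigr => j _; rewrite form_loc_at.
rewrite H -sumrN; apply: eq_bigr => j _; rewrite -scalerN; congr (_ *: _).
rewrite -locv_at opprD (derive_dirN _ (form_loc_smooth p s (fal j))); congr (_ + _).
rewrite -sumrN; apply: eq_bigr => i _; rewrite form_loc_at -form_set_nthN//.
congr (al j p (set_nth 0 s i _)).
by have [_ ->] := is_deriveN (smooth_at_is_derive (nth 0 s i) (locfund_smooth actP cp.1 x iz)).
Qed.

(** The left side is the coordinate expression of the Lie derivative along v_x, on arguments s with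
    constant coordinates; the case of one constant coefficient. *)
Lemma lie_derivative_invariant al p x s : is_form al -> invariant_form act al ->
  let c := chart_at P p in let z := phi c p in
  'D_(v x p) (fun t => form_loc c al t s) z +
  \sum_(i < size s) al p (set_nth 0 s i ('D_(nth 0 s i) (locv c x) z)) = 0.
Proof.
move=> fal inv c z.
have sC (j : 'I_1) : smooth_at ((fun=> 1 : R^o) \o psi (chart_at G (lone G))) (phi (chart_at G (lone G)) (lone G)).
  exact: smooth_at_cst.
have Hi g : \sum_(j < 1) (1 : R^o) *: pullback (act g) al p = \sum_(j < 1) (1 : R^o) *: al p.
  by rewrite (inv g).
have := @lie_derivative_cochain 1 (fun _ _ => 1) (fun=> al) p x s (fun=> fal) sC Hi.
rewrite !big_ord1 scale1r => <-.
by rewrite derive_cst scale0r.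
Qed.
End FundamentalCalculus.

Section LinearArithmetic.
Variable R : realType.

(** The scalar content of [cartan3_at]. L1 - L2 is d iota_b iota_a al on (u, w), B the contraction
    with the bracket field, P and T the four terms of d al; the small letters are values of al with
    a derivative of v_a or v_b in one slot. Naming all of them lets [lra] decide. *)
Lemma cartan3_arith (L1 L2 B P1 q1 q2 P2 q3 q4 T1 r1 r2 r3 T2 s1 s3 m : R) :
  L1 = P1 + (q1 + q2) -> L2 = P2 + (q3 + q4) -> B = s1 - r1 ->
  T1 + (r1 + (r2 + r3)) = 0 -> T2 + (s1 + (q2 + s3)) = 0 ->
  q1 = - r2 -> q3 = - m -> m = - r3 -> q4 = - s3 ->
  L1 - L2 = - B + (T1 + (- T2 + (P1 - P2))).
Proof. by lra. Qed.

Lemma cartan2_arith (L1 B P1 q1 q2 T1 r1 r2 T2 s1 : R) :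
  L1 = P1 + (q1 + q2) -> B = s1 - r1 ->
  T1 + (r1 + r2) = 0 -> T2 + (s1 + q2) = 0 -> q1 = - r2 ->
  L1 = - B + (T1 + (- T2 + P1)).
Proof. by lra. Qed.

Lemma cochain1_arith (M D A B c q r : R) :
  M = A + c -> D = B + c -> A - B = - r -> r = - q -> M = D + q.
Proof. by lra. Qed.

Lemma dform_cochain1_arith (L M K A B c : R) :
  L = A + B -> M = A + c -> K = B - c -> L = M + K.
Proof. by lra. Qed.
End LinearArithmetic.

Section LowDegreeDifferential.
Variables (R : realType) (P : manifold R).
Local Notation E := 'rV[R]_(mdim P).
Implicit Types (al : diff_form P) (p : P) (u w x y : E).
Local Notation "'c_ p" := (chart_at P p) (at level 0, p at level 2).
Local Notation "'z_ p" := (phi (chart_at P p) p) (at level 0, p at level 2).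

(** Indexing the summand by a natural number lets short sums be expanded term by term. *)
Definition dform_term al p (s : seq E) (i : nat) : R^o :=
  (-1) ^+ i *: 'D_(nth 0 s i) (fun t => form_loc 'c_p al t (take i s ++ drop i.+1 s)) 'z_p.

Lemma sign0 (A : R^o) : (-1) ^+ 0 *: A = A. Proof. exact: scale1r. Qed.
Lemma sign1 (A : R^o) : (-1) ^+ 1 *: A = - A. Proof. exact: scaleN1r. Qed.
Lemma sign2 (A : R^o) : (-1) ^+ 2 *: A = A. Proof. by rewrite -signr_odd scale1r. Qed.
Lemma sign3 (A : R^o) : (-1) ^+ 3 *: A = - A. Proof. by rewrite -signr_odd scaleN1r. Qed.

Lemma dform1 al p u : dform al p [:: u] = 'D_u (fun t => form_loc 'c_p al t [::]) 'z_p :> R^o.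
Proof. by rewrite /dform big_ord1; exact: sign0. Qed.

Lemma dform2 al p u w : dform al p [:: u; w] =
  'D_u (fun t => form_loc 'c_p al t [:: w]) 'z_p -
  'D_w (fun t => form_loc 'c_p al t [:: u]) 'z_p :> R^o.
Proof.
have S (F : nat -> R^o) : \sum_(i < 2) F i = F 0%N + F 1%N by rewrite !big_ord_recl big_ord0 addr0.
exact (etrans (S (dform_term al p [:: u; w]))
  (congr2 (fun a b : R^o => a + b) (sign0 _) (sign1 _))).
Qed.

Lemma dform3 al p x y u : dform al p [:: x; y; u] =
  'D_x (fun t => form_loc 'c_p al t [:: y; u]) 'z_p +
  (- 'D_y (fun t => form_loc 'c_p al t [:: x; u]) 'z_p +
  'D_u (fun t => form_loc 'c_p al t [:: x; y]) 'z_p) :> R^o.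
Proof.
have S (F : nat -> R^o) : \sum_(i < 3) F i = F 0%N + (F 1%N + F 2%N).
  by rewrite !big_ord_recl big_ord0 addr0.
exact (etrans (S (dform_term al p [:: x; y; u]))
  (congr2 (fun a b : R^o => a + b) (sign0 _)
    (congr2 (fun a b : R^o => a + b) (sign1 _) (sign2 _)))).
Qed.

Lemma dform4 al p x y u w : dform al p [:: x; y; u; w] =
  'D_x (fun t => form_loc 'c_p al t [:: y; u; w]) 'z_p +
  (- 'D_y (fun t => form_loc 'c_p al t [:: x; u; w]) 'z_p +
  ('D_u (fun t => form_loc 'c_p al t [:: x; y; w]) 'z_p -
  'D_w (fun t => form_loc 'c_p al t [:: x; y; u]) 'z_p)) :> R^o.
Proof.
have S (F : nat -> R^o) : \sum_(i < 4) F i = F 0%N + (F 1%N + (F 2%N + F 3%N)).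
  by rewrite !big_ord_recl big_ord0 addr0.
exact (etrans (S (dform_term al p [:: x; y; u; w]))
  (congr2 (fun a b : R^o => a + b) (sign0 _)
    (congr2 (fun a b : R^o => a + b) (sign1 _)
      (congr2 (fun a b : R^o => a + b) (sign2 _) (sign3 _))))).
Qed.
End LowDegreeDifferential.

(** * Cartan's formulas for invariant forms and equivariant cochains *)

Section CartanIdentities.
Variables (R : realType) (G : lieGroup R) (P : manifold R) (act : G -> P -> P).
Hypothesis actP : is_action act.
Local Notation EG := 'rV[R]_(mdim G).
Local Notation EP := 'rV[R]_(mdim P).
Local Notation v := (fund_field act).
Local Notation "'c_ p" := (chart_at P p) (at level 0, p at level 2).
Local Notation "'z_ p" := (phi (chart_at P p) p) (at level 0, p at level 2).
Implicit Types (al : diff_form P) (p : P) (s : seq EP) (a b x y z : EG) (u w : EP).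

Lemma near_contract2 al a b p s : \forall t \near 'z_p,
  form_loc 'c_p (Defs.contract (v b) (Defs.contract (v a) al)) t s =
  form_loc 'c_p al t (locv act 'c_p a t :: locv act 'c_p b t :: s).
Proof.
have cp := chart_around_at p; apply: filterS (near_img cp) => t it.
by rewrite !(contract_loc actP _ _ _ cp.1 it).
Qed.

Lemma near_contract1 al a p s : \forall t \near 'z_p,
  form_loc 'c_p (Defs.contract (v a) al) t s = form_loc 'c_p al t (locv act 'c_p a t :: s).
Proof.
have cp := chart_around_at p; apply: filterS (near_img cp) => t it.
by rewrite (contract_loc actP _ _ _ cp.1 it).
Qed.

Lemma derive_contract2 al a b p s u : is_form al ->
  'D_u (fun t => form_loc 'c_p (Defs.contract (v b) (Defs.contract (v a) al)) t s) 'z_p =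
  'D_u (fun t => form_loc 'c_p al t (v a p :: v b p :: s)) 'z_p +
  (al p ('D_u (locv act 'c_p a) 'z_p :: v b p :: s) +
   al p (v a p :: 'D_u (locv act 'c_p b) 'z_p :: s)).
Proof.
move=> fal; have cp := chart_around_at p; have iz := img_phi cp.2.
have sX := locv_smooth actP a cp.1 iz; have sY := locv_smooth actP b cp.1 iz.
rewrite (near_eq_derive u (near_contract2 al a b p s)).
rewrite (derive_loc2 u s (form_smooth_family fal cp) sX sY).
by rewrite !form_loc_at !(locv_at actP).
Qed.

Lemma derive_contract1 al a p s u : is_form al ->
  'D_u (fun t => form_loc 'c_p (Defs.contract (v a) al) t s) 'z_p =
  'D_u (fun t => form_loc 'c_p al t (v a p :: s)) 'z_p +
  al p ('D_u (locv act 'c_p a) 'z_p :: s).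
Proof.
move=> fal; have cp := chart_around_at p; have iz := img_phi cp.2.
have sX := locv_smooth actP a cp.1 iz.
rewrite (near_eq_derive u (near_contract1 al a p s)).
rewrite (derive_loc1 u s (form_smooth_family fal cp) sX).
by rewrite form_loc_at (locv_at actP).
Qed.

Lemma form_bracket al a b p s : is_form al ->
  al p (v (lbracket a b) p :: s) =
  al p ('D_(v a p) (locv act 'c_p b) 'z_p :: s) - al p ('D_(v b p) (locv act 'c_p a) 'z_p :: s).
Proof.
move=> fal; have cp := chart_around_at p; have iz := img_phi cp.2.
have E : (v (lbracket a b) p : EP) =
    'D_(v a p) (locv act 'c_p b) 'z_p - 'D_(v b p) (locv act 'c_p a) 'z_p.
  by have := locv_bracket actP a b cp.1 iz; rewrite !(locv_at actP).
rewrite E; exact: (linear_funB (form_linear p [::] s fal)).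
Qed.

Definition lie_term al a p s (i : nat) : R^o :=
  al p (set_nth 0 s i ('D_(nth 0 s i) (locv act 'c_p a) 'z_p)).

Lemma lie3 al a p u1 u2 u3 : is_form al -> invariant_form act al ->
  'D_(v a p) (fun t => form_loc 'c_p al t [:: u1; u2; u3]) 'z_p +
  (al p [:: 'D_u1 (locv act 'c_p a) 'z_p; u2; u3] +
  (al p [:: u1; 'D_u2 (locv act 'c_p a) 'z_p; u3] +
   al p [:: u1; u2; 'D_u3 (locv act 'c_p a) 'z_p])) = 0.
Proof.
move=> fal inv; have H := lie_derivative_invariant actP p a [:: u1; u2; u3] fal inv.
have S (F : nat -> R^o) : \sum_(i < 3) F i = F 0%N + (F 1%N + F 2%N).
  by rewrite !big_ord_recl big_ord0 addr0.
exact (etrans (congr1 (fun q : R^o => _ + q) (esym (S (lie_term al a p [:: u1; u2; u3])))) H).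
Qed.

Lemma lie2 al a p u1 u2 : is_form al -> invariant_form act al ->
  'D_(v a p) (fun t => form_loc 'c_p al t [:: u1; u2]) 'z_p +
  (al p [:: 'D_u1 (locv act 'c_p a) 'z_p; u2] +
   al p [:: u1; 'D_u2 (locv act 'c_p a) 'z_p]) = 0.
Proof.
move=> fal inv; have H := lie_derivative_invariant actP p a [:: u1; u2] fal inv.
have S (F : nat -> R^o) : \sum_(i < 2) F i = F 0%N + F 1%N by rewrite !big_ord_recl big_ord0 addr0.
exact (etrans (congr1 (fun q : R^o => _ + q) (esym (S (lie_term al a p [:: u1; u2])))) H).
Qed.

Lemma cartan3_at al a b p u w : is_form al -> invariant_form act al ->
  dform (Defs.contract (v b) (Defs.contract (v a) al)) p [:: u; w] =
  - al p [:: v (lbracket a b) p; u; w] + dform al p [:: v a p; v b p; u; w] :> R.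
Proof.
move=> fal inv.
have H1 := lie3 a p (v b p) u w fal inv; have H2 := lie3 b p (v a p) u w fal inv.
have S1 := form_swap p [::] [:: w] ('D_u (locv act 'c_p a) 'z_p) (v b p) fal.
have S2 := form_swap p [::] [:: u] ('D_w (locv act 'c_p a) 'z_p) (v b p) fal.
have S3 := form_swap p [:: v b p] [::] ('D_w (locv act 'c_p a) 'z_p) u fal.
have S4 := form_swap p [:: v a p] [::] ('D_w (locv act 'c_p b) 'z_p) u fal.
exact (etrans (dform2 _ _ _ _) (etrans
  (cartan3_arith (derive_contract2 a b p [:: w] u fal) (derive_contract2 a b p [:: u] w fal)
     (form_bracket a b p [:: u; w] fal) H1 H2 S1 S2 S3 S4)
  (esym (congr1 (fun q : R^o => - al p [:: v (lbracket a b) p; u; w] + q) (dform4 _ _ _ _ _ _))))).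
Qed.

Lemma cartan2_at al a b p u : is_form al -> invariant_form act al ->
  dform (Defs.contract (v b) (Defs.contract (v a) al)) p [:: u] =
  - al p [:: v (lbracket a b) p; u] + dform al p [:: v a p; v b p; u] :> R.
Proof.
move=> fal inv.
have H1 := lie2 a p (v b p) u fal inv; have H2 := lie2 b p (v a p) u fal inv.
have S1 := form_swap p [::] [::] ('D_u (locv act 'c_p a) 'z_p) (v b p) fal.
exact (etrans (dform1 _ _ _) (etrans
  (cartan2_arith (derive_contract2 a b p [::] u fal) (form_bracket a b p [:: u] fal) H1 H2 S1)
  (esym (congr1 (fun q : R^o => - al p [:: v (lbracket a b) p; u] + q) (dform3 _ _ _ _ _))))).
Qed.

(** By d iota_b = L_b - iota_b d and L_b iota_a = iota_[b,a] + iota_a L_b, together with L_a al =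
    L_b al = 0. The proof is a computation in coordinates on lists of length 2; on other lists all
    terms vanish by degree. *)
Lemma cartan3 al a b : Omega P 3 al -> invariant_form act al ->
  dform (Defs.contract (v b) (Defs.contract (v a) al)) =
  - Defs.contract (v (lbracket a b)) al +
  Defs.contract (v b) (Defs.contract (v a) (dform al)).
Proof.
move=> oal inv; have fal := Omega_form oal; have [_ z] := oal.
have o1 := Omega_contract actP b (Omega_contract actP a oal).
apply/funext => p; apply/funext => s.
rewrite -[RHS]/(- al p (v (lbracket a b) p :: s) + dform al p (v a p :: v b p :: s)).
have [|ns] := eqVneq (size s) 2; first by case: s => [//|u [//|w []//]] _; exact: cartan3_at.
by rewrite (dform_degree p o1)// (dform_degree p oal)//= z//= oppr0 addr0.
Qed.

Lemma cartan2 al a b : Omega P 2 al -> invariant_form act al ->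
  dform (Defs.contract (v b) (Defs.contract (v a) al)) =
  - Defs.contract (v (lbracket a b)) al +
  Defs.contract (v b) (Defs.contract (v a) (dform al)).
Proof.
move=> oal inv; have fal := Omega_form oal; have [_ z] := oal.
have o1 := Omega_contract actP b (Omega_contract actP a oal).
apply/funext => p; apply/funext => s.
rewrite -[RHS]/(- al p (v (lbracket a b) p :: s) + dform al p (v a p :: v b p :: s)).
have [|ns] := eqVneq (size s) 1; first by case: s => [//|u []//] _; exact: cartan2_at.
by rewrite (dform_degree p o1)// (dform_degree p oal)//= z//= oppr0 addr0.
Qed.

Section EquivariantCochain.
Variables (m : EG -> diff_form P) (k : nat).
Hypotheses (lm : linear m) (om : forall x, Omega P k (m x))
  (em : forall g x, m (Ad g x) = pullback (act (linv g)) (m x)).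

Lemma pullback_actV g (be : diff_form P) : pullback (act g) (pullback (act (linv g)) be) = be.
Proof.
have [sA a1 aM] := actP; apply/funext => p; apply/funext => s.
have V q : act (linv g) (act g q) = q by rewrite -aM lmulVg a1.
rewrite /pullback V -map_comp; congr (be p _); rewrite -[RHS]map_id; apply: eq_map => u /=.
have sg h q : smooth_map_at (act h) q by exact: (smooth_map2_right h q sA).
rewrite -(tmap_comp u (sg g p) (sg (linv g) (act g p))).
by rewrite (_ : act (linv g) \o act g = id) ?tmap_id//; apply/funext => q /=; exact: V.
Qed.

Lemma cochain_basis x p s : m x p s = \sum_j x ord0 j *: m (delta_mx ord0 j) p s.
Proof. by rewrite {1}(lin_sumZ x lm) !fct_sumE. Qed.

(** The infinitesimal form of equivariance: m [x, y] is the Lie derivative of m y along v_x, written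
    in coordinates. *)
Lemma cochain_bracket x y p s :
  m (lbracket x y) p s =
  'D_(v x p) (fun t => form_loc 'c_p (m y) t s) 'z_p +
  \sum_(i < size s) m y p (set_nth 0 s i ('D_(nth 0 s i) (locv act 'c_p x) 'z_p)).
Proof.
(* With these coefficients the sum of C j g times the pullback by g of m (b_j) is the pullback of m
   (Ad g y), which equals m y for every g. The derivative of C j is the j-th coordinate of [x, y] by
   [Ad_derive]. *)
pose C (j : 'I_(mdim G)) (g : G) : R^o := Ad g y ord0 j.
pose c1 := chart_at G (lone G).
have aro := chart_around_at (lone G).
have sAd := Ad_smooth y aro.
have lc (j : 'I_(mdim G)) : linear (fun u : EG => u ord0 j : R^o) by move=> a u w; rewrite !mxE.
have cc (j : 'I_(mdim G)) : continuous (fun u : EG => u ord0 j : R^o).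
  by move=> u; exact: (@coord_continuous R 1 (mdim G) ord0 j u).
have sC j : smooth_at (C j \o psi c1) (phi c1 (lone G)).
  exact: (smooth_at_comp sAd (smooth_at_linear _ (lc j) (cc j))).
have fm j : is_form (m (delta_mx ord0 j)) by exact: Omega_form (om _).
have inv g : \sum_j C j g *: pullback (act g) (m (delta_mx ord0 j)) p =
    \sum_j C j (lone G) *: m (delta_mx ord0 j) p.
  apply/funext => l; rewrite !fct_sumE.
  transitivity (pullback (act g) (m (Ad g y)) p l); first by rewrite /pullback cochain_basis.
  rewrite em pullback_actV cochain_basis; apply: eq_bigr => j _.
  by rewrite /C Ad_one.
have := lie_derivative_cochain actP x s fm sC inv.
have -> : \sum_j 'D_x (C j \o psi (chart_at G (lone G))) (phi (chart_at G (lone G)) (lone G)) *: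
   m (delta_mx ord0 j) p s = m (lbracket x y) p s.
  rewrite cochain_basis; apply: eq_bigr => j _; congr (_ *: _).
  have [_] := linear_comp_derive (lc j) (cc j) (smooth_at_is_derive x sAd).
  by rewrite Ad_derive.
move=> ->.
have Cy j : C j (lone G) = y ord0 j by rewrite /C Ad_one.
under eq_bigr do rewrite Cy scalerDr.
rewrite big_split /=; congr (_ + _).
  have N : (fun t => form_loc 'c_p (m y) t s) =
      (fun t => \sum_j y ord0 j *: form_loc 'c_p (m (delta_mx ord0 j)) t s).
    by apply/funext => t; rewrite /form_loc cochain_basis.
  rewrite N; have Dj j := is_deriveZ (y ord0 j) (smooth_at_is_derive (v x p) (form_loc_smooth p s (fm j))).
  by have [_ ->] := is_derive_sumr (index_enum _) Dj.
under [RHS]eq_bigr do rewrite cochain_basis.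
by rewrite exchange_big; apply: eq_bigr => j _; rewrite scaler_sumr.
Qed.
End EquivariantCochain.

(** m [x, y] = L_x (m y) = d iota_x (m y) + iota_x d (m y), where iota_x d (m y) = - iota_x iota_y
    om = iota_y iota_x om. *)
Lemma cochain1_bracket (m : EG -> diff_form P) (om : diff_form P) x y :
  linear m -> (forall x, Omega P 1 (m x)) ->
  (forall g x, m (Ad g x) = pullback (act (linv g)) (m x)) ->
  Omega P 3 om -> (forall x, dform (m x) = - Defs.contract (v x) om) ->
  m (lbracket x y) = dform (Defs.contract (v x) (m y)) +
    Defs.contract (v y) (Defs.contract (v x) om).
Proof.
move=> lm o1 em o3 dm; have [_ z1] := o1 (lbracket x y); have [_ z3] := o3.
apply/funext => p; apply/funext => s.
rewrite -[RHS]/(dform (Defs.contract (v x) (m y)) p s + om p (v x p :: v y p :: s)).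
have [|ns] := eqVneq (size s) 1; last first.
  by rewrite z1// (dform_degree p (Omega_contract actP x (o1 y)))//= z3// add0r.
case: s => [//|u []//] _.
have H := congr1 (fun f : diff_form P => f p [:: v x p; u]) (dm y).
have H' := etrans (esym (dform2 _ _ _ _)) H.
have S := form_swap p [::] [:: u] (v y p) (v x p) (Omega_form o3).
have B1 := cochain_bracket lm o1 em x y p [:: u]; rewrite big_ord1 in B1.
have B2 := etrans (dform1 _ _ _) (derive_contract1 x p [::] u (Omega_form (o1 y))).
exact (cochain1_arith B1 B2 H' S).
Qed.

(** The Leibniz rule for the derivative along v_x of the function m z (v_y), with L_x (m z) = m
    [x, z] and [v_x, v_y] = v_[x,y]. *)
Lemma dform_cochain1 (m : EG -> diff_form P) x y z p :
  linear m -> (forall x, Omega P 1 (m x)) ->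
  (forall g x, m (Ad g x) = pullback (act (linv g)) (m x)) ->
  dform (Defs.contract (v y) (m z)) p [:: v x p] =
  m (lbracket x z) p [:: v y p] + m z p [:: v (lbracket x y) p] :> R.
Proof.
move=> lm o1 em; have fz := Omega_form (o1 z).
have B1 := cochain_bracket lm o1 em x z p [:: v y p]; rewrite big_ord1 in B1.
have B2 := etrans (dform1 _ _ _) (derive_contract1 y p [::] (v x p) fz).
exact (dform_cochain1_arith B2 B1 (form_bracket x y p [::] fz)).
Qed.

Lemma cochain0_bracket (m : EG -> diff_form P) x y p :
  linear m -> (forall x, Omega P 0 (m x)) ->
  (forall g x, m (Ad g x) = pullback (act (linv g)) (m x)) ->
  m (lbracket x y) p [::] = dform (m y) p [:: v x p].
Proof.
by move=> lm o1 em; rewrite dform1 (cochain_bracket lm o1 em) big_ord0 addr0.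
Qed.
End CartanIdentities.

(** * Moment maps *)

(** On a ball inside a chart the mean value theorem makes f constant, so its level sets are open and
    closed. *)
Lemma zero_form_constant (R : realType) (N : manifold R) (f : diff_form N) :
  connected [set: N] -> is_form f -> (forall p u, dform f p [:: u] = 0) ->
  forall p q, f p [::] = f q [::].
Proof.
move=> cN ff df; pose E := 'rV[R]_(mdim N).
have loc p : \forall q \near p, f q [::] = f p [::].
  have cp := chart_around_at p; set c := chart_at N p in cp.
  pose g (t : E) : R^o := form_loc c f t [::].
  (* The differential at q is computed in the preferred chart at q, so a change of charts is needed
     to use it in the chart c around p. *)
  have Dg q u : chart_around c q -> is_derive (phi c q) u g 0.
    move=> cq; have cq' := chart_around_at q; have sid := smooth_map_at_id q.
    have s1 : smooth_at (loc_rep id c (chart_at N q)) (phi c q) := sid.2 c _ cq cq'.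
    have s2 := form_loc_smooth q [::] ff; rewrite -(loc_rep_phi id (chart_at N q) cq) in s2.
    have N1 : \forall t \near phi c q, ((fun t => form_loc (chart_at N q) f t [::]) \o
         loc_rep id c (chart_at N q)) t = g t.
      by apply: filterS (near_psi cq (near_dom cq')) => t ct; rewrite /g /form_loc /loc_rep /= psi_phi.
    apply: (near_eq_is_derive N1).
    pose proof (smooth_at_is_derive u (smooth_at_comp s1 s2)) as D.
    pose proof (derive_comp u s1 s2) as D2; rewrite D2 in D.
    have E0 := df q ('D_u (loc_rep id c (chart_at N q)) (phi c q)).
    rewrite dform1 in E0; move: D; rewrite (loc_rep_phi id (chart_at N q) cq) /=.
    by rewrite E0.
  move: (near_img cp) => /nbhs_ballP[r /= r0 Br].
  have cst t : ball (phi c p) r t -> g t = g (phi c p).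
    move=> bt; have H (s : R) : `|s| <= `|1 : R| -> is_derive (phi c p + s *: (t - phi c p)) (t - phi c p) g 0.
      rewrite normr1 => s1; have bs : ball (phi c p) r (phi c p + s *: (t - phi c p)).
        rewrite -ball_normE /= opprD addrA subrr sub0r normrN normrZ.
        move: bt; rewrite -ball_normE /= distrC => bt.
        by apply: le_lt_trans bt; rewrite ler_piMl.
      by have [q cq Eq] := img_ex cp.1 (Br _ bs); rewrite {1}Eq; exact: Dg.
    have [s s1] := @MVT_dir R E g (phi c p) (t - phi c p) 1 (fun s s1 => @ex_derive _ _ _ _ _ _ _ (H s s1)).
    have E0 : phi c p + (t - phi c p) = t by rewrite addrC subrK.
    have [_ ->] := H s s1; rewrite scale1r E0 mulr0 => /eqP.
    by rewrite subr_eq0 => /eqP.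
  have nb : \forall q \near p, ball (phi c p) r (phi c q).
    by apply: (phi_continuous cp); exact: nbhsx_ballx.
  apply: filterS2 nb (near_dom cp) => q bq cq.
  by have := cst _ bq; rewrite /g /form_loc /= !psi_phi.
move=> p q; pose A := [set t | f t [::] = f q [::]].
have oA : open A.
  by rewrite openE => t At; apply: filterS (loc t) => s E1; rewrite /A /= E1.
have cA : closed A.
  rewrite -[A]setCK; apply: open_closedC; rewrite openE => t At.
  by apply: filterS (loc t) => s st As; apply: At; rewrite /A /= -st.
have -> // : A p.
suff -> : A = [set: N] by [].
apply: cN; first by exists q.
  by exists A => //; rewrite setTI.
by exists A => //; rewrite setTI.
Qed.

Section Moment.
Variables (R : realType) (G : lieGroup R) (P : manifold R) (act : G -> P -> P).
Hypothesis actP : is_action act.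
Local Notation EG := 'rV[R]_(mdim G).
Local Notation v := (fund_field act).
Variable sigma : EG -> 'M[R]_(mdim G).
Hypotheses (lsigma : linear sigma) (bsigma : forall x, ext (@lbracket R G) (sigma x) = x)
  (esigma : forall g x, sigma (Ad g x) = Ad2 g (sigma x)).
Variables (al : diff_form P).

Definition contract2 (be : diff_form P) (a b : EG) : diff_form P :=
  Defs.contract (v b) (Defs.contract (v a) be).

Definition moment (x : EG) : diff_form P := ext (contract2 al) (sigma x).

Lemma contract_fund_linear be : (forall p, multilinear (be p)) ->
  linear (fun a => Defs.contract (v a) be).
Proof.
move=> ml a x y; apply/funext => p; apply/funext => s.
by rewrite -[LHS]/(be p (v (a *: x + y) p :: s)) (fund_field_linear actP) (ml p [::]).
Qed.

Lemma contract2_bilinear be : (forall p, multilinear (be p)) -> bilinear_fun (contract2 be).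
Proof.
move=> ml; split.
  move=> b a x y; apply/funext => p; apply/funext => s.
  by rewrite -[LHS]/(be p (v (a *: x + y) p :: v b p :: s)) (fund_field_linear actP) (ml p [::]).
move=> b a x y; apply/funext => p; apply/funext => s.
by rewrite -[LHS]/(be p ([:: v b p] ++ v (a *: x + y) p :: s)) (fund_field_linear actP) ml.
Qed.

Lemma moment_linear : linear moment.
Proof. by move=> a x y; rewrite /moment lsigma ext_linear. Qed.

Lemma Omega_ext k (beta : EG -> EG -> diff_form P) T :
  (forall a b, Omega P k (beta a b)) -> Omega P k (ext beta T).
Proof.
move=> H; rewrite /ext; elim/big_ind: _ => [|f g Hf Hg|i _]; first exact: Omega0.
  by rewrite -[f]scale1r; exact: Omega_lin.
exact: Omega_sum.
Qed.

Lemma dform_ext k (beta : EG -> EG -> diff_form P) T :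
  (forall a b, Omega P k (beta a b)) ->
  dform (ext beta T) = ext (fun a b => dform (beta a b)) T.
Proof.
move=> H; rewrite /ext.
have E i : \sum_j T i j *: beta (delta_mx ord0 i) (delta_mx ord0 j) =
    1 *: \sum_j T i j *: beta (delta_mx ord0 i) (delta_mx ord0 j) by rewrite scale1r.
under eq_bigr do rewrite E.
rewrite (dform_sum (k := k)) => [|i]; last exact: Omega_sum.
by apply: eq_bigr => i _; rewrite scale1r (dform_sum (k := k)).
Qed.

Lemma moment_Omega k x : Omega P k.+2 al -> Omega P k (moment x).
Proof. by move=> o; apply: Omega_ext => a b; do 2!apply: (Omega_contract actP). Qed.

Lemma pullback_linear (S Q : manifold R) (F : S -> Q) : linear (@pullback R S Q F).
Proof. by []. Qed.

Lemma contract2_equivariant g a b : invariant_form act al ->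
  contract2 al (Ad g a) (Ad g b) = pullback (act (linv g)) (contract2 al a b).
Proof.
move=> inv; apply/funext => p; apply/funext => s.
have T c : v c (act (linv g) p) = tmap (act (linv g)) p (v (Ad g c) p).
  by rewrite tmap_fund_field// AdK.
rewrite -[LHS]/(al p (v (Ad g a) p :: v (Ad g b) p :: s)) -{1}(inv (linv g)).
by rewrite /pullback /contract2 /Defs.contract /= !T.
Qed.

Lemma moment_equivariant g x : (forall p, multilinear (al p)) -> invariant_form act al ->
  moment (Ad g x) = pullback (act (linv g)) (moment x).
Proof.
move=> ml inv; rewrite /moment esigma ext_Ad2; last exact: contract2_bilinear.
rewrite (ext_comp _ _ (@pullback_linear P P _)); apply: ext_eq => a b.
exact: contract2_equivariant.
Qed.

(** The summand is linear in [a, b], and the brackets in sigma(x) add up to x as sigma is a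
    section. *)
Lemma ext_bracket_contract x : (forall p, multilinear (al p)) ->
  ext (fun a b => - Defs.contract (v (lbracket a b)) al) (sigma x) = - Defs.contract (v x) al.
Proof.
move=> ml; pose L (a : EG) : diff_form P := - Defs.contract (v a) al.
have lL : linear L.
  by move=> a y z; rewrite /L (contract_fund_linear ml) opprD scalerN.
by rewrite -[X in _ = - Defs.contract (v X) _]bsigma -[RHS]/(L _) (ext_comp _ _ lL).
Qed.
End Moment.

Lemma ext_add (R : realType) n (W : lmodType R) (b1 b2 : 'rV[R]_n -> 'rV[R]_n -> W) T :
  ext (fun x y => b1 x y + b2 x y) T = ext b1 T + ext b2 T.
Proof.
rewrite /ext -big_split; apply: eq_bigr => i _; rewrite -big_split; apply: eq_bigr => j _ /=.
by rewrite scalerDr.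
Qed.

Section CartanParts.
Variables (R : realType) (G : lieGroup R) (P : manifold R) (act : G -> P -> P).

Lemma cartan_part_linear k (m : cochain G P) : linear m -> (forall x, Omega P k (m x)) ->
  equivariant act m -> cartan_part act 1 k m.
Proof.
(* Only lists of length 1 matter for polynomial degree 1; the value 0 on the others keeps the
   function multilinear on all lists. *)
move=> lm om em; split=> //; exists (fun s => if s is [:: x] then m x else 0); split => //.
  move=> s1 s2 a x y; case: s1 => [|t [|t' s1]] /=; last by rewrite scaler0 addr0.
    by case: s2 => [|? ?]; [exact: lm|rewrite scaler0 addr0].
  by rewrite scaler0 addr0.
by case=> [|x []] => [||? ?]; [exact: Omega0|exact: om|exact: Omega0].
Qed.

Lemma cartan_part_invariant k al : Omega P k al -> invariant_form act al ->
  cartan_part act 0 k (fun=> al).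
Proof.
move=> oal inv; split; last by move=> a x; rewrite inv.
exists (fun s => if s is [::] then al else 0); split => //.
  by move=> s1 s2 a x y; case: s1 => [|t s1] /=; rewrite scaler0 addr0.
by case=> [|? ?]; [exact: oal|exact: Omega0].
Qed.

(** The condition on k covers the two cases needed: k = 3 on N and k = 2 on M. The polynomial parts
    are al in degree 0 and - m in degree 1. *)
Lemma cartan_sub k al (m : cochain G P) : k./2 = 1%N -> Omega P k al -> invariant_form act al ->
  linear m -> (forall x, Omega P (k - 2) (m x)) -> equivariant act m ->
  cartan act k ((fun=> al) - m).
Proof.
move=> k2 oal inv lm om em; exists (fun p => if p is 0%N then (fun=> al) else - m); rewrite k2.
  case=> [|[|//]] _; first by rewrite muln0 subn0; exact: cartan_part_invariant.
  apply: cartan_part_linear.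
  - by move=> a x y; rewrite -[LHS]/(- m (a *: x + y)) lm opprD -scalerN.
  - by move=> x; rewrite muln1 -[(- m) x]/(- m x) -scaleN1r -[_ *: _]addr0; apply: Omega_lin; [exact: om|exact: Omega0].
  - by move=> a x; rewrite -[LHS]/(- m (Ad a x)) em.
by rewrite !big_ord_recl big_ord0 addr0.
Qed.
End CartanParts.

Lemma jacobi_arith (R : realType) (D A B C B' C' o o' o'' : R) :
  D = B + A -> C = D + o -> B = - B' -> C = - C' -> o = - o' -> o' = - o'' ->
  A - B' + C' = - o''.
Proof. by lra. Qed.

(** * The relative moment map *)

Section Relative.
Variables (R : realType) (G : lieGroup R) (N M : manifold R) (F : M -> N).
Variables (aN : G -> N -> N) (aM : G -> M -> M).
Hypotheses (smoothF : smooth_map F) (actF : map_action F aN aM).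
Local Notation EG := 'rV[R]_(mdim G).
Local Notation vN := (fund_field aN).
Local Notation vM := (fund_field aM).
Implicit Types (x y z a b : EG) (p : M) (q : N).

Let actN : is_action aN. Proof. by case: actF. Qed.
Let actM : is_action aM. Proof. by case: actF. Qed.

(** Differentiate F (g p) = g F p at the unit: the fundamental fields form an F-pair. *)
Lemma map_fund_field x p : tmap F p (vM x p) = vN x (F p).
Proof.
have [sM e1 _] := actM; have [sN _ _] := actN; have [_ _ FE] := actF.
rewrite (fund_fieldE x p actM) (fund_fieldE x (F p) actN).
have sF p' : smooth_map_at F p' by exact: smooth_map_loc.
rewrite (linear_funN (tmap_linear (sF p))); congr (- _).
have -> : (fun g => aN g (F p)) = F \o (fun g => aM g p) by apply/funext => g; rewrite -FE.
have s1 : smooth_map_at (fun g => aM g p) (lone G) by exact: (smooth_map2_left (lone G) p sM).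
by rewrite (tmap_comp x s1 (sF _)) e1.
Qed.

Lemma contract2_pullback (al : diff_form N) a b :
  contract2 aM (pullback F al) a b = pullback F (contract2 aN al a b).
Proof.
apply/funext => p; apply/funext => s.
by rewrite /contract2 /Defs.contract /pullback /= !map_fund_field.
Qed.

Variable w : rform N M.
Hypotheses (plectic : pre_2_plectic F w) (preserved : preserves aN aM w).
Variable sigma : EG -> 'M[R]_(mdim G).
Hypotheses (lsigma : linear sigma) (bsigma : forall x, ext (@lbracket R G) (sigma x) = x)
  (esigma : forall g x, sigma (Ad g x) = Ad2 g (sigma x)).

Local Notation mu := (moment aN sigma w.1).
Local Notation h := (moment aM sigma w.2).

Let om3 : Omega N 3 w.1. Proof. by case: plectic => -[]. Qed.
Let be2 : Omega M 2 w.2. Proof. by case: plectic => -[]. Qed.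
Let ml1 : forall q, multilinear (w.1 q). Proof. by have [] := Omega_form om3. Qed.
Let ml2 : forall p, multilinear (w.2 p). Proof. by have [] := Omega_form be2. Qed.
Let d1 : dform w.1 = 0. Proof. by case: plectic => _ []. Qed.
Let d2 : dform w.2 = pullback F w.1.
Proof. by case: plectic => _ [_ /eqP]; rewrite subr_eq0 => /eqP. Qed.
Let inv1 : invariant_form aN w.1. Proof. by case: preserved. Qed.
Let inv2 : invariant_form aM w.2. Proof. by case: preserved. Qed.

Let lmu : linear mu. Proof. exact: moment_linear. Qed.
Let lh : linear h. Proof. exact: moment_linear. Qed.
Let omu x : Omega N 1 (mu x). Proof. exact: moment_Omega. Qed.
Let oh x : Omega M 0 (h x). Proof. exact: moment_Omega. Qed.
Let emu g x : mu (Ad g x) = pullback (aN (linv g)) (mu x).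
Proof. exact: moment_equivariant. Qed.
Let eh g x : h (Ad g x) = pullback (aM (linv g)) (h x).
Proof. exact: moment_equivariant. Qed.

Lemma dform_mu x : dform (mu x) = - Defs.contract (vN x) w.1.
Proof.
rewrite /moment (dform_ext (k := 1)) => [|a b]; last by do 2!apply: (Omega_contract actN).
rewrite -(ext_bracket_contract actN bsigma)//; apply: ext_eq => a b.
rewrite /contract2 cartan3// d1 -[RHS]addr0; congr (_ + _).
Qed.

(** Unlike w.1, the form w.2 is not closed: its differential is the pullback of w.1, and the term
    iota_b iota_a d w.2 sums to the pullback of mu x. *)
Lemma dform_h x : dform (h x) = pullback F (mu x) - Defs.contract (vM x) w.2.
Proof.
rewrite addrC {1}/moment (dform_ext (k := 0)) => [|a b]; last by do 2!apply: (Omega_contract actM).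
rewrite -(ext_bracket_contract actM bsigma)// /moment (ext_comp _ _ (@pullback_linear _ _ _ F)).
rewrite -ext_add; apply: ext_eq => a b.
by rewrite /contract2 cartan2// d2 -contract2_pullback.
Qed.

Lemma mu_lbracket x y :
  mu (lbracket x y) = dform (Defs.contract (vN x) (mu y)) + contract2 aN w.1 x y.
Proof. exact: (cochain1_bracket actN x y lmu omu emu om3 dform_mu). Qed.

(** As h has degree 0, h [x, y] is the derivative of h y along v_x, which [dform_h] expresses by mu
    y and w.2. *)
Lemma h_lbracket x y :
  h (lbracket x y) = pullback F (Defs.contract (vN x) (mu y)) + contract2 aM w.2 x y.
Proof.
have [_ z0] := oh (lbracket x y); have [_ z1] := omu y; have [_ z2] := be2.
apply/funext => p; apply/funext => s.
rewrite -[RHS]/(mu y (F p) (vN x (F p) :: [seq tmap F p u | u <- s]) +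
  w.2 p (vM x p :: vM y p :: s)).
case: s => [|u s]; last by rewrite z0// z1// z2// addr0.
rewrite (cochain0_bracket actM x y p lh oh eh) dform_h.
rewrite -[LHS]/(mu y (F p) [:: tmap F p (vM x p)] - w.2 p [:: vM y p; vM x p]).
by rewrite map_fund_field (form_swap p [::] [::] _ _ (Omega_form be2)) opprK.
Qed.

Hypotheses (connectedN : connected [set: N]) (M_nonempty : [set: M] !=set0).

(* The function on the left is locally constant by [mu_lbracket] and vanishes on
   the image of F by [h_lbracket]. *)
Lemma contract_mu x : Defs.contract (vN x) (mu x) = 0.
Proof.
have o := Omega_contract actN x (omu x); have [_ z] := o.
have mu0 : mu 0 = 0 by have := lmu (-1) 0 0; rewrite !scaleN1r !addNr.
have h0 : h 0 = 0 by have := lh (-1) 0 0; rewrite !scaleN1r !addNr.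
have df q u : dform (Defs.contract (vN x) (mu x)) q [:: u] = 0.
  have [_ alt _] := Omega_form om3.
  have := congr1 (fun f : diff_form N => f q [:: u]) (mu_lbracket x x).
  rewrite lbracketxx mu0 => H; apply: etrans (esym H).
  rewrite -[RHS]/(dform (Defs.contract (vN x) (mu x)) q [:: u] + w.1 q [:: vN x q; vN x q; u]).
  by rewrite (alt q [::] [::] [:: u]) addr0.
have [m _] := M_nonempty.
have Fm : Defs.contract (vN x) (mu x) (F m) [::] = 0.
  have [_ alt _] := Omega_form be2.
  have := congr1 (fun f : diff_form M => f m [::]) (h_lbracket x x).
  rewrite lbracketxx h0 => H; apply: etrans (esym H).
  rewrite -[RHS]/(Defs.contract (vN x) (mu x) (F m) [::] + w.2 m [:: vM x m; vM x m]).
  by rewrite (alt m [::] [::] [::]) addr0.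
apply/funext => q; apply/funext => -[|u s]; last by rewrite z.
exact: etrans (zero_form_constant connectedN (Omega_form o) df q (F m)) Fm.
Qed.

(** Polarization of [contract_mu] at x + y. *)
Lemma contract_mu_antisym x y : Defs.contract (vN y) (mu x) = - Defs.contract (vN x) (mu y).
Proof.
have ml u : forall q, multilinear (mu u q) by have [] := Omega_form (omu u).
have add (f : EG -> diff_form N) : linear f -> f (x + y) = f x + f y.
  by move=> lf; have := lf 1 x y; rewrite !scale1r.
have E u : Defs.contract (vN (x + y)) (mu u) =
    Defs.contract (vN x) (mu u) + Defs.contract (vN y) (mu u).
  exact: add _ (contract_fund_linear actN (ml u)).
have S : Defs.contract (vN (x + y)) (mu (x + y)) =
    Defs.contract (vN (x + y)) (mu x) + Defs.contract (vN (x + y)) (mu y).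
  by rewrite (add _ lmu).
have arith (a b c d e f s : diff_form N) : s = e + f -> e = a + b -> f = c + d ->
    s = 0 -> a = 0 -> d = 0 -> b = - c.
  by move=> -> -> -> + a0 d0; rewrite a0 d0 add0r addr0 => /eqP; rewrite addr_eq0 => /eqP.
exact (arith _ _ _ _ _ _ _ S (E x) (E y) (contract_mu _) (contract_mu x) (contract_mu y)).
Qed.

(** The value of d iota_y (mu z) on v_x is computed by the Leibniz rule ([dform_cochain1]) and by
    [mu_lbracket]. Antisymmetry then moves the brackets from mu into the contracting fields. *)
Lemma contract_mu_jacobi x y z q :
  mu z q [:: vN (lbracket x y) q] - mu y q [:: vN (lbracket x z) q] +
    mu x q [:: vN (lbracket y z) q] = - w.1 q [:: vN x q; vN y q; vN z q].
Proof.
have H1 := dform_cochain1 actN x y z q lmu omu emu.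
have H2 := congr1 (fun f : diff_form N => f q [:: vN x q]) (mu_lbracket y z).
have H3 := congr1 (fun f : diff_form N => f q [::]) (contract_mu_antisym (lbracket x z) y).
have H4 := congr1 (fun f : diff_form N => f q [::]) (contract_mu_antisym (lbracket y z) x).
have S1 := form_swap q [:: vN y q] [::] (vN z q) (vN x q) (Omega_form om3).
have S2 := form_swap q [::] [:: vN z q] (vN y q) (vN x q) (Omega_form om3).
exact (jacobi_arith H1 H2 H3 H4 S1 S2).
Qed.

Local Notation mom := ((mu, h) : rcochain G N M).

Lemma moment_one_step_extension : one_step_extension F aN aM w mom.
Proof.
split.
- by split; [exact: cartan_part_linear|exact: cartan_part_linear].
- by split; [exact: cartan_sub|exact: cartan_sub].
have sub (P : manifold R) k l al be : Omega P k al -> Omega P l be ->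
    dform (al - be) = dform al - dform be.
  move=> oa ob; rewrite addrC -scaleN1r dform_lin; last 2 first.
  - exact: Omega_form ob.
  - exact: Omega_form oa.
  by rewrite scaleN1r addrC.
congr pair; apply/funext => x.
  rewrite -[LHS]/(dform (w.1 - mu x) - (Defs.contract (vN x) w.1 - Defs.contract (vN x) (mu x))).
  by rewrite (sub _ _ _ _ _ om3 (omu x)) d1 dform_mu contract_mu subr0 sub0r opprK subrr.
rewrite -[LHS]/((pullback F w.1 - pullback F (mu x)) - (dform (w.2 - h x) -
  (Defs.contract (vM x) w.2 - Defs.contract (vM x) (h x)))).
rewrite (sub _ _ _ _ _ be2 (oh x)) d2 dform_h (contract0 aM x (oh x)) subr0.
have arith (a m i : diff_form M) : (a - m) - ((a - (m - i)) - i) = 0.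
  by rewrite (opprB m i) (addrCA a i) [i + _]addrC addrK subrr.
exact: arith.
Qed.

Lemma moment_homotopy : homotopy_moment_map F aN aM w
  (fun x => rcochain_at mom x)
  (fun x y => iotaF (rfund_field aN aM x) (rcochain_at mom y)).
Proof.
(* The component of f_2 on M would have degree -1: it contracts the 0-form h y and is therefore
   0. *)
have -> : (fun x y => iotaF (rfund_field aN aM x) (rcochain_at mom y)) =
    (fun x y => (Defs.contract (vN x) (mu y), 0)).
  by apply/funext => x; apply/funext => y; rewrite /iotaF /= (contract0 aM x (oh y)) oppr0.
have ml u q : multilinear (mu u q) by have [] := Omega_form (omu u).
have pl (V W : lmodType R) (f : EG -> V) (g : EG -> W) : linear f -> linear g ->
    linear (fun x => (f x, g x)) by move=> lf lg a x y; rewrite lf lg.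
have l0 : linear (fun _ : EG => 0 : diff_form M) by move=> a x y; rewrite scaler0 addr0.
split.
- split; first exact: pl.
  by move=> x; split; [exact: omu|exact: oh].
- split.
  + move=> x; apply: (pl _ _ (fun y => Defs.contract (vN x) (mu y)) _ _ l0) => a y z.
    by rewrite lmu.
  + by move=> y; exact (pl _ _ _ _ (contract_fund_linear actN (ml y)) l0).
  + by move=> x; rewrite contract_mu.
  + by move=> x y; split => //; exact: (Omega_contract actN x (omu y)).
- move=> x; congr pair; first exact: dform_mu.
  by rewrite /= dform_h opprB addrCA subrr addr0 opprK.
- move=> x y; congr pair; first exact: mu_lbracket.
  rewrite /= h_lbracket dform0 subr0; congr (_ + _).
  by apply/funext => p; apply/funext => s; rewrite -[RHS]/(- - w.2 p _) opprK.
move=> x y z; congr pair; last first.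
  have [_ z2] := be2; rewrite /= subrr addr0.
  apply/funext => p; apply/funext => s.
  by rewrite -[RHS]/(- - - - w.2 p [:: vM x p, vM y p, vM z p & s]) z2// !oppr0.
apply/funext => q; apply/funext => -[|u s]; first exact: contract_mu_jacobi.
have z3 := (om3 : Omega N 3 w.1).2; have z1 a := (omu a : Omega N 1 (mu a)).2.
rewrite -[LHS]/(mu z q [:: vN (lbracket x y) q, u & s] - mu y q [:: vN (lbracket x z) q, u & s]
  + mu x q [:: vN (lbracket y z) q, u & s]).
rewrite -[RHS]/(- w.1 q [:: vN x q, vN y q, vN z q, u & s]) z3//.
by rewrite (z1 x)// (z1 y)// (z1 z)// subrr addr0 oppr0.
Qed.
End Relative.
Theorem proposition7p5 (R : realType) (G : lieGroup R) (N M : manifold R)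
    (F : M -> N) (aN : G -> N -> N) (aM : G -> M -> M) (w : rform N M)
    (compactG : compact [set: G])
    (perfectG : derived_algebra G = [set: lieAlg G])
    (smoothF : smooth_map F)
    (actF : map_action F aN aM)
    (w_plectic : pre_2_plectic F w)
    (w_preserved : preserves aN aM w)
    (connectedN : connected [set: N])
    (M_nonempty : [set: M] !=set0) :
  exists mu : rcochain G N M,
    one_step_extension F aN aM w mu /\
    homotopy_moment_map F aN aM w
      (fun x => rcochain_at mu x)
      (fun x y => iotaF (rfund_field aN aM x) (rcochain_at mu y)).
Proof.
have [sigma [ls bs es]] := equivariant_section compactG perfectG.
exists (moment aN sigma w.1, moment aM sigma w.2); split.
  exact: moment_one_step_extension.
exact: moment_homotopy.
Qed.
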